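(* In the setting and with the truncated Euler–Maruyama scheme described in the context, assume (A1) and (A2). Then there is a constant $L>0$ such that $$\sup_{\Delta\in(0,1]}\ \sup_{k\ge-N}\ \mathbb E|Y^\Delta(t_k)|^p\le L,$$ where the supremum over $\Delta$ is over all admissible step sizes $\Delta=\tau/N$, $N\ge\tau$ an integer, and $p$ is the exponent in (A2).
   Context: Setting: $\tau>0$; $\mathcal C=C([-\tau,0];\mathbb R^n)$ with sup norm $\|\cdot\|$; $|\cdot|$ is the Euclidean norm on vectors and the trace norm on matrices; $B$ is a $d$-dimensional Brownian motion on a filtered probability space with the usual conditions; $f:\mathcal C\to\mathbb R^n$, $g:\mathcal C\to\mathbb R^{n\times d}$; $\xi\in\mathcal C$ is the initial datum of the SFDE $\mathrm dx(t)=f(x_t)\mathrm dt+g(x_t)\mathrm dB(t)$, $x(t)=\xi(t)$ on $[-\tau,0]$. $\mathcal W$: bounded Borel $\rho:[-\tau,0]\to[0,\infty)$ with $\int_{-\tau}^0\rho=1$. (A1): for each $\ell>0$ there is $R_\ell>0$ with $|f(\phi)-f(\bar\phi)|\vee|g(\phi)-g(\bar\phi)|\le R_\ell(|\phi(0)-\bar\phi(0)|+\frac1\tau\int_{-\tau}^0|\phi-\bar\phi|\mathrm d\theta)$ whenever $\|\phi\|\vee\|\bar\phi\|\le\ell$. (A2): there are $p\ge2$, $\varrho>0$, $a_1,a_2,a_3>0$ with $a_2>a_3$ and $\rho_1\in\mathcal W$ with $2\phi(0)^Tf(\phi)+(p-1)|g(\phi)|^2\le a_1(1+|\phi(0)|^2+\frac1\tau\int_{-\tau}^0|\phi|^2\mathrm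 d\theta)-a_2|\phi(0)|^{2+\varrho}+a_3\int_{-\tau}^0|\phi(\theta)|^{2+\varrho}\rho_1(\theta)\mathrm d\theta$ for all $\phi\in\mathcal C$. Scheme: let $\Psi(\phi,\bar\phi)=|\phi(0)-\bar\phi(0)|^2+\frac1\tau\int_{-\tau}^0|\phi-\bar\phi|^2\mathrm d\theta$. Fix a strictly increasing continuous $\Gamma:[1,\infty)\to[0,\infty)$ with $\Gamma(l)\to\infty$ and $\sup\{\frac{|f(\phi)-f(\bar\phi)|}{\Psi(\phi,\bar\phi)^{1/2}}\vee\frac{|g(\phi)-g(\bar\phi)|^2}{\Psi(\phi,\bar\phi)}:\|\phi\|\vee\|\bar\phi\|\le l,\phi\ne\bar\phi\}\le\Gamma(l)$ for $l\ge1$; $\Gamma^{-1}$ its inverse on $[\Gamma(1),\infty)$. $K=\Gamma(1)\vee|f(\mathbf 0)|\vee|g(\mathbf 0)|^2$, and $\lambda\in(0,1/2)$ is fixed. Step size $\Delta=\tau/N$ with integer $N\ge\tau$, $t_k=k\Delta$; $\Lambda(x)=(|x|\wedge\Gamma^{-1}(K\Delta^{-\lambda}))x/|x|$ ($x/|x|:=0$ if $x=0$). $\breve Y^\Delta(t_k)=\xi(t_k)$, $k=-N,\dots,0$; $Y^\Delta(t_k)=\Lambda(\breve Y^\Delta(t_k))$, $k\ge-N$; $\breve Y^\Delta(t_{k+1})=Y^\Delta(t_k)+f(\bar Y^\Delta_{t_k})\Delta+g(\bar Y^\Delta_{t_k})(B(t_{k+1})-B(t_k))$, $k\ge0$, where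 $\bar Y^\Delta_{t_k}(\theta)=\frac{(j+1)\Delta-\theta}{\Delta}Y^\Delta(t_{k+j})+\frac{\theta-j\Delta}{\Delta}Y^\Delta(t_{k+j+1})$ for $\theta\in[j\Delta,(j+1)\Delta]$, $j=-N,\dots,-1$. *)

(* Defs.v *)
From HB Require Import structures.
From mathcomp Require Import all_boot all_order all_algebra.
From mathcomp Require Import all_classical all_reals all_analysis.
Set Implicit Arguments. Unset Strict Implicit. Unset Printing Implicit Defensive.
Import Order.TTheory GRing.Theory Num.Theory.
Import numFieldNormedType.Exports.
Local Open Scope classical_set_scope.
Local Open Scope ring_scope.

Definition vnorm {R : realType} {n : nat} (x : 'cV[R]_n) : R :=
  Num.sqrt (\sum_(i < n) x i 0 ^+ 2).

Definition mnorm {R : realType} {n d : nat} (A : 'M[R]_(n, d)) : R :=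
  Num.sqrt (\tr (A^T *m A)).

(* An element of C is represented by a function R -> R^n that is continuous
   on [-tau,0]; its values outside [-tau,0] are irrelevant. *)
Definition in_C {R : realType} {n : nat} (tau : R) (phi : R -> 'cV[R]_n) : Prop :=
  forall i : 'I_n, {within `[-tau, 0], continuous (fun th => phi th i 0)}.

Definition supnorm_le {R : realType} {n : nat} (tau : R) (phi : R -> 'cV[R]_n) (l : R) : Prop :=
  forall th, -tau <= th <= 0 -> vnorm (phi th) <= l.

Definition Iseg {R : realType} (tau : R) (h : R -> R) : R :=
  (\int[@lebesgue_measure R]_(th in `[-tau, 0]) h th)%R.

Definition Psi {R : realType} {n : nat} (tau : R) (phi phi' : R -> 'cV[R]_n) : R :=
  vnorm (phi 0 - phi' 0) ^+ 2 + tau^-1 * Iseg tau (fun th => vnorm (phi th - phi' th) ^+ 2).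

Definition inW {R : realType} (tau : R) (rho : R -> R) : Prop :=
  [/\ measurable_fun `[-tau, 0] rho,
      (forall th, -tau <= th <= 0 -> 0 <= rho th),
      (exists M : R, forall th, -tau <= th <= 0 -> rho th <= M)
    & Iseg tau rho = 1].

Definition A1 {R : realType} {n d : nat} (tau : R)
    (f : (R -> 'cV[R]_n) -> 'cV[R]_n) (g : (R -> 'cV[R]_n) -> 'M[R]_(n, d)) : Prop :=
  forall l : R, 0 < l -> exists Rl : R, 0 < Rl /\
    forall phi phi' : R -> 'cV[R]_n, in_C tau phi -> in_C tau phi' ->
      supnorm_le tau phi l -> supnorm_le tau phi' l ->
      let rhs := Rl * (vnorm (phi 0 - phi' 0)
                       + tau^-1 * Iseg tau (fun th => vnorm (phi th - phi' th))) in
      Num.max (vnorm (f phi - f phi')) (mnorm (g phi - g phi')) <= rhs.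

Definition A2 {R : realType} {n d : nat} (tau : R)
    (f : (R -> 'cV[R]_n) -> 'cV[R]_n) (g : (R -> 'cV[R]_n) -> 'M[R]_(n, d))
    (p varrho a1 a2 a3 : R) (rho1 : R -> R) : Prop :=
  2 <= p /\ 0 < varrho /\ 0 < a1 /\ 0 < a2 /\ 0 < a3 /\ a3 < a2 /\ inW tau rho1 /\
    forall phi : R -> 'cV[R]_n, in_C tau phi ->
      2 * ((phi 0)^T *m f phi) 0 0 + (p - 1) * mnorm (g phi) ^+ 2
      <= a1 * (1 + vnorm (phi 0) ^+ 2 + tau^-1 * Iseg tau (fun th => vnorm (phi th) ^+ 2))
         - a2 * powR (vnorm (phi 0)) (2 + varrho)
         + a3 * Iseg tau (fun th => powR (vnorm (phi th)) (2 + varrho) * rho1 th).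

Definition Gamma_ok {R : realType} {n d : nat} (tau : R)
    (f : (R -> 'cV[R]_n) -> 'cV[R]_n) (g : (R -> 'cV[R]_n) -> 'M[R]_(n, d))
    (Gam : R -> R) : Prop :=
  [/\ (forall l, 1 <= l -> 0 <= Gam l),
      (forall l l', 1 <= l -> l < l' -> Gam l < Gam l'),
      {within `[1, +oo[, continuous Gam},
      Gam x @[x --> +oo] --> +oo &
      forall l, 1 <= l -> forall phi phi' : R -> 'cV[R]_n,
        in_C tau phi -> in_C tau phi' ->
        supnorm_le tau phi l -> supnorm_le tau phi' l ->
        (exists th, -tau <= th <= 0 /\ phi th != phi' th) ->
        Num.max (vnorm (f phi - f phi') / Num.sqrt (Psi tau phi phi'))
                (mnorm (g phi - g phi') ^+ 2 / Psi tau phi phi') <= Gam l].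

Definition Ginv_ok {R : realType} (Gam Gaminv : R -> R) : Prop :=
  forall y, Gam 1 <= y -> 1 <= Gaminv y /\ Gam (Gaminv y) = y.

Section BM.
Context {R : realType} {dO : measure_display} {Omega : measurableType dO}.
Variable P : probability Omega R.

Definition mutually_independent (I : finType) (X : I -> Omega -> R) : Prop :=
  forall A : I -> set R, (forall i, measurable (A i)) ->
    fine (P [set w | forall i, A i (X i w)]) = \prod_(i : I) fine (P (X i @^-1` A i)).

Definition is_BM (d : nat) (B : R -> Omega -> 'cV[R]_d) : Prop :=
  [/\ (forall t, 0 <= t -> forall i : 'I_d, measurable_fun setT (fun w => B t w i 0)),
      {ae P, forall w, B 0 w = 0},
      {ae P, forall w, forall i : 'I_d,
          {within `[0, +oo[, continuous (fun t => B t w i 0)}},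
      (forall s t, 0 <= s -> s < t -> forall i : 'I_d, forall A : set R, measurable A ->
          P [set w | A ((B t w - B s w) i 0)] = normal_prob 0 (Num.sqrt (t - s)) A) &
      (forall (m : nat) (ts : nat -> R), 0 <= ts 0%N ->
          (forall j, (j < m)%N -> ts j < ts j.+1) ->
          mutually_independent
            (fun q : 'I_m * 'I_d => fun w => (B (ts q.1.+1) w - B (ts q.1) w) q.2 0))].
End BM.

Section Scheme.
Context {R : realType} {n d : nat} {Omega : Type}.
Variables (tau : R) (N : nat)
  (f : (R -> 'cV[R]_n) -> 'cV[R]_n) (g : (R -> 'cV[R]_n) -> 'M[R]_(n, d))
  (xi : R -> 'cV[R]_n) (Gam Gaminv : R -> R) (lam : R)
  (B : R -> Omega -> 'cV[R]_d) (w : Omega).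

Definition stepsize : R := tau / N%:R.

Definition Kconst : R :=
  Num.max (Gam 1) (Num.max (vnorm (f (fun _ => 0))) (mnorm (g (fun _ => 0)) ^+ 2)).

Definition Trunc (x : 'cV[R]_n) : 'cV[R]_n :=
  if x == 0 then 0
  else (Num.min (vnorm x) (Gaminv (Kconst * powR stepsize (- lam))) / vnorm x) *: x.

(* Piecewise linear interpolation \bar Y_{t_k}; [h (N + i)] stores Y(t_i),
   i >= -N.  For theta in [j Delta, (j+1) Delta], j = -N..-1. *)
Definition Ybar (h : nat -> 'cV[R]_n) (k : nat) (th : R) : 'cV[R]_n :=
  let j : int := Num.max (- (N%:Z)) (Num.min (Num.floor (th / stepsize)) (-1)) in
  let jn : nat := `|(j + N%:Z)%R|%N in
  (((j + 1)%:~R * stepsize - th) / stepsize) *: h (k + jn)%N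
  + ((th - j%:~R * stepsize) / stepsize) *: h (k + jn).+1.

(* hist m i = Y(t_{i-N}) for i <= N + m *)
Fixpoint hist (m : nat) : nat -> 'cV[R]_n :=
  match m with
  | 0%N => fun i => Trunc (xi ((i%:R - N%:R) * stepsize))
  | m'.+1 => let h := hist m' in
      fun i => if (i <= N + m')%N then h i
               else Trunc (h (N + m')%N + stepsize *: f (Ybar h m')
                      + g (Ybar h m') *m (B (m'.+1%:R * stepsize) w - B (m'%:R * stepsize) w))
  end.

Definition Yscheme (k : int) : 'cV[R]_n :=
  let i := `|(k + N%:Z)%R|%N in hist i i.
End Scheme.

(* Main.v *)
(* With q = p/2 and V(x) = (1+|x|^2)^q, symmetrising over the sign of the
   Brownian increment in a second order Taylor estimate gives
     E[V(Y_{k+1}) | F_k] <= V(Y_k) + Delta (q A^{q-1} (2 x.f + (p-1)|g|^2) + remainder),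
   with x = Y_k and A = 1+|x|^2.  Since f and g are taken at states bounded by the
   truncation level, |f|^2 and |g|^2 are at most Delta^{-2 lam}, resp. Delta^{-lam}, times
   1 + Psi(phi,0), and lam < 1/2 makes the remainder at most of the order of
   (1 + Psi)^q, up to a small multiple of the a_3-integral of (A2) when p < 4.
   Young's inequality turns (A2) into the delayed recursion
     e_{k+1} <= e_k + Delta (- b_2 m_k + sum_j w_j m_{k-N+j} + C),  sum_j w_j < b_2,
   where e_k = E V(Y_k) and m_k is the moment of A of order q + varrho/2 >= q; the
   w_j come from writing the interpolation as a sum of hat functions.  A Lyapunov
   functional with geometrically growing weights then bounds e_k uniformly in k and
   Delta.  The finitely many large step sizes are covered by the truncation bound. *)
Require Import Defs.
From HB Require Import structures.
From mathcomp Require Import all_boot all_order all_algebra.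
From mathcomp Require Import all_classical all_reals all_analysis.
From mathcomp Require Import measurable_realfun ring lra.
Set Implicit Arguments. Unset Strict Implicit. Unset Printing Implicit Defensive.
Import Order.TTheory GRing.Theory Num.Theory.
Import numFieldNormedType.Exports.
Local Open Scope classical_set_scope.
Local Open Scope ring_scope.

(** * Real powers *)

(** The factor [p - 1 = 2 q - 1] in (A2) leaves no slack for [|g|^2], so the one-step estimate must
    be exact to first order in Delta. Averaging over [v] and [-v] achieves this for every real
    [q >= 1]: the odd powers cancel, and E|Gv|^2 is bounded with constant 1. The obstacle is the
    noise remainder for 2 < p < 4. Let [T] bound 1 + Psi(phi,0), delayed values included. The growth
    bound makes [|g|^2] of order [Delta^(-lam) T]; then [(Delta |g|^2)^q] need not be O(Delta), and
    [A^(q-2) (Delta |g|^2)^2] is not controlled by [T^q] when [A] is much smaller than [T]. So (A2)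
    itself is used to bound [|g|^2], either by [T + M] with [M] the a_3-integral, or by |x.f|, for
    which Cauchy-Schwarz supplies the missing factor [A]. Powers [T^q] are harmless: the dissipation
    has order [q + varrho/2 > q]. Only the gap [a_2 - a_3] has to survive, so the small parameter is
    fixed before the large constants. The space C carries no sigma-algebra here; measurability of
    [f] and [g] along the scheme is derived from (A1). *)

Section RealPowers.
Context {R : realType}.
Implicit Types (x y r q A B : R).

Lemma powRN_tangent x r : 0 < x -> 0 <= r -> 1 - r * (x - 1) <= x `^ (- r).
Proof.
move=> x0 r0; rewrite /powR gt_eqF//.
apply: le_trans (expR_ge1Dx _).
have := @le_ln1Dx R (x - 1); rewrite (_ : 1 + (x - 1) = x); last lra.
move=> /(_ _) h; have {}h : ln x <= x - 1 by apply: h; lra.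
by nra.
Qed.

(** Bernoulli's inequality: the previous bound at [x^-1] with exponent [r - 1], multiplied by
    [x]. *)
Lemma powR_tangent x r : 0 < x -> 1 <= r -> 1 + r * (x - 1) <= x `^ r.
Proof.
move=> x0 r1.
have h := @powRN_tangent x^-1 (r - 1) _ _.
have {}h : 1 - (r - 1) * (x^-1 - 1) <= x^-1 `^ (- (r - 1)).
  by apply: h; rewrite ?invr_gt0//; lra.
have e : x * x^-1 `^ (- (r - 1)) = x `^ r.
  rewrite -powR_inv1 ?ltW// -powRrM mulN1r opprK mulr_powRB1//; lra.
rewrite -e; apply: le_trans (ler_wpM2l (ltW x0) h).
have -> : x * (1 - (r - 1) * (x^-1 - 1)) = x - (r - 1) * (x * x^-1 - x) by ring.
rewrite divff ?gt_eqF//; lra.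
Qed.

Lemma invr_second_order u : `|u| <= 1 / 2 -> (1 - u)^-1 <= 1 + u + 2 * u ^+ 2 :> R.
Proof.
move=> /ler_normlP[h1 h2]; have u0 : 0 < 1 - u by lra.
rewrite -[leLHS]mul1r ler_pdivrMr//; nra.
Qed.

(** The power [(1 + y)^(-r)] lies above its tangent [1 - r y]; inverting turns this into an upper
    bound. *)
Let powR_second_order_ge0 r y : 0 <= r -> `|y| <= 1 / 2 -> `|r * y| <= 1 / 2 ->
  (1 + y) `^ r <= 1 + r * y + 2 * (r * y) ^+ 2.
Proof.
move=> r0 y1 ry; apply: le_trans (invr_second_order ry).
have y0 : 0 < 1 + y by move/ler_normlP : y1 => [? ?]; lra.
rewrite -[leLHS]invrK -powRN lef_pV2 ?posrE ?powR_gt0//; last first.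
  by move/ler_normlP : ry => [? ?]; lra.
by apply: le_trans (powRN_tangent y0 r0); rewrite (_ : 1 + y - 1 = y)//; lra.
Qed.

(** Negative exponents are reached by writing [r = a - 1] with [a >= 0] and multiplying the
    expansions of [(1 + y)^a] and [(1 + y)^-1]. The range covers the two exponents in use, [q] and
    [q - 2] with [q >= 1]. *)
Lemma powR_second_order r : -1 <= r -> exists C d : R, [/\ 0 <= C, 0 < d, d <= 1 / 2 &
  forall y, `|y| <= d -> (1 + y) `^ r <= 1 + r * y + C * y ^+ 2].
Proof.
move=> r1; set a := r + 1; have a0 : 0 <= a by rewrite /a; lra.
(* This radius keeps both [|y|] and [|a y|] below 1/2, as the two expansions require. *)
pose d := (2 * (a + 1))^-1.
have da : d * (2 * (a + 1)) = 1 by rewrite mulVf// gt_eqF//; lra.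
have d0 : 0 < d by rewrite invr_gt0; lra.
have d2 : d <= 1 / 2 by nra.
exists ((1 + a + 2 * a ^+ 2) * 4), d; split => //; first by nra.
move=> y yd; have yd2 : `|y| <= 1 / 2 by lra.
have ay : `|a * y| <= 1 / 2 by rewrite normrM (ger0_norm a0); nra.
have h1 := powR_second_order_ge0 a0 yd2 ay.
have := @invr_second_order (- y); rewrite normrN opprK => /(_ yd2) h2.
have y0 : 0 < 1 + y by move/ler_normlP : yd2 => [? ?]; lra.
have -> : (1 + y) `^ r = (1 + y) `^ a * (1 + y)^-1.
  rewrite -powR_inv1 ?ltW// -powRD; first by rewrite /a addrK.
  by apply/implyP => _; rewrite gt_eqF.
have e : (1 + y) `^ a * (1 + y)^-1 <= (1 + a * y + 2 * (a * y) ^+ 2) * (1 + - y + 2 * (- y) ^+ 2).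
  by apply: ler_pM => //; rewrite ?powR_ge0// invr_ge0 ltW.
apply: (le_trans e).
move/ler_normlP : yd2 => [? ?].
have yy : y ^+ 2 <= 1 / 4 by nra.
have y2 := sqr_ge0 y.
have -> : (1 + a * y + 2 * (a * y) ^+ 2) * (1 + - y + 2 * (- y) ^+ 2)
  = 1 + (a - 1) * y + y ^+ 2 * (2 - a + 2 * a ^+ 2 + 2 * a * y - 2 * a ^+ 2 * y + 4 * a ^+ 2 * y ^+ 2) by ring.
have -> : r = a - 1 by rewrite /a; lra.
rewrite lerD2l mulrC; apply: ler_wpM2r => //.
have a2 := sqr_ge0 a; set b := a ^+ 2 in a2 *.
have := mulr_ge0 a2 y2.
have : b * y ^+ 2 <= b / 4 by nra.
nra.
Qed.

Lemma is_derive_powR1D r (s : R) y : 0 < 1 + s * y ->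
  is_derive y (1 : R) (fun y => (1 + s * y) `^ r : R) (s * (r * (1 + s * y) `^ (r - 1))).
Proof.
move=> y0.
have dp : is_derive (1 + s * y) (1 : R) (fun z => z `^ r : R) (r * (1 + s * y) `^ (r - 1)).
  have yin : 1 + s * y \in `]0, +oo[ by rewrite in_itv/= y0.
  have := @powR_derive1 R r _ yin; rewrite derive1E => <-.
  exact/derivableP/derivable_powR.
have dl : is_derive y (1 : R) (fun y => 1 + s * y : R) s.
  by apply: is_derive_eq; rewrite /GRing.scale/=; ring.
have := @is_derive1_comp R (fun z => z `^ r) (fun y => 1 + s * y) y _ _ dp dl.
by rewrite /comp [_ * s]mulrC.
Qed.

Lemma ge0_of_deriv_ge0 (F f : R -> R) d : 0 <= F 0 ->
  (forall y, 0 <= y <= d -> is_derive y (1 : R) F (f y)) ->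
  (forall y, 0 <= y <= d -> 0 <= f y) ->
  forall y, 0 <= y <= d -> 0 <= F y.
Proof.
move=> F0 dF f0 y /andP[y0 yd]; apply: (le_trans F0).
have s z : z \in `]0, d[ -> 0 <= z <= d.
  by rewrite in_itv/= => /andP[? ?]; rewrite !ltW.
apply: (@ger0_derive1_ndecr R F 0 d) => //.
- by move=> z /s zd; have := dF _ zd => -[].
- by move=> z /s zd; have := dF _ zd => -[_ e]; rewrite derive1E e f0.
- apply: derivable_within_continuous => z; rewrite in_itv/= => zd.
  by have := dF _ zd => -[].
Qed.

(** Both sides and their first derivatives agree at 0, so comparing second derivatives is enough;
    that is the second order bound for the exponent [q - 2] at [y] and [- y]. *)
Let powR_sym_fourth_order_near q : 1 <= q -> exists C d : R, [/\ 0 <= C, 0 < d, d <= 1 / 2 &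
  forall y, 0 <= y <= d ->
    (1 + y) `^ q + (1 - y) `^ q <= 2 + q * (q - 1) * y ^+ 2 + C * y ^+ 4].
Proof.
move=> q1; have q2 : -1 <= q - 2 by lra.
have [C [d [C0 d0 d2 hC]]] := powR_second_order q2.
have qq : 0 <= q * (q - 1) by nra.
pose c := q * (q - 1) * C.
have c0 : 0 <= c by exact: mulr_ge0.
exists c, d; split => // y yd; rewrite -subr_ge0.
pose F y := 2 + q * (q - 1) * y ^+ 2 + c * y ^+ 4 - ((1 + 1 * y) `^ q + (1 + (-1) * y) `^ q).
pose F1 y := 2 * (q * (q - 1)) * y + 4 * c * y ^+ 3
   - (1 * (q * (1 + 1 * y) `^ (q - 1)) + (-1) * (q * (1 + (-1) * y) `^ (q - 1))).
pose F2 y := 2 * (q * (q - 1)) + 12 * c * y ^+ 2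
   - (q * (1 * ((q - 1) * (1 + 1 * y) `^ (q - 1 - 1)))
      - q * ((-1) * ((q - 1) * (1 + (-1) * y) `^ (q - 1 - 1)))).
rewrite (_ : _ - _ = F y); last by rewrite /F !mul1r mulN1r.
have p1 z : 0 <= z <= d -> 0 < 1 + 1 * z by move=> /andP[? ?]; lra.
have p2 z : 0 <= z <= d -> 0 < 1 + (-1) * z by move=> /andP[? ?]; lra.
have dF z : 0 <= z <= d -> is_derive z (1 : R) F (F1 z).
  move=> zd; have h1 := is_derive_powR1D q (p1 _ zd).
  have h2 := is_derive_powR1D q (p2 _ zd).
  apply: is_derive_eq; rewrite /F1.
  rewrite /GRing.scale/=; ring.
have dF1 z : 0 <= z <= d -> is_derive z (1 : R) F1 (F2 z).
  move=> zd; have h1 := is_derive_powR1D (q - 1) (p1 _ zd).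
  have h2 := is_derive_powR1D (q - 1) (p2 _ zd).
  apply: is_derive_eq; rewrite /F2.
  rewrite /GRing.scale/=; ring.
apply: (ge0_of_deriv_ge0 _ dF) yd; first by rewrite /F !mulr0 !addr0 powR1 !expr0n/= !mulr0; lra.
apply: (ge0_of_deriv_ge0 _ dF1); first by rewrite /F1 !mulr0 !addr0 powR1 !expr0n/= !mulr0; lra.
move=> z zd.
have zn : `|z| <= d by rewrite ger0_norm; case/andP : zd.
have zn' : `|- z| <= d by rewrite normrN.
have := hC _ zn; have := hC _ zn'; rewrite /F2.
have -> : q - 1 - 1 = q - 2 by lra.
rewrite !mul1r !mulN1r sqrrN.
move: (_ `^ _) (_ `^ _) => u v h1 h2.
have : q * (q - 1) * (u + v) <= q * (q - 1) * (2 + 2 * C * z ^+ 2) by apply: ler_wpM2l => //; lra.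
have : 0 <= c * z ^+ 2 by rewrite mulr_ge0// sqr_ge0.
rewrite /c; lra.
Qed.

(* The odd terms cancel, so the error is of fourth order. *)
Lemma powR_sym_fourth_order q : 1 <= q -> exists C : R, [/\ 0 <= C, (q = 1 -> C = 0) &
  forall y, `|y| <= 1 ->
    (1 + y) `^ q + (1 - y) `^ q <= 2 + q * (q - 1) * y ^+ 2 + C * y ^+ 4].
Proof.
(* For [q = 1] the left side equals 2. The constant 0 obtained here later removes the noise
   remainder when [p = 2]. *)
move=> q1; have [->|qn1] := eqVneq q 1.
  exists 0; split => // y /ler_normlP[? ?].
  rewrite !powRr1; lra.
have [C [d [C0 d0 d2 hC]]] := powR_sym_fourth_order_near q1.
(* Away from 0 both powers are at most [2^q], which a multiple of [y^4 >= d^4] dominates. *)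
pose K := 2 * 2 `^ q / d ^+ 4.
have K0 : 0 <= K by rewrite !mulr_ge0 ?powR_ge0// invr_ge0 exprn_ge0// ltW.
exists (C + K); split; [exact: addr_ge0|by move/eqP; rewrite (negbTE qn1)|].
suff H y : 0 <= y -> y <= 1 ->
    (1 + y) `^ q + (1 - y) `^ q <= 2 + q * (q - 1) * y ^+ 2 + (C + K) * y ^+ 4.
  move=> y; have [y0 y1|y0 y1] := leP 0 y; first by apply: H => //; rewrite -(ger0_norm y0).
  have := H (- y); rewrite opprK addrC => h.
  have -> : y ^+ 2 = (- y) ^+ 2 by rewrite sqrrN.
  have -> : y ^+ 4 = (- y) ^+ 4 by rewrite exprNn -signr_odd/= expr0 mul1r.
  by apply: h; rewrite -?(ltr0_norm y0)// normr_ge0.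
move=> y0 y1; have y4 : 0 <= y ^+ 4 by rewrite exprn_ge0.
have [yd|yd] := leP y d.
  apply: le_trans (hC y _) _; first by rewrite y0.
  by rewrite lerD2l ler_wpM2r// lerDl.
have h1 : (1 + y) `^ q <= 2 `^ q by apply: ge0_ler_powR; rewrite ?nnegrE; lra.
have h2 : (1 - y) `^ q <= 2 `^ q by apply: ge0_ler_powR; rewrite ?nnegrE; lra.
have : 2 * 2 `^ q <= K * y ^+ 4.
  rewrite /K mulrAC ler_pdivlMr ?exprn_gt0// ler_wpM2l ?mulr_ge0 ?powR_ge0//.
  by rewrite lerXn2r ?nnegrE ?(ltW d0) ?(ltW yd).
have : 0 <= C * y ^+ 4 by exact: mulr_ge0.
have : 0 <= q * (q - 1) * y ^+ 2 by rewrite mulr_ge0 ?sqr_ge0//; nra.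
rewrite (_ : (C + K) * y ^+ 4 = C * y ^+ 4 + K * y ^+ 4); last by ring.
move: (K * _) (C * _) (_ * y ^+ 2) h1 h2 => u v w.
move: ((1 + y) `^ q) ((1 - y) `^ q) => z1 z2; lra.
Qed.

End RealPowers.

Section SymmetricStep.
Context {R : realType}.
Implicit Types (x y r q A B a c t m l k : R).

Lemma sqr_normr x : `|x| ^+ 2 = x ^+ 2.
Proof. exact: real_normK (num_real x). Qed.

Lemma powR_succ x r : 0 < x -> x `^ r * x = x `^ (r + 1).
Proof.
move=> x0; rewrite -[X in _ * X]powRr1 ?ltW// -powRD//.
by apply/implyP => _; rewrite gt_eqF.
Qed.

Lemma powR_succ2 x r : 0 < x -> x `^ (r - 2) * x ^+ 2 = x `^ r.
Proof. by move=> x0; rewrite expr2 mulrA !powR_succ//; congr (_ `^ _); lra. Qed.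

Lemma powR_pred x r : 0 < x -> x `^ r / x = x `^ (r - 1).
Proof.
by move=> x0; rewrite -[r in LHS](subrK 1) -powR_succ// mulfK// gt_eqF.
Qed.

Lemma powR_le_scale_neg x y k r : r <= 0 -> 0 < x -> 0 < y -> 0 < k -> y <= k * x ->
  x `^ r <= k `^ (- r) * y `^ r.
Proof.
move=> r0 x0 y0 k0 h.
have h' : y `^ (- r) <= k `^ (- r) * x `^ (- r).
  rewrite -powRM ?(ltW k0) ?(ltW x0)//.
  by apply: ge0_ler_powR => //; rewrite ?nnegrE ?mulr_ge0 ?(ltW k0) ?(ltW x0) ?(ltW y0)//; lra.
rewrite -[X in _ `^ X <= _]opprK -[X in _ * _ `^ X]opprK !(powRN _ (- r)).
by rewrite ler_pdivlMr ?powR_gt0// ler_pdivrMl ?powR_gt0// mulrC.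
Qed.

Lemma powR_le_scale x y k r : 0 <= r -> 0 <= x -> 0 <= y -> 0 <= k -> x <= k * y ->
  x `^ r <= k `^ r * y `^ r.
Proof.
move=> r0 x0 y0 k0 h; rewrite -powRM//.
by apply: ge0_ler_powR; rewrite ?nnegrE ?mulr_ge0.
Qed.

(** Near 0 this is the second order bound, since [(1 + |m|)^(q - 2) >= 1/2] there. Farther out the
    remainder dominates the whole power, and also a negative linear term, which is at least [- q]
    because [m >= -1]. *)
Let powR1D_taylor2 q : 1 < q -> exists C : R, 0 <= C /\
  forall m, -1 <= m -> (1 + m) `^ q <= 1 + q * m + C * ((1 + `|m|) `^ (q - 2) * m ^+ 2).
Proof.
move=> q1; have q0 : -1 <= q by lra.
have [C [d [C0 d0 d2 hC]]] := powR_second_order q0.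
(* For [|m| > d] the first summand comes from [1 + |m| <= (1 + d^-1) |m|]; the second pays for a
   negative [q m]. *)
pose K := (1 + d^-1) ^+ 2 + 2 * q / d ^+ 2.
have dV0 : 0 < d^-1 by rewrite invr_gt0.
have d20 : 0 < d ^+ 2 by rewrite exprn_gt0.
have K10 : 0 <= (1 + d^-1) ^+ 2 by exact: sqr_ge0.
have K20 : 0 <= 2 * q / d ^+ 2 by rewrite divr_ge0 ?(ltW d20)//; lra.
exists (2 * C + K); split; first by rewrite /K; lra.
move=> m m1.
have n0 := normr_ge0 m; have y0 : 0 < 1 + `|m| by lra.
have m2 := sqr_ge0 m.
have half : `|m| <= 1 -> 1 / 2 <= (1 + `|m|) `^ (q - 2).
  move=> h; have [q2|q2] := leP q 2.
    apply: (@le_trans _ _ ((1 + `|m|) `^ (- 1))); last by apply: ler_powR; lra.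
    by rewrite powR_inv1 ?(ltW y0)// mul1r lef_pV2 ?posrE//; lra.
  apply: (@le_trans _ _ ((1 + `|m|) `^ 0)); first by rewrite powRr0; lra.
  by apply: ler_powR; lra.
set P := (1 + `|m|) `^ (q - 2) in half *.
have P0 : 0 <= P by exact: powR_ge0.
have Pm := mulr_ge0 P0 m2.
have [md|md] := leP `|m| d.
  apply: le_trans (hC _ md) _; rewrite lerD2l.
  have := half (le_trans md _); rewrite -/P => /(_ _) h; have {}h : 1 / 2 <= P by apply: h; lra.
  have : m ^+ 2 <= 2 * (P * m ^+ 2) by nra.
  have : 0 <= K * (P * m ^+ 2) by rewrite mulr_ge0//; rewrite /K; lra.
  move: (m ^+ 2) (P * m ^+ 2) => v u; rewrite /K => ? ?.
  have : C * v <= C * (2 * u) by apply: ler_wpM2l.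
  lra.
have s1 : (1 + m) `^ q <= (1 + d^-1) ^+ 2 * (P * m ^+ 2).
  apply: (@le_trans _ _ ((1 + `|m|) `^ q)).
    by apply: ge0_ler_powR; rewrite ?nnegrE ?(ler_norm m)//; have := ler_norm m; lra.
  rewrite -(powR_succ2 q y0) -/P [X in _ <= X]mulrCA ler_wpM2l// -exprMn -[X in _ <= X]sqr_normr.
  rewrite lerXn2r ?nnegrE ?normr_ge0 ?(ltW y0)//.
  rewrite normrM [`|1 + _|]ger0_norm ?addr_ge0 ?(ltW dV0)//.
  rewrite mulrDl mul1r addrC lerD2l mulrC ler_pdivlMr// mul1r ltW//.
have s2 : 0 <= q * m + 2 * q / d ^+ 2 * (P * m ^+ 2).
  have [m0|m0] := leP 0 m.
    by rewrite addr_ge0// mulr_ge0//; lra.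
  have mn : `|m| = - m by rewrite ltr0_norm.
  have := half; rewrite mn => /(_ _) h; have {}h : 1 / 2 <= P by apply: h; lra.
  have md2 : d ^+ 2 <= m ^+ 2.
    by rewrite -[X in _ <= X]sqr_normr lerXn2r ?nnegrE ?normr_ge0 ?ltW.
  have : q <= 2 * q / d ^+ 2 * (P * m ^+ 2).
    rewrite mulrAC ler_pdivlMr//.
    have : d ^+ 2 <= 2 * (P * m ^+ 2) by nra.
    move: (P * _) (d ^+ 2) => u v; nra.
  move: (_ * (P * _)) => u; nra.
have : 0 <= C * (P * m ^+ 2) by exact: mulr_ge0.
rewrite /K; move: s1 s2; move: (P * m ^+ 2) => u; lra.
Qed.

(** Up to constants this is [A^(q-2) m^2] for [|m| <= A] and [|m|^q] beyond. The base [A + |m|]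
    stays away from 0 even when [A + m] does not, which matters for [q < 2]. *)
Definition taylor_rem q A m := (A + `|m|) `^ (q - 2) * m ^+ 2.

Lemma taylor_rem_ge0 q A m : 0 <= taylor_rem q A m.
Proof. by rewrite mulr_ge0 ?powR_ge0 ?sqr_ge0. Qed.

Lemma powR_taylor2 q : 1 < q -> exists C : R, 0 <= C /\
  forall A m, 0 < A -> 0 <= A + m ->
    (A + m) `^ q <= A `^ q + q * A `^ (q - 1) * m + C * taylor_rem q A m.
Proof.
move=> q1; have [C [C0 h]] := powR1D_taylor2 q1.
exists C; split => // A m A0 Am.
have AN : A != 0 by rewrite gt_eqF.
have AV : 0 < A^-1 by rewrite invr_gt0.
have m1 : -1 <= m / A by rewrite ler_pdivlMr//; lra.
have e1 : A + m = A * (1 + m / A) by rewrite mulrDr mulr1 mulrCA divff// mulr1.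
have e2 : A + `|m| = A * (1 + `|m / A|).
  by rewrite normrM (gtr0_norm AV) mulrDr mulr1 mulrCA divff// mulr1.
have p1 : (A + m) `^ q = A `^ q * (1 + m / A) `^ q.
  by rewrite {1}e1 powRM ?(ltW A0)//; lra.
have p2 : (A + `|m|) `^ (q - 2) = A `^ (q - 2) * (1 + `|m / A|) `^ (q - 2).
  by rewrite e2 powRM ?(ltW A0) ?addr_ge0.
rewrite /taylor_rem p1 p2.
apply: le_trans (ler_wpM2l (powR_ge0 _ _) (h _ m1)) _.
rewrite !mulrDr mulr1 -!addrA lerD2l; apply: lerD.
  by rewrite -powR_pred//; lra.
rewrite -(powR_succ2 q A0).
rewrite le_eqVlt; apply/orP; left; apply/eqP.
have -> : m ^+ 2 = A ^+ 2 * (m / A) ^+ 2 by rewrite expr_div_n mulrCA divff ?mulr1// expf_neq0.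
ring.
Qed.

(** For [m >= 0], Bernoulli at [A / (A + m)] bounds [A^r] from below; raising the exponent to
    [max r 1] is allowed because this base is at most 1. *)
Lemma powR_taylor1 r : 0 <= r -> exists C : R, 0 <= C /\
  forall A m, 0 < A -> 0 <= A + m ->
    (A + m) `^ r <= A `^ r + C * ((A + `|m|) `^ (r - 1) * `|m|).
Proof.
move=> r0; pose k := Num.max r 1.
have k1 : 1 <= k by rewrite le_max lexx orbT.
have rk : r <= k by rewrite le_max lexx.
exists k; split => [|A m A0 Am]; first lra.
have [m0|m0] := ltP m 0.
  apply: (@le_trans _ _ (A `^ r)).
    by apply: ge0_ler_powR => //; rewrite ?nnegrE; lra.
  by rewrite lerDl mulr_ge0 ?mulr_ge0 ?powR_ge0 ?normr_ge0//; lra.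
rewrite ger0_norm//; set Y := A + m.
have Y0 : 0 < Y by rewrite /Y; lra.
have z0 : 0 < A / Y by rewrite divr_gt0.
have AY : A / Y <= 1 by rewrite ler_pdivrMr// mul1r /Y; lra.
have e : A / Y - 1 = - (m / Y) by rewrite /Y; field; rewrite gt_eqF// -/Y.
have : 1 - k * (m / Y) <= (A / Y) `^ r.
  apply: (@le_trans _ _ ((A / Y) `^ k)).
    by have := powR_tangent z0 k1; rewrite e; lra.
  by apply: ger_powR => //; rewrite z0.
move=> /(ler_wpM2l (powR_ge0 Y r)).
have -> : Y `^ r * (A / Y) `^ r = A `^ r.
  by rewrite -powRM ?(ltW Y0) ?(ltW z0)// mulrCA divff ?gt_eqF// mulr1.
rewrite -powR_pred//.
have -> : Y `^ r * (1 - k * (m / Y)) = Y `^ r - k * (Y `^ r / Y * m) by ring.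
by rewrite lerBlDr.
Qed.

(** The three conclusions are the three errors of the symmetric step: expanding the [q]-th power at
    [A], replacing the base in the [(q-1)]-st power, and the fourth order term. All are charged to a
    drift remainder in [c] and a noise remainder in [t]. *)
Lemma rem_split q : 1 <= q -> exists C : R, 0 <= C /\
  forall A c t, 0 < A -> 0 < A + c -> 0 <= t ->
   let m := c + t in let K := C * (taylor_rem q A c + taylor_rem q A t) in
   [/\ taylor_rem q A m <= K, (A + `|m|) `^ (q - 2) * t ^+ 2 <= K &
       (A + m) `^ (q - 2) * t ^+ 2 <= K].
Proof.
move=> q1; pose k := 3 `^ `|q - 2| : R.
have k1 : 1 <= k by rewrite /k -[leLHS](powRr0 3) ler_powR//; lra.
exists (40 * k ^+ 2); split; first by rewrite mulr_ge0 ?sqr_ge0.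
move=> A c t A0 Ac t0 m.
set rc := taylor_rem q A c; set rt := taylor_rem q A t => K.
have rc0 : 0 <= rc by exact: taylor_rem_ge0.
have rt0 : 0 <= rt by exact: taylor_rem_ge0.
set X := A + `|m|; have XE : X = A + `|m| by []; have m0 := normr_ge0 m; have c0 := normr_ge0 c.
have X0 : 0 < X by rewrite /X; lra.
have Xc0 : 0 < A + `|c| by lra.
have Xt0 : 0 < A + `|t| by rewrite ger0_norm//; lra.
have b0 : 0 < A + m by rewrite /m; lra.
have tb : t <= A + m by rewrite /m; lra.
have bX : A + m <= X by rewrite lerD2l ler_norm.
have cX : A + `|c| <= 3 * X.
  have : `|c| <= `|m| + t.
    rewrite (_ : c = m - t); last by rewrite /m; ring.
    by rewrite -{2}(ger0_norm t0) ler_normB.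
  by lra.
have tX : A + `|t| <= 3 * X by rewrite ger0_norm//; lra.
have Xct : X <= A + `|c| + t.
  by rewrite /X -addrA lerD2l -{1}(ger0_norm t0) ler_normD.
have sc k' x y : 0 < x -> 0 < y -> y <= 3 * x -> x <= 3 * y -> k' = q - 2 -> x `^ k' <= k * y `^ k'.
  move=> x0 y0 yx xy ->; rewrite /k; have [h|h] := leP 0 (q - 2).
    by rewrite ger0_norm//; apply: powR_le_scale => //; rewrite ?ltW.
  by rewrite ltr0_norm//; apply: powR_le_scale_neg => //; rewrite ltW.
have sn x y : q - 2 <= 0 -> 0 < x -> 0 < y -> y <= 3 * x -> x `^ (q - 2) <= k * y `^ (q - 2).
  by move=> h x0 y0 yx; rewrite /k ler0_norm//; exact: powR_le_scale_neg.
have P1 : X `^ (q - 2) * t ^+ 2 <= k * (rc + rt).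
  have t2 := sqr_ge0 t.
  have [h|h] := leP (q - 2) 0.
    have := ler_wpM2r t2 (sn _ _ h X0 Xt0 tX); rewrite -mulrA -/(taylor_rem _ _ _) -/rt.
    by nra.
  have [ct|ct] := leP `|c| t.
    have xx : X <= 3 * (A + `|t|) by rewrite [`|t|]ger0_norm//; lra.
    have := ler_wpM2r t2 (sc _ _ _ X0 Xt0 tX xx erefl).
    by rewrite -mulrA -/(taylor_rem _ _ _) -/rt; nra.
  have xx : X <= 3 * (A + `|c|) by lra.
  have := ler_wpM2r t2 (sc _ _ _ X0 Xc0 cX xx erefl).
  have tc : t ^+ 2 <= c ^+ 2 by rewrite -(sqr_normr c) lerXn2r ?nnegrE ?(ltW ct).
  have := ler_wpM2l (powR_ge0 (A + `|c|) (q - 2)) tc; rewrite -/(taylor_rem _ _ _) -/rc.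
  by rewrite -mulrA; move: (_ * t ^+ 2) (_ * t ^+ 2) => u v; nra.
have P2 : X `^ (q - 2) * c ^+ 2 <= k * (rc + rt).
  have c2 := sqr_ge0 c.
  have [h|h] := leP (q - 2) 0.
    have := ler_wpM2r c2 (sn _ _ h X0 Xc0 cX); rewrite -mulrA -/(taylor_rem _ _ _) -/rc.
    by nra.
  have [ct|ct] := leP `|c| t; last first.
    have xx : X <= 3 * (A + `|c|) by lra.
    have := ler_wpM2r c2 (sc _ _ _ X0 Xc0 cX xx erefl).
    by rewrite -mulrA -/(taylor_rem _ _ _) -/rc; nra.
  have xx : X <= 3 * (A + `|t|) by rewrite [`|t|]ger0_norm//; lra.
  have := ler_wpM2r c2 (sc _ _ _ X0 Xt0 tX xx erefl).
  have tc : c ^+ 2 <= t ^+ 2 by rewrite -(sqr_normr c) lerXn2r ?nnegrE.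
  have := ler_wpM2l (powR_ge0 (A + `|t|) (q - 2)) tc; rewrite -/(taylor_rem _ _ _) -/rt.
  by rewrite -mulrA; move: (_ * c ^+ 2) (_ * c ^+ 2) => u v; nra.
have Pm : taylor_rem q A m <= 4 * k * (rc + rt).
  rewrite /taylor_rem -/X.
  have m2 : m ^+ 2 <= 2 * c ^+ 2 + 2 * t ^+ 2 by rewrite /m; have := sqr_ge0 (c - t); nra.
  have := ler_wpM2l (powR_ge0 X (q - 2)) m2; rewrite mulrDr !(mulrCA _ 2).
  by move: P1 P2; move: (_ * t ^+ 2) (_ * c ^+ 2) (_ * m ^+ 2) => u v w; lra.
have k2 : k * (rc + rt) <= k ^+ 2 * (rc + rt) by rewrite ler_wpM2r ?addr_ge0//; nra.
have S0 : 0 <= k * (rc + rt) by rewrite mulr_ge0 ?addr_ge0//; lra.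
rewrite /K -mulrA; split; [lra|lra|].
have t2 := sqr_ge0 t.
(* If [A + m] is much smaller than [X], then [m < 0] and [X <= 3 |m|]. As [t <= A + m], the term is
   at most [(A + m)^q <= X^q], which is again of the size of [taylor_rem q A m]. *)
have [xb|bx] := leP X (3 * (A + m)).
  have := ler_wpM2r t2 (sc _ _ _ b0 X0 xb _ erefl); rewrite -mulrA => /(_ _) h.
  have {}h : (A + m) `^ (q - 2) * t ^+ 2 <= k * (X `^ (q - 2) * t ^+ 2) by apply: h; lra.
  have : k * (X `^ (q - 2) * t ^+ 2) <= k * (k * (rc + rt)) by apply: ler_wpM2l => //; lra.
  by rewrite (_ : k * (k * (rc + rt)) = k ^+ 2 * (rc + rt)); [lra|ring].
have mneg : m < 0 by rewrite ltNge; apply/negP => mp; move: bx; rewrite /X ger0_norm//; lra.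
have Xm : X <= 3 * `|m| by move: bx; rewrite /X ltr0_norm//; lra.
suff : (A + m) `^ (q - 2) * t ^+ 2 <= 9 * taylor_rem q A m by lra.
apply: (@le_trans _ _ ((A + m) `^ q)).
  by rewrite -(powR_succ2 q b0) ler_wpM2l ?powR_ge0// lerXn2r ?nnegrE ?(ltW b0).
apply: (@le_trans _ _ (X `^ q)).
  by apply: ge0_ler_powR; rewrite ?nnegrE ?ltW//; lra.
rewrite -(powR_succ2 q X0) /taylor_rem -/X [X in _ <= X]mulrCA ler_wpM2l ?powR_ge0//.
rewrite -[m ^+ 2]sqr_normr; nra.
Qed.

(* [b + l] and [b - l] are the values of 1+|x+a+v|^2 and 1+|x+a-v|^2 when
   [A = 1+|x|^2], [c = 2x.a+|a|^2], [t = |v|^2] and [l = 2(x+a).v]. *)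
Lemma powR_sym_step q : 1 <= q -> exists C : R, [/\ 0 <= C, (q = 1 -> C = 0) &
  forall A c t l, 0 < A -> 0 < A + c -> 0 <= t -> l ^+ 2 <= 4 * (A + c) * t ->
   ((A + c + t + l) `^ q + (A + c + t - l) `^ q) / 2 <=
     A `^ q + q * A `^ (q - 1) * (c + (2 * q - 1) * t)
     + C * (taylor_rem q A c + taylor_rem q A t)].
Proof.
move=> q1; have [->|qn1] := eqVneq q 1.
  exists 0; split => // A c t l A0 Ac t0 hl; set b := A + c + t.
  have b0 : 0 < b by rewrite /b; lra.
  have /ler_normlP[? ?] : `|l| <= b.
    rewrite -(ger0_norm (ltW b0)) -ler_sqr ?nnegrE ?normr_ge0// !sqr_normr.
    by apply: (le_trans hl); rewrite /b; have := sqr_ge0 (A + c - t); nra.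
  rewrite !powRr1 ?subrr ?powRr0; [|lra..].
  by rewrite /b; lra.
have {}q1' : 1 < q by rewrite lt_neqAle eq_sym qn1.
have [C4 [C40 _ h4]] := powR_sym_fourth_order q1.
have [C2 [C20 h2]] := powR_taylor2 q1'.
have q10 : 0 <= q - 1 by lra.
have [C1 [C10 h1]] := powR_taylor1 q10.
have [C3 [C30 h3]] := rem_split q1.
have qq : 0 <= q * (q - 1) by nra.
exists (C3 * (C2 + 2 * (q * (q - 1)) * C1 * 2 + 8 * C4)); split.
- by apply: mulr_ge0 => //; have := mulr_ge0 qq C10; lra.
- by move/eqP; rewrite (negbTE qn1).
move=> A c t l A0 Ac t0 hl; set b := A + c + t.
have b0 : 0 < b by rewrite /b; lra.
have bn0 : b != 0 by rewrite gt_eqF.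
have bE : b = A + (c + t) by rewrite /b; lra.
have [r1 r2 r3] := h3 A c t A0 Ac t0.
set rr := taylor_rem q A c + _ in r1 r2 r3 *.
have b'0 : 0 <= A + (c + t) by rewrite -bE ltW.
have g2 := h2 A (c + t) A0 b'0; have g1 := h1 A (c + t) A0 b'0.
rewrite -bE in g2 g1 r3.
(* After factoring out [b], the bound [y^2 <= 4 t / b] is the hypothesis on [l], and [|y| <= 1]
   follows from [4 (A + c) t <= (A + c + t)^2]. *)
set y := l / b.
have hy : y ^+ 2 <= 4 * t / b.
  rewrite /y expr_div_n ler_pdivrMr ?exprn_gt0// expr2 mulrA divfK//.
  by apply: (le_trans hl); rewrite /b; nra.
have y1 : `|y| <= 1.
  rewrite -[X in _ <= X]normr1 -ler_sqr ?nnegrE ?normr_ge0// !sqr_normr expr1n.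
  rewrite /y expr_div_n ler_pdivrMr ?exprn_gt0// mul1r.
  by apply: (le_trans hl); rewrite /b; have := sqr_ge0 (A + c - t); nra.
have /ler_normlP[? ?] := y1.
have -> : b + l = b * (1 + y) by rewrite /y mulrDr mulr1 mulrCA divff// mulr1.
have -> : b - l = b * (1 - y) by rewrite /y mulrBr mulr1 mulrCA divff// mulr1.
rewrite !powRM ?(ltW b0)//; [|lra|lra].
rewrite -mulrDr.
have s1 : b `^ q * ((1 + y) `^ q + (1 - y) `^ q) / 2 <=
    b `^ q * (2 + q * (q - 1) * (4 * t / b) + C4 * (4 * t / b) ^+ 2) / 2.
  rewrite ler_wpM2r ?invr_ge0// ler_wpM2l ?powR_ge0//.
  apply: (le_trans (h4 _ y1)).
  have : q * (q - 1) * y ^+ 2 <= q * (q - 1) * (4 * t / b) by exact: ler_wpM2l.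
  have : C4 * y ^+ 4 <= C4 * (4 * t / b) ^+ 2.
    apply: ler_wpM2l => //; rewrite (exprM y 2 2).
    by rewrite lerXn2r ?nnegrE ?sqr_ge0// divr_ge0 ?mulr_ge0 ?(ltW b0).
  lra.
apply: (le_trans s1).
(* The quadratic term contributes [2 q (q - 1) b^(q-1) t]. Added to [q A^(q-1) t] from the expansion
   of [b^q], it produces the factor [2 q - 1], that is [p - 1] for [q = p / 2]. *)
have -> : b `^ q * (2 + q * (q - 1) * (4 * t / b) + C4 * (4 * t / b) ^+ 2) / 2
  = b `^ q + 2 * (q * (q - 1)) * (b `^ (q - 1) * t) + 8 * C4 * (b `^ (q - 2) * t ^+ 2).
  by rewrite -(powR_pred q b0) -(powR_succ2 q b0); field.
have f1 : 2 * (q * (q - 1)) * (b `^ (q - 1) * t) <=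
    2 * (q * (q - 1)) * (A `^ (q - 1) * t + C1 * (2 * (C3 * rr))).
  apply: ler_wpM2l; first by rewrite mulr_ge0.
  apply: (le_trans (ler_wpM2r t0 g1)); rewrite mulrDl lerD2l -mulrA.
  apply: ler_wpM2l => //; rewrite (_ : q - 1 - 1 = q - 2); last lra.
  have mt : `|c + t| * t <= (c + t) ^+ 2 + t ^+ 2.
    by rewrite -[(c + t) ^+ 2]sqr_normr; have := sqr_ge0 (`|c + t| - t); nra.
  rewrite -mulrA; apply: (le_trans (ler_wpM2l (powR_ge0 _ _) mt)).
  by rewrite mulrDr -/(taylor_rem _ _ _) mulr_natl mulr2n lerD.
have f2 : C2 * taylor_rem q A (c + t) <= C2 * (C3 * rr) by exact: ler_wpM2l.
have f3 : 8 * C4 * (b `^ (q - 2) * t ^+ 2) <= 8 * C4 * (C3 * rr).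
  by apply: ler_wpM2l => //; rewrite mulr_ge0.
move: f1 f2 f3 g2; move: (b `^ q) (b `^ (q - 1) * t) (_ * (_ * t ^+ 2)) (C2 * taylor_rem _ _ _) => u v w z.
nra.
Qed.

(** Here [a] is the squared norm of the drift increment and [c - a] is twice its product with the
    state, so the hypothesis is Cauchy-Schwarz. If [a <= A] then [A + |c| <= 4 A] and
    [c^2 <= 10 A a]; otherwise [A + |c| <= 4 a]. *)
Lemma taylor_rem_drift q : 1 <= q -> exists C : R, 0 <= C /\
  forall A c a, 0 < A -> 0 <= a -> (c - a) ^+ 2 <= 4 * A * a ->
    taylor_rem q A c <= C * (A `^ (q - 1) * a + a `^ q).
Proof.
move=> q1; pose k := 4 `^ `|q - 2| + 4 `^ q : R.
have k1 : 0 <= 4 `^ `|q - 2| :> R by exact: powR_ge0.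
have k2 : 0 <= 4 `^ q :> R by exact: powR_ge0.
exists (10 * k); split; first by rewrite mulr_ge0 ?addr_ge0.
move=> A c a A0 a0 h; rewrite mulrDr.
have g1 : 0 <= A `^ (q - 1) * a by rewrite mulr_ge0 ?powR_ge0.
have g2 : 0 <= a `^ q by exact: powR_ge0.
have cc : c ^+ 2 <= 2 * (c - a) ^+ 2 + 2 * a ^+ 2 by have := sqr_ge0 (c - 2 * a); nra.
have abs (z : R) : 0 <= z -> (c - a) ^+ 2 <= z ^+ 2 -> `|c| <= z + a.
  move=> z0 hz; have : `|c - a| <= z.
    by rewrite -(ger0_norm z0) -ler_sqr ?nnegrE ?normr_ge0// !sqr_normr.
  by move/ler_normlP => [? ?]; apply/ler_normlP; split; lra.
have X0 : 0 < A + `|c| by have := normr_ge0 c; lra.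
have [aA|Aa] := leP a A.
  have cA : `|c| <= 2 * A + a by apply: abs; nra.
  have : (A + `|c|) `^ (q - 2) <= 4 `^ `|q - 2| * A `^ (q - 2).
    have [hq|hq] := leP 0 (q - 2).
        by rewrite [`|q - 2|]ger0_norm//; apply: powR_le_scale; lra.
    by rewrite [`|q - 2|]ltr0_norm//; apply: powR_le_scale_neg => //; have := normr_ge0 c; lra.
  move=> hp.
  have c2 : c ^+ 2 <= 10 * (A * a) by nra.
  have : taylor_rem q A c <= 4 `^ `|q - 2| * A `^ (q - 2) * (10 * (A * a)).
    by apply: ler_pM; rewrite ?powR_ge0 ?sqr_ge0.
  have -> : 4 `^ `|q - 2| * A `^ (q - 2) * (10 * (A * a)) = 10 * (4 `^ `|q - 2| * (A `^ (q - 1) * a)).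
    by rewrite (_ : q - 1 = q - 2 + 1) -?powR_succ//; [ring|lra].
  move/le_trans; apply; rewrite -lerBlDl; apply: (@le_trans _ _ 0); last by rewrite !mulr_ge0// addr_ge0.
  by rewrite subr_le0 -!mulrA ler_wpM2l// ler_wpM2r// lerDl.
have a0' : 0 < a by lra.
have cA : `|c| <= 2 * a + a by apply: abs; nra.
have : taylor_rem q A c <= (A + `|c|) `^ q.
  rewrite -(powR_succ2 q X0) ler_wpM2l ?powR_ge0//.
  by rewrite -[c ^+ 2]sqr_normr lerXn2r ?nnegrE ?normr_ge0 ?ltW//; lra.
move/le_trans; apply.
have : (A + `|c|) `^ q <= 4 `^ q * a `^ q.
  by apply: powR_le_scale; rewrite ?ltW//; lra.
move/le_trans; apply.
have : 4 `^ q * a `^ q <= 10 * k * a `^ q by rewrite ler_wpM2r// /k; lra.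
have : 0 <= 10 * k * (A `^ (q - 1) * a) by rewrite mulr_ge0// /k; lra.
lra.
Qed.

(** The exponent [q - 2] is nonpositive, so shrinking the base [A + |t|] to one of its summands
    increases the power: to [A] here, to [t] in the next lemma. *)
Lemma taylor_rem_le_sq q A t : q <= 2 -> 0 < A -> 0 <= t ->
  taylor_rem q A t <= A `^ (q - 2) * t ^+ 2.
Proof.
move=> q2 A0 t0; rewrite ler_wpM2r ?sqr_ge0//.
have := @powR_le_scale_neg (A + `|t|) A 1 (q - 2).
by rewrite powR1 !mul1r; apply; rewrite ?ger0_norm//; lra.
Qed.

Lemma taylor_rem_le_pow q A t : 1 <= q -> q <= 2 -> 0 < A -> 0 <= t ->
  taylor_rem q A t <= t `^ q.
Proof.
move=> q1 q2 A0; rewrite le_eqVlt => /predU1P[<-|t0].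
  by rewrite /taylor_rem expr0n/= mulr0 powR_ge0.
rewrite -(powR_succ2 q t0) ler_wpM2r ?sqr_ge0//.
have := @powR_le_scale_neg (A + `|t|) t 1 (q - 2).
by rewrite powR1 !mul1r; apply; rewrite ?gtr0_norm//; lra.
Qed.

Lemma taylor_rem_le_sum q A t : 2 <= q -> 0 < A -> 0 <= t ->
  taylor_rem q A t <= 2 `^ (q - 2) * (A `^ (q - 2) * t ^+ 2 + t `^ q).
Proof.
move=> q2 A0 t0; have q0 : 0 <= q - 2 by lra.
have P0 : 0 <= 2 `^ (q - 2) :> R by exact: powR_ge0.
have g1 : 0 <= A `^ (q - 2) * t ^+ 2 by rewrite mulr_ge0 ?powR_ge0 ?sqr_ge0.
have g2 : 0 <= t `^ q by exact: powR_ge0.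
rewrite /taylor_rem ger0_norm//; have [tA|At] := leP t A.
  have : (A + t) `^ (q - 2) <= 2 `^ (q - 2) * A `^ (q - 2) by apply: powR_le_scale; lra.
  move/(ler_wpM2r (sqr_ge0 t))/le_trans; apply.
  by rewrite -mulrA ler_wpM2l// lerDl.
have : (A + t) `^ (q - 2) <= 2 `^ (q - 2) * t `^ (q - 2) by apply: powR_le_scale; lra.
move/(ler_wpM2r (sqr_ge0 t))/le_trans; apply.
rewrite -mulrA ler_wpM2l// powR_succ2 ?lerDr//; lra.
Qed.

End SymmetricStep.

(** * Gaussian moments *)

Section Density.
Context d (T : measurableType d) (R : realType).
Variables (mu nu : {measure set T -> \bar R}) (g : T -> R).
Hypotheses (mg : measurable_fun setT g) (g0 : forall x, 0 <= g x).
Hypothesis nuE : forall A, measurable A -> nu A = (\int[mu]_(x in A) (g x)%:E)%E.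
Import HBNNSimple.

Let integral_density_nnsfun (f : {nnsfun T >-> R}) :
  (\int[nu]_x (f x)%:E = \int[mu]_x ((f x)%:E * (g x)%:E))%E.
Proof.
under [LHS]eq_integral do rewrite fimfunE -fsumEFin//.
rewrite [LHS]ge0_integral_fsum//; last 2 first.
- by move=> r; exact/measurable_EFinP/measurableT_comp.
- by move=> n x _; rewrite EFinM nnfun_muleindic_ge0.
under [RHS]eq_integral.
  move=> x xD; rewrite fimfunE -fsumEFin// muleC ge0_mule_fsumr; last first.
    by move=> r; rewrite EFinM nnfun_muleindic_ge0.
  over.
rewrite [RHS]ge0_integral_fsum//; last 2 first.
- move=> r; apply/measurable_EFinP; apply: measurable_funM => //.
  exact: measurableT_comp.
- move=> n x _; apply: mule_ge0; first by rewrite lee_fin.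
  by rewrite EFinM nnfun_muleindic_ge0.
apply: eq_fsbigr => r _.
have [fr|fr] := pselect (range f r); last first.
  have e : f @^-1` [set r] = set0 by apply/seteqP; split => // x /= fx; apply: fr; exists x.
  rewrite e !integral0_eq// => x _; rewrite indic0 ?mulr0 ?mule0//.
have r0 : (0 <= r)%R by case: fr => x _ <-.
have mE : measurable (f @^-1` [set r]) by exact: measurable_funPTI.
rewrite integralZl_indic_nnsfun// integral_indic// setIT nuE//.
rewrite integral_mkcond -ge0_integralZl//; last 2 first.
- apply/(measurable_restrictT _ _).1 => //; exact/measurable_EFinP/measurable_funTS.
- by move=> x _; rewrite patchE; case: ifPn => // _; rewrite lee_fin.
apply: eq_integral => x _; rewrite patchE -EFinM indicE.
by case: ifPn => _; rewrite ?mulr1 ?mulr0 ?mule0 -?EFinM// mulrC.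
Qed.

Lemma ge0_integral_density (f : T -> \bar R) : measurable_fun setT f ->
  (forall x, 0 <= f x)%E -> (\int[nu]_x f x = \int[mu]_x (f x * (g x)%:E))%E.
Proof.
move=> mf f0; pose f_ := nnsfun_approx measurableT mf.
transitivity (lim (\int[nu]_x (f_ n x)%:E @[n --> \oo])%E).
  rewrite -monotone_convergence//=.
  - apply: eq_integral => x _; apply/esym/cvg_lim => //=.
    exact: cvg_nnsfun_approx.
  - by move=> n; exact/measurable_EFinP/measurable_funTS.
  - by move=> n x _; rewrite lee_fin.
  - by move=> x _ a b ab; rewrite lee_fin; exact/lefP/nd_nnsfun_approx.
transitivity (lim (\int[mu]_x ((f_ n x)%:E * (g x)%:E) @[n --> \oo])%E).
  by congr (limn _); apply/funext => n; exact: integral_density_nnsfun.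
rewrite -monotone_convergence//=.
- apply: eq_integral => x _; apply/cvg_lim => //=.
  by apply: cvgeZr => //; exact: cvg_nnsfun_approx.
- move=> n; apply/measurable_EFinP; apply: measurable_funM => //.
- by move=> n x _; rewrite lee_fin mulr_ge0.
- move=> x _ a b ab; rewrite lee_fin ler_wpM2r//; exact/lefP/nd_nnsfun_approx.
Qed.

End Density.

(** * Even moments of the centred normal law *)

Section NormalMoments.
Context {R : realType}.
Implicit Types (s x : R) (m : nat).
Local Notation mu := (@lebesgue_measure R).
Local Notation pdf s := (@normal_pdf R 0 s).

Let is_derive_normal_pdf s x : s != 0 ->
  is_derive x (1 : R) (pdf s : R -> R) (- (x / s ^+ 2) * pdf s x).
Proof.
move=> s0; rewrite normal_pdfE//.
have -> : (fun x => normal_peak s * normal_fun 0 s x) =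
    (fun x => normal_peak s * expR (- (2 * s ^+ 2)^-1 * x ^+ 2)).
  by apply/funext => z; rewrite /normal_fun subr0; congr (_ * expR _); field.
apply: is_derive_eq; rewrite /normal_fun subr0 /GRing.scale/=.
have -> : - x ^+ 2 / (s ^+ 2 *+ 2) = - (2 * s ^+ 2)^-1 * x ^+ 2 by field.
by move: (expR _) => e; field.
Qed.

(** Gaussian integration by parts: [H] is an antiderivative of [h], whose integral compares the
    moments of orders [k + 2] and [k]. *)
Let H s k x : R := - s ^+ 2 * (x ^+ k.+1 * pdf s x).
Let h s k x : R := x ^+ k.+2 * pdf s x - k.+1%:R * s ^+ 2 * (x ^+ k * pdf s x).

Let is_derive_H s k x : s != 0 -> is_derive x (1 : R) (H s k : R -> R) (h s k x).
Proof.
move=> s0; have dp := is_derive_normal_pdf x s0.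
have dx : is_derive x (1 : R) (fun x => x ^+ k.+1 : R) (k.+1%:R * x ^+ k).
  have := is_deriveX k.+1 (is_derive_id x (1 : R)).
  rewrite /GRing.scale/= mulr1; congr (is_derive _ _ _ _); apply/funext => z.
  by elim: k.+1 => [|j IH]; rewrite ?expr0// exprS [in RHS]exprS -IH.
have dm : is_derive x (1 : R) (fun x => x ^+ k.+1 * pdf s x : R)
    (x ^+ k.+1 * (- (x / s ^+ 2) * pdf s x) + pdf s x * (k.+1%:R * x ^+ k)).
  exact: is_deriveM.
have := is_deriveZ (- s ^+ 2) dm; rewrite /H => dz.
have -> : h s k x = - s ^+ 2 *: (x ^+ k.+1 * (- (x / s ^+ 2) * pdf s x) + pdf s x * (k.+1%:R * x ^+ k)).
  by rewrite /h /GRing.scale/= !exprS; field.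
exact: dz.
Qed.

Let even_moment_step_itv s m (n : nat) : 0 < s ->
  (\int[mu]_(x in `[(- n.+1%:R)%R, n.+1%:R%R]) (x ^+ (2 * m).+2 * pdf s x)%:E
   <= ((2 * m).+1%:R * s ^+ 2)%:E * \int[mu]_(x in `[(- n.+1%:R)%R, n.+1%:R%R]) (x ^+ (2 * m) * pdf s x)%:E)%E.
Proof.
move=> s0; have sn0 : s != 0 by rewrite gt_eqF.
have cp : continuous (pdf s) by exact: continuous_normal_pdf.
have cx k : continuous (fun x : R => x ^+ k * pdf s x : R).
  by move=> x; apply: cvgM; [exact: exprn_continuous|exact: cp].
have itg k : mu.-integrable `[(- n.+1%:R)%R, n.+1%:R%R] (EFin \o (fun x => x ^+ k * pdf s x)).
  apply: continuous_compact_integrable; first exact: segment_compact.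
  exact/continuous_subspaceT.
have ab : - n.+1%:R < n.+1%:R :> R by rewrite gtrN// ltr0n.
have : (\int[mu]_(x in `[(- n.+1%:R)%R, n.+1%:R%R]) (h s (2 * m) x)%:E = (H s (2 * m) n.+1%:R)%:E - (H s (2 * m) (- n.+1%:R))%:E)%E.
  apply: continuous_FTC2 => //.
  - apply: continuous_subspaceT => x; rewrite /h; apply: cvgB; first exact: cx.
    by apply: cvgM; [exact: cvg_cst|exact: cx].
  - have cH : continuous (H s (2 * m)).
      by move=> x; apply/differentiable_continuous/derivable1_diffP; case: (is_derive_H (2 * m) x sn0).
    split; [by move=> x _; case: (is_derive_H (2 * m) x sn0)| |].
    + by apply: cvg_at_right_filter; exact: cH.
    + by apply: cvg_at_left_filter; exact: cH.
  - by move=> x _; rewrite derive1E; case: (is_derive_H (2 * m) x sn0).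
move=> e.
(* For an even order the boundary term has a sign, so the recursion holds as an inequality on every
   bounded interval, before any limit is taken. *)
have le0 : ((H s (2 * m) n.+1%:R)%:E - (H s (2 * m) (- n.+1%:R))%:E <= 0)%E.
  rewrite -EFinB lee_fin /H.
  have p0 := normal_pdf_ge0 0 s.
  have N0 : 0 <= n.+1%:R ^+ (2 * m).+1 :> R by rewrite exprn_ge0.
  have s2 := sqr_ge0 s.
  rewrite exprNn -signr_odd/= oddM/= expr1 !mulN1r.
  have := mulr_ge0 (mulr_ge0 s2 N0) (p0 n.+1%:R); have := mulr_ge0 (mulr_ge0 s2 N0) (p0 (- n.+1%:R)).
  lra.
move: e; rewrite /h.
under eq_integral do rewrite EFinB.
rewrite integralB//=; last 2 first.
- exact: (itg _).
- exact: (integrableZl _ _ (itg _)).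
under [X in (_ - X = _)%E -> _]eq_integral do rewrite EFinM.
rewrite integralZl//; last exact: itg.
move=> e; rewrite -sube_le0; apply: le_trans le0.
by rewrite le_eqVlt; apply/orP; left; apply/eqP; exact: e.
Qed.

Let moment_setT s m : (\int[mu]_(x in `[(- n.+1%:R)%R, n.+1%:R%R]) (x ^+ (2 * m) * pdf s x)%:E @[n --> \oo]
  --> \int[mu]_x (x ^+ (2 * m) * pdf s x)%:E)%E.
Proof.
have -> : setT = \bigcup_n `[(- n.+1%:R)%R, n.+1%:R%R]%classic :> set R.
  apply/seteqP; split => // x _.
  exists (Num.truncn `|x|) => //=; rewrite in_itv/= -ler_norml.
  exact/ltW/truncnS_gt.
apply: ge0_nondecreasing_set_cvg_integral => //.
- move=> a b ab; apply/subsetPset => x /=; rewrite !in_itv/= => /andP[h1 h2].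
  have : a.+1%:R <= b.+1%:R :> R by rewrite ler_nat.
  lra.
- move=> i; apply/measurable_EFinP/measurable_funTS; apply: measurable_funM => //.
  exact: measurable_normal_pdf.
- by move=> i x _; rewrite lee_fin mulr_ge0 ?normal_pdf_ge0// exprM exprn_ge0// sqr_ge0.
Qed.

(** The product is the double factorial (2m-1)!!. The induction runs in the extended reals and so
    proves finiteness along the way. *)
Lemma normal_pdf_even_moment s m : 0 < s ->
  (\int[mu]_x (x ^+ (2 * m) * normal_pdf 0 s x)%:E <=
   ((\prod_(i < m) (2 * i).+1%:R) * s ^+ (2 * m))%:E)%E.
Proof.
move=> s0; elim: m => [|m IH].
  under eq_integral do rewrite muln0 expr0 mul1r.
  by rewrite integral_normal_pdf big_ord0 muln0 expr0 mulr1.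
apply: (@le_trans _ _ (((2 * m).+1%:R * s ^+ 2)%:E * \int[mu]_x (x ^+ (2 * m) * pdf s x)%:E)%E).
  rewrite -(cvg_lim _ (@moment_setT s m.+1))//; apply: lime_le.
    by apply/cvg_ex; eexists; exact: (@moment_setT s m.+1).
  apply: nearW => n; rewrite [(2 * m.+1)%N]mulnS add2n.
  apply: (le_trans (even_moment_step_itv m n s0)).
  rewrite lee_pmul2l// ?lte_fin ?mulr_gt0 ?exprn_gt0//.
  apply: ge0_subset_integral => //.
  + apply/measurable_EFinP; apply: measurable_funM => //; exact: measurable_normal_pdf.
  + by move=> x _; rewrite lee_fin mulr_ge0 ?normal_pdf_ge0// exprM exprn_ge0// sqr_ge0.
rewrite big_ord_recr/= mulnS exprD.
have -> : \prod_(i < m) (2 * i).+1%:R * (2 * m).+1%:R * (s ^+ 2 * s ^+ (2 * m)) =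
  ((2 * m).+1%:R * s ^+ 2) * (\prod_(i < m) (2 * i).+1%:R * s ^+ (2 * m)) by ring.
by rewrite [leRHS]EFinM lee_pmul2l// ?lte_fin ?mulr_gt0 ?exprn_gt0.
Qed.

Lemma normal_prob_even_moment s m : 0 < s ->
  (\int[normal_prob 0 s]_x (x ^+ (2 * m))%:E <=
   ((\prod_(i < m) (2 * i).+1%:R) * s ^+ (2 * m))%:E)%E.
Proof.
move=> s0; rewrite (@ge0_integral_density _ _ _ mu _ (normal_pdf 0 s)).
- under eq_integral do rewrite -EFinM; exact: normal_pdf_even_moment.
- exact: measurable_normal_pdf.
- by move=> x; exact: normal_pdf_ge0.
- by [].
- exact/measurable_EFinP.
- by move=> x; rewrite lee_fin exprM exprn_ge0// sqr_ge0.
Qed.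

End NormalMoments.

(** * Independence and Brownian increments *)

Section Rectangles.
Context {R : realType} (I : finType) (T : pointedType) (X : I -> T -> R).

Definition rect (A : I -> set R) : set T := [set w | forall i, A i (X i w)].

Definition rectangles : set (set T) :=
  [set E | exists2 A : I -> set R, (forall i, measurable (A i)) & E = rect A].

(** The sigma-algebra generated by the family [X], through a pi-system that contains the whole
    space. It serves both for vectors with their coordinates and for [Omega] with the information of
    finitely many increments. *)
Definition rectType := g_sigma_algebraType rectangles.

Lemma rectangles_setI : setI_closed rectangles.
Proof.
move=> _ _ [A mA ->] [B mB ->]; exists (fun i => A i `&` B i).
  by move=> i; exact: measurableI.
apply/seteqP; split => w /=; first by move=> [hA hB] i; split.
by move=> h; split => i; case: (h i).
Qed.

Lemma rectangles_setT : rectangles setT.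
Proof. by exists (fun=> setT) => //; apply/seteqP; split. Qed.

Lemma measurable_rect (A : I -> set R) : (forall i, measurable (A i)) ->
  measurable (rect A : set rectType).
Proof. by move=> mA; apply: sub_sigma_algebra; exists A. Qed.

Lemma measurable_rect_coord i : measurable_fun setT (X i : rectType -> R).
Proof.
move=> _ A mA; rewrite setTI.
have -> : X i @^-1` A = rect (fun j => if j == i then A else setT).
  apply/seteqP; split => w /=; first by move=> Aw j; case: ifP => // /eqP ->.
  by move=> /(_ i); rewrite eqxx.
by apply: measurable_rect => j; case: ifP.
Qed.

Lemma measurable_to_rectType d (Z : measurableType d) (Y : Z -> rectType) :
  (forall i, measurable_fun setT (fun z => X i (Y z))) -> measurable_fun setT Y.
Proof.
move=> h; apply: (@measurability _ _ _ rectType setT Y rectangles) => // _ [_ [A mA ->] <-].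
rewrite setTI.
have -> : Y @^-1` rect A = \bigcap_(i in [set: I]) ((fun z => X i (Y z)) @^-1` A i).
  by apply/seteqP; split => z /= hz i; [move=> _|]; exact: hz.
apply: fin_bigcap_measurable => // i _; rewrite -[X in measurable X]setTI.
exact: h.
Qed.

Lemma rectType_measure_unique (m1 m2 : {measure set rectType -> \bar R}) :
  (m1 setT < +oo)%E ->
  (forall A : I -> set R, (forall i, measurable (A i)) -> m1 (rect A) = m2 (rect A)) ->
  forall E, measurable E -> m1 E = m2 E.
Proof.
move=> m1oo h E mE; apply: (@measure_unique _ R rectType rectangles (fun=> setT)) => //.
- exact: rectangles_setI.
- by move=> _; exact: rectangles_setT.
- by rewrite bigcup_const.
- by move=> _ [A mA ->]; exact: h.
Qed.

End Rectangles.
Arguments rectType {R I T} X.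

(** * Freezing an independent variable *)

Section IndependentFubini.
Context {R : realType} d d1 d2 (Omega : measurableType d)
  (T1 : measurableType d1) (T2 : measurableType d2) (P : probability Omega R).
Variables (X1 : Omega -> T1) (X2 : Omega -> T2).
Hypotheses (mX1 : measurable_fun setT X1) (mX2 : measurable_fun setT X2).
Hypothesis indep : forall A B, measurable A -> measurable B ->
  P (X1 @^-1` A `&` X2 @^-1` B) = (P (X1 @^-1` A) * P (X2 @^-1` B))%E.

(** Independence makes the joint law the product of the marginal laws, and Tonelli does the rest.
    The inner integral over a second copy [w'] of the sample space takes the place of a conditional
    expectation. *)
Lemma ge0_independent_fubini (F : T1 * T2 -> \bar R) : measurable_fun setT F ->
  (forall z, 0 <= F z)%E ->
  measurable_fun setT (fun w => \int[P]_w' F (X1 w, X2 w'))%E /\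
  (\int[P]_w F (X1 w, X2 w) = \int[P]_w \int[P]_w' F (X1 w, X2 w'))%E.
Proof.
move=> mF F0.
pose m1 := distribution P (mfun_Sub (mem_set mX1)).
pose m2 := distribution P (mfun_Sub (mem_set mX2)).
have mX : measurable_fun setT (fun w => (X1 w, X2 w)) by exact: measurable_fun_pair.
pose m12 := distribution P (mfun_Sub (mem_set mX)).
have e : forall C, measurable C -> (m1 \x m2)%E C = m12 C.
  by apply: product_measure_unique => A B mA mB; exact: indep.
have inner t1 : (\int[P]_w' F (t1, X2 w') = \int[m2]_y F (t1, y))%E.
  rewrite ge0_integral_pushforward//.
  exact: measurableT_comp.
have mG : measurable_fun setT (fubini_F m2 F) by exact: measurable_fun_fubini_tonelli_F.
split.
  under eq_fun do rewrite inner.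
  exact: (measurableT_comp mG mX1).
under [RHS]eq_integral do rewrite inner.
transitivity (\int[m12]_z F z)%E; first by rewrite ge0_integral_pushforward.
rewrite (eq_measure_integral (m1 \x m2)%E); last by move=> C mC _; exact: esym (e C mC).
rewrite fubini_tonelli1// ge0_integral_pushforward//.
by move=> x _; apply: integral_ge0.
Qed.

End IndependentFubini.

(** * Reflection invariance of the normal law *)

Section NormalSymmetry.
Context {R : realType}.
Local Notation mu := (@lebesgue_measure R).

Let measurable_opp : measurable_fun setT (fun x : measurableTypeR R => - x : measurableTypeR R).
Proof. exact: measurable_funN. Qed.

Lemma lebesgue_measure_opp (A : set R) : measurable A ->
  mu ((fun x => - x) @^-1` A) = mu A.
Proof.
move=> mA.
pose nu : {measure set (measurableTypeR R) -> \bar R} :=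
  pushforward mu (fun x : measurableTypeR R => - x : measurableTypeR R).
suff : forall A, measurable A -> mu A = nu measurable_opp A by move=> /(_ A mA) ->.
apply: lebesgue_measure_unique => _ [[a b] _ <-].
change (mu `]a, b]%classic = mu ((fun x : R => - x) @^-1` `]a, b]%classic)).
have -> : (fun x : R => - x) @^-1` `]a, b]%classic = `[- b, - a[%classic.
  apply/seteqP; split => x /=; rewrite !in_itv/= => /andP[? ?]; apply/andP; split; lra.
by rewrite !lebesgue_measure_itv/= !lte_fin ltrN2 opprK -!EFinD addrC.
Qed.

Lemma normal_prob_opp (s : R) (A : set R) : s != 0 -> measurable A ->
  normal_prob 0 s ((fun x => - x) @^-1` A) = normal_prob 0 s A.
Proof.
move=> s0 mA; rewrite /normal_prob.
pose nu : {measure set (measurableTypeR R) -> \bar R} :=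
  pushforward mu (fun x : measurableTypeR R => - x : measurableTypeR R).
transitivity (\int[nu measurable_opp]_(x in A) (normal_pdf 0 s x)%:E)%E; last first.
  by apply: eq_measure_integral => C mC _; exact: lebesgue_measure_opp.
have mp : measurable_fun (A : set (measurableTypeR R)) (fun x : measurableTypeR R => (normal_pdf 0 s x)%:E).
  apply/measurable_EFinP; apply: measurable_funTS; exact: measurable_normal_pdf.
rewrite ge0_integral_pushforward.
- apply: eq_integral => x _; congr (_%:E).
  by rewrite normal_pdfE// /normal_fun !subr0 sqrrN.
- exact: measurable_opp.
- exact: mA.
- exact: mp.
- by move=> x _; rewrite lee_fin normal_pdf_ge0.
Qed.

End NormalSymmetry.

Section RectIndependence.
Context {R : realType} d (Omega : measurableType d) (P : probability Omega R).

(** With [D] fixed both sides are finite measures in [E], images of [P] restricted to [D] and of [P]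
    scaled by [P D], so agreement on rectangles suffices. Independence of two sigma-algebras follows
    by doing this in each argument in turn. *)
Let rect_independent_half (I : finType) (T : pointedType) (X : I -> T -> R)
    (Y : Omega -> rectType X) (D : set Omega) :
  measurable_fun setT Y -> measurable D ->
  (forall A, (forall i, measurable (A i)) ->
     P (Y @^-1` rect X A `&` D) = (P (Y @^-1` rect X A) * P D)%E) ->
  forall E, measurable E -> P (Y @^-1` E `&` D) = (P (Y @^-1` E) * P D)%E.
Proof.
move=> mY mD h E mE.
pose m1 : {measure set (rectType X) -> \bar R} := pushforward (mrestr P mD) Y.
have c0 : (0 <= fine (P D))%R by apply: fine_ge0.
pose m2 : {measure set (rectType X) -> \bar R} := mscale (NngNum c0) (pushforward P Y).
have m2E F : m2 mY F = (P (Y @^-1` F) * P D)%E.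
  by rewrite /m2 /= /mscale /= fineK ?fin_num_measure// muleC.
rewrite -m2E; change (m1 mY E = m2 mY E).
apply: (rectType_measure_unique (X := X)) => //.
  by apply: (le_lt_trans (probability_le1 P _)); rewrite ?ltry// preimage_setT setTI.
by move=> A mA; rewrite m2E -h.
Qed.

Lemma rect_independent (I1 I2 : finType) (T1 T2 : pointedType)
    (X1 : I1 -> T1 -> R) (X2 : I2 -> T2 -> R)
    (Y1 : Omega -> rectType X1) (Y2 : Omega -> rectType X2) :
  measurable_fun setT Y1 -> measurable_fun setT Y2 ->
  (forall A1 A2, (forall i, measurable (A1 i)) -> (forall i, measurable (A2 i)) ->
     P (Y1 @^-1` rect X1 A1 `&` Y2 @^-1` rect X2 A2) =
     (P (Y1 @^-1` rect X1 A1) * P (Y2 @^-1` rect X2 A2))%E) ->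
  forall E1 E2, measurable E1 -> measurable E2 ->
     P (Y1 @^-1` E1 `&` Y2 @^-1` E2) = (P (Y1 @^-1` E1) * P (Y2 @^-1` E2))%E.
Proof.
move=> mY1 mY2 h E1 E2 mE1 mE2.
have mp1 E : measurable E -> measurable (Y1 @^-1` E).
  by move=> mE; rewrite -[X in measurable X]setTI; exact: mY1.
have mp2 E : measurable E -> measurable (Y2 @^-1` E).
  by move=> mE; rewrite -[X in measurable X]setTI; exact: mY2.
apply: (rect_independent_half (X := X1)) => //; first exact: mp2.
move=> A1 mA1; rewrite setIC muleC.
apply: (rect_independent_half (X := X2)) => //; first exact: (mp1 _ (measurable_rect (X := X1) mA1)).
by move=> A2 mA2; rewrite setIC muleC; exact: h.
Qed.

End RectIndependence.

(** * Increments over the time grid: independence of the past, and symmetry *)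

Section BrownianIncrements.
Context {R : realType} dO (Omega : measurableType dO) (P : probability Omega R).
Context {d : nat} (B : R -> Omega -> 'cV[R]_d) (D : R).
Hypotheses (D0 : 0 < D) (hB : is_BM P B).

Definition bm_inc (k : nat) (w : Omega) : 'cV[R]_d := B (k.+1%:R * D) w - B (k%:R * D) w.

Definition vec_coord (i : 'I_d) (v : 'cV[R]_d) : R := v i 0.
Definition vecType := rectType vec_coord.

Definition past_coord (m : nat) (q : 'I_m * 'I_d) (w : Omega) : R := bm_inc q.1 w q.2 0.
(* [Omega] with the sigma-algebra generated by the first [m] increments *)
Definition pastType (m : nat) := rectType (@past_coord m).

Lemma measurable_bm_inc k i : measurable_fun setT (fun w => bm_inc k w i 0).
Proof.
have [mB _ _ _ _] := hB.
have -> : (fun w => bm_inc k w i 0) = (fun w => B (k.+1%:R * D) w i 0) \- (fun w => B (k%:R * D) w i 0).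
  by apply/funext => w; rewrite /bm_inc !mxE.
by apply: measurable_funB; apply: mB; rewrite mulr_ge0// ltW.
Qed.

Lemma measurable_bm_inc_vec k : measurable_fun setT (bm_inc k : Omega -> vecType).
Proof. by apply: measurable_to_rectType => i; exact: measurable_bm_inc. Qed.

Lemma measurable_past m : measurable_fun setT (id : Omega -> pastType m).
Proof. by apply: measurable_to_rectType => q; exact: measurable_bm_inc. Qed.

Lemma measurable_past_set m (E : set (pastType m)) : measurable E -> measurable (E : set Omega).
Proof. by move=> mE; have := @measurable_past m measurableT E mE; rewrite setTI. Qed.

Lemma measurable_past_succ m : measurable_fun setT (id : pastType m.+1 -> pastType m).
Proof.
apply: measurable_to_rectType => q.
exact: (@measurable_rect_coord R _ _ (@past_coord m.+1) (widen_ord (leqnSn m) q.1, q.2)).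
Qed.

Lemma measurable_past_last m i :
  measurable_fun setT (fun w : pastType m.+1 => bm_inc m w i 0).
Proof. exact: (@measurable_rect_coord R _ _ (@past_coord m.+1) (ord_max, i)). Qed.

Let sqrtD0 : Num.sqrt D != 0. Proof. by rewrite gt_eqF// sqrtr_gt0. Qed.

Lemma bm_inc_law k i (A : set R) : measurable A ->
  P [set w | A (bm_inc k w i 0)] = normal_prob 0 (Num.sqrt D) A.
Proof.
move=> mA; have [_ _ _ law _] := hB.
have k0 : 0 <= k%:R * D by rewrite mulr_ge0// ltW.
have kk : k%:R * D < k.+1%:R * D by rewrite ltr_pM2r// ltr_nat.
have e : k.+1%:R * D - k%:R * D = D by rewrite -mulrBl -natrB// subSnn mul1r.
have := law _ _ k0 kk i A mA.
by rewrite e.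
Qed.

Let rect_prod m (A : 'I_m * 'I_d -> set R) : (forall q, measurable (A q)) ->
  P (rect (@past_coord m) A) = (\prod_(k < m) \prod_(i < d)
     fine (normal_prob 0 (Num.sqrt D) (A (k, i))))%:E.
Proof.
move=> mA; have [_ _ _ _ ind] := hB.
have := ind m (fun j => j%:R * D); rewrite mul0r => /(_ (lexx _)) /(_ _ A mA) h.
have mR : measurable (rect (@past_coord m) A : set Omega).
  exact: (@measurable_past_set m _ (measurable_rect (X := @past_coord m) mA)).
rewrite -[LHS]fineK ?fin_num_measure//; congr (_%:E).
rewrite [LHS]h; last by move=> j _; rewrite ltr_pM2r// ltr_nat.
rewrite pair_big/=; apply: eq_bigr => -[k i] _; congr (fine _).
exact: bm_inc_law.
Qed.

(** A rectangle for the first [m] increments and one for the increment of index [m] form a single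
    rectangle for [m + 1] increments; [insub] fails exactly on the last index. *)
Let join_sets m (A : 'I_m * 'I_d -> set R) (C : 'I_d -> set R) (q : 'I_m.+1 * 'I_d) : set R :=
  if insub (q.1 : nat) is Some k then A (k, q.2) else C q.2.

Let rect_prod_join m (A : 'I_m * 'I_d -> set R) (C : 'I_d -> set R) :
  (forall q, measurable (A q)) -> (forall i, measurable (C i)) ->
  P (rect (@past_coord m) A `&` bm_inc m @^-1` rect vec_coord C) =
   (P (rect (@past_coord m) A) * (\prod_(i < d) fine (normal_prob 0 (Num.sqrt D) (C i)))%:E)%E.
Proof.
move=> mA mC.
have e1 (k : 'I_m) i : join_sets A C (widen_ord (leqnSn m) k, i) = A (k, i).
  by rewrite /join_sets /= (valK k).
have e2 i : join_sets A C (ord_max, i) = C i.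
  by rewrite /join_sets /= insubF// ltnn.
have -> : rect (@past_coord m) A `&` bm_inc m @^-1` rect vec_coord C =
    rect (@past_coord m.+1) (join_sets A C).
  apply/seteqP; split => w /=.
    move=> [hA hC] [k i]; case: (unliftP ord_max k) => [j|] ->; last by rewrite e2; exact: hC.
    have -> : lift ord_max j = widen_ord (leqnSn m) j.
      by apply/val_inj; rewrite /= /bump leqNgt ltn_ord.
    by rewrite e1; exact: (hA (j, i)).
  move=> h; split=> [[k i]|i].
    by have := h (widen_ord (leqnSn m) k, i); rewrite e1.
  by have := h (ord_max, i); rewrite e2.
rewrite !rect_prod//; last by move=> [k i]; rewrite /join_sets; case: insubP.
rewrite big_ord_recr/= -EFinM; congr (_ * _)%:E.
  by apply: eq_bigr => k _; apply: eq_bigr => i _; rewrite e1.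
by apply: eq_bigr => i _; rewrite e2.
Qed.

Let rect_prod_inc m (C : 'I_d -> set R) : (forall i, measurable (C i)) ->
  P (bm_inc m @^-1` rect vec_coord C) = (\prod_(i < d) fine (normal_prob 0 (Num.sqrt D) (C i)))%:E.
Proof.
move=> mC; have := @rect_prod_join m (fun=> setT) C (fun=> measurableT) mC.
have -> : rect (@past_coord m) (fun=> setT) = setT by apply/seteqP; split.
by rewrite setTI probability_setT mul1e.
Qed.

Lemma bm_inc_independent m (E1 : set (pastType m)) (E2 : set vecType) :
  measurable E1 -> measurable E2 ->
  P ((id : Omega -> pastType m) @^-1` E1 `&` bm_inc m @^-1` E2) =
  (P ((id : Omega -> pastType m) @^-1` E1) * P (bm_inc m @^-1` E2))%E.
Proof.
have h := @rect_independent R _ _ P _ _ Omega 'cV[R]_d (@past_coord m) vec_coord _ _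
  (@measurable_past m) (measurable_bm_inc_vec m).
move=> mE1 mE2; apply: h mE1 mE2.
by move=> A1 A2 mA1 mA2; rewrite rect_prod_join// rect_prod_inc.
Qed.

(** Signs are chosen per coordinate because two patterns occur: flipping all of them symmetrises the
    step, flipping one kills the mixed second moments. *)
Definition flip_signs (e : 'I_d -> bool) (v : 'cV[R]_d) : 'cV[R]_d := \col_i ((-1) ^+ e i * v i 0).

Lemma measurable_flip_signs e : measurable_fun setT (flip_signs e : vecType -> vecType).
Proof.
apply: measurable_to_rectType => i.
have -> : (fun v : vecType => vec_coord i (flip_signs e v)) = (fun v : vecType => (-1) ^+ e i * vec_coord i v).
  by apply/funext => v; rewrite /vec_coord /flip_signs mxE.
by apply: measurable_funM => //; exact: (@measurable_rect_coord R _ _ vec_coord).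
Qed.

Lemma bm_inc_flip_signs m e (F : vecType -> \bar R) : measurable_fun setT F ->
  (forall v, 0 <= F v)%E ->
  (\int[P]_w F (flip_signs e (bm_inc m w)) = \int[P]_w F (bm_inc m w))%E.
Proof.
move=> mF F0; have mi := measurable_bm_inc_vec m.
have mfi : measurable_fun setT (fun w => flip_signs e (bm_inc m w) : vecType).
  exact: (measurableT_comp (measurable_flip_signs e) mi).
pose m1 := distribution P (mfun_Sub (mem_set mfi)).
pose m2 := distribution P (mfun_Sub (mem_set mi)).
transitivity (\int[m1]_v F v)%E; first by rewrite ge0_integral_pushforward.
transitivity (\int[m2]_v F v)%E; last by rewrite ge0_integral_pushforward.
apply: eq_measure_integral => C mC _.
apply: (rectType_measure_unique (X := vec_coord)) => //.
  by apply: (le_lt_trans (probability_le1 _ _)); rewrite ?ltry.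
move=> A mA.
change (P ((fun w => flip_signs e (bm_inc m w)) @^-1` rect vec_coord A) =
        P (bm_inc m @^-1` rect vec_coord A)).
rewrite [RHS]rect_prod_inc//.
pose A' i := (fun x : R => (-1) ^+ e i * x) @^-1` A i.
have mA' i : measurable (A' i).
  by rewrite /A' -[X in measurable X]setTI; apply: (measurable_funM _ _) => //.
rewrite [LHS](_ : _ = P (bm_inc m @^-1` rect vec_coord A')); last first.
  congr (P _); apply/seteqP; split => w /= h i; have := h i;
  by rewrite /A' /vec_coord /flip_signs /= mxE.
rewrite rect_prod_inc//; congr (_%:E); apply: eq_bigr => i _; congr fine.
rewrite /A'; case: (e i); rewrite ?expr1 ?expr0.
  by under eq_fun do rewrite mulN1r; exact: normal_prob_opp.
by under eq_fun do rewrite mul1r.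
Qed.

Lemma bm_inc_even_moment m i k :
  (\int[P]_w (bm_inc m w i 0 ^+ (2 * k))%:E <= ((\prod_(j < k) (2 * j).+1%:R) * D ^+ k)%:E)%E.
Proof.
have mi : @measurable_fun _ _ Omega (measurableTypeR R) setT (fun w => bm_inc m w i 0).
  exact: measurable_bm_inc.
have e : Num.sqrt D ^+ (2 * k) = D ^+ k by rewrite exprM sqr_sqrtr// ltW.
have sD : 0 < Num.sqrt D by rewrite sqrtr_gt0.
rewrite -e; apply: le_trans (normal_prob_even_moment k sD).
pose X : Omega -> measurableTypeR R := fun w => bm_inc m w i 0.
pose nu : {measure set (measurableTypeR R) -> \bar R} := pushforward P X.
have mp : measurable_fun setT (fun x : measurableTypeR R => (x ^+ (2 * k))%:E).
  by apply/measurable_EFinP.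
have -> : (\int[P]_w (bm_inc m w i 0 ^+ (2 * k))%:E = \int[nu mi]_x (x ^+ (2 * k))%:E)%E.
  rewrite ge0_integral_pushforward//.
  by move=> x _; rewrite lee_fin exprM exprn_ge0// sqr_ge0.
rewrite le_eqVlt; apply/orP; left; apply/eqP.
by apply: eq_measure_integral => A mA _; exact: bm_inc_law.
Qed.

End BrownianIncrements.

(** * One step of the scheme *)

Section VectorNorms.
Context {R : realType}.
Implicit Types (n d : nat).

Lemma vnorm_sqE n (x : 'cV[R]_n) : vnorm x ^+ 2 = \sum_(i < n) x i 0 ^+ 2.
Proof. by rewrite sqr_sqrtr// sumr_ge0// => i _; rewrite sqr_ge0. Qed.

Lemma vnorm_ge0 n (x : 'cV[R]_n) : 0 <= vnorm x.
Proof. exact: sqrtr_ge0. Qed.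

Lemma mnorm_sqE n d (G : 'M[R]_(n, d)) : mnorm G ^+ 2 = \sum_(i < n) \sum_(j < d) G i j ^+ 2.
Proof.
have e : \tr (G^T *m G) = \sum_(i < n) \sum_(j < d) G i j ^+ 2.
  rewrite /mxtrace exchange_big/=; apply: eq_bigr => j _.
  by rewrite mxE; apply: eq_bigr => i _; rewrite mxE expr2.
by rewrite /mnorm e sqr_sqrtr// sumr_ge0// => i _; rewrite sumr_ge0// => j _; rewrite sqr_ge0.
Qed.

Definition vdot n (x y : 'cV[R]_n) : R := (x^T *m y) 0 0.

Lemma vdotE n (x y : 'cV[R]_n) : vdot x y = \sum_(i < n) x i 0 * y i 0.
Proof. by rewrite /vdot mxE; apply: eq_bigr => i _; rewrite mxE. Qed.

Lemma vnormD_sq n (x y : 'cV[R]_n) :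
  vnorm (x + y) ^+ 2 = vnorm x ^+ 2 + 2 * vdot x y + vnorm y ^+ 2.
Proof.
rewrite !vnorm_sqE vdotE mulr_sumr -!big_split/=; apply: eq_bigr => i _.
by rewrite mxE; ring.
Qed.

Lemma vnormB_sq n (x y : 'cV[R]_n) :
  vnorm (x - y) ^+ 2 = vnorm x ^+ 2 - 2 * vdot x y + vnorm y ^+ 2.
Proof.
rewrite !vnorm_sqE vdotE mulr_sumr -sumrB -big_split/=; apply: eq_bigr => i _.
by rewrite !mxE; ring.
Qed.

Lemma vnormZ_sq n (a : R) (x : 'cV[R]_n) : vnorm (a *: x) ^+ 2 = a ^+ 2 * vnorm x ^+ 2.
Proof. by rewrite !vnorm_sqE mulr_sumr; apply: eq_bigr => i _; rewrite mxE exprMn. Qed.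

Lemma vdotZr n (a : R) (x y : 'cV[R]_n) : vdot x (a *: y) = a * vdot x y.
Proof. by rewrite !vdotE mulr_sumr; apply: eq_bigr => i _; rewrite mxE; ring. Qed.

Lemma sum_cauchy_schwarz n (u v : 'I_n -> R) :
  (\sum_i u i * v i) ^+ 2 <= (\sum_i u i ^+ 2) * (\sum_i v i ^+ 2).
Proof.
set a := \sum_i u i ^+ 2; set b := \sum_i v i ^+ 2; set c := \sum_i u i * v i.
have a0 : 0 <= a by apply: sumr_ge0 => i _; exact: sqr_ge0.
have h (s t : R) : 0 <= s ^+ 2 * a + 2 * (s * t) * c + t ^+ 2 * b.
  rewrite /a /b /c !mulr_sumr -!big_split/=; apply: sumr_ge0 => i _.
  have -> : s ^+ 2 * u i ^+ 2 + 2 * (s * t) * (u i * v i) + t ^+ 2 * v i ^+ 2 = (s * u i + t * v i) ^+ 2 by ring.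
  exact: sqr_ge0.
(* The nonnegative form [h] at [(- c, a)] equals [a (a b - c^2)]. When [a = 0], its value at
   [((b + 1) / 2, - c)] is [- c^2], which forces [c = 0]. *)
have [a1|a1] := eqVneq a 0.
  have := h ((b + 1) / 2) (- c); rewrite a1 mul0r.
  have := sqr_ge0 c; nra.
have {}a1 : 0 < a by rewrite lt_neqAle eq_sym a1.
have := h (- c) a; rewrite -(pmulr_rge0 _ a1) => hh.
by rewrite -subr_ge0 -(pmulr_rge0 _ a1); have := h (- c) a; nra.
Qed.

Lemma vdot_cauchy_schwarz n (x y : 'cV[R]_n) : vdot x y ^+ 2 <= vnorm x ^+ 2 * vnorm y ^+ 2.
Proof. by rewrite vdotE !vnorm_sqE; exact: sum_cauchy_schwarz. Qed.

Lemma vnorm_mulmx_sq n d (G : 'M[R]_(n, d)) (v : 'cV[R]_d) :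
  vnorm (G *m v) ^+ 2 <= mnorm G ^+ 2 * vnorm v ^+ 2.
Proof.
rewrite vnorm_sqE mnorm_sqE mulr_suml; apply: ler_sum => i _.
by rewrite mxE vnorm_sqE; exact: sum_cauchy_schwarz.
Qed.

Lemma sum_exprn_le n (y : 'I_n -> R) k : (forall i, 0 <= y i) ->
  (\sum_i y i) ^+ k.+1 <= n%:R ^+ k.+1 * \sum_i y i ^+ k.+1.
Proof.
move=> y0; case: n y y0 => [|n] y y0; first by rewrite !big_ord0 mulr0 expr0n.
have [i0 _ hi0] := @arg_maxP _ R 'I_n.+1 ord0 xpredT y isT.
apply: (@le_trans _ _ ((n.+1%:R * y i0) ^+ k.+1)).
  rewrite lerXn2r ?nnegrE ?sumr_ge0 ?mulr_ge0//.
  have -> : n.+1%:R * y i0 = \sum_(i < n.+1) y i0 by rewrite sumr_const card_ord mulr_natl.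
  by apply: ler_sum => i _; exact: hi0.
rewrite exprMn ler_wpM2l ?exprn_ge0// (bigD1 i0)//= lerDl sumr_ge0// => i _.
exact: exprn_ge0.
Qed.

End VectorNorms.

Section RealIntegrable.
Context d (T : measurableType d) (R : realType) (mu : {measure set T -> \bar R}).
Variable A : set T.
Hypothesis mA : measurable A.
Implicit Types f g : T -> R.

Lemma integrable_EFinD f g : mu.-integrable A (EFin \o f) -> mu.-integrable A (EFin \o g) ->
  mu.-integrable A (EFin \o (fun x => f x + g x)).
Proof. by move=> hf hg; exact: (integrableD mA hf hg). Qed.

Lemma integrable_EFinZ r f : mu.-integrable A (EFin \o f) ->
  mu.-integrable A (EFin \o (fun x => r * f x)).
Proof. by move=> hf; exact: (integrableZl mA r hf). Qed.

End RealIntegrable.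

(** * Moments of a matrix applied to a Brownian increment *)

Section IncrementMoments.
Context {R : realType} dO (Omega : measurableType dO) (P : probability Omega R).
Context {d : nat} (B : R -> Omega -> 'cV[R]_d) (D : R).
Hypotheses (D0 : 0 < D) (hB : is_BM P B).
Local Notation v m w := (bm_inc B D m w).
Local Notation even_coef k := (\prod_(j < k) (2 * j).+1%:R : R).

Let mv m i : measurable_fun setT (fun w => v m w i 0) := measurable_bm_inc D0 hB m i.

Let integrable_sq m i : P.-integrable setT (EFin \o (fun w => v m w i 0 ^+ 2)).
Proof.
apply/integrableP; split; first by apply/measurable_EFinP; exact: measurable_funX.
under eq_integral do rewrite /= ger0_norm ?sqr_ge0//.
apply: le_lt_trans (ltry _); first exact: (@bm_inc_even_moment _ _ _ _ _ _ _ D0 hB m i 1).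
Qed.

Let measurable_prod m i j : measurable_fun setT (fun w => v m w i 0 * v m w j 0).
Proof. exact: measurable_funM. Qed.

Let integrable_prod m i j : P.-integrable setT (EFin \o (fun w => v m w i 0 * v m w j 0)).
Proof.
apply: (@le_integrable _ _ _ P _ measurableT _ (EFin \o (fun w => v m w i 0 ^+ 2 + v m w j 0 ^+ 2))).
- exact/measurable_EFinP.
- move=> w _ /=; rewrite lee_fin [leRHS]ger0_norm ?addr_ge0 ?sqr_ge0//.
  rewrite normrM -!(real_normK (num_real (v m w _ 0))).
  by have := normr_ge0 (v m w i 0); have := normr_ge0 (v m w j 0);
    have := sqr_ge0 (`|v m w i 0| - `|v m w j 0|); nra.
- exact: integrable_EFinD.
Qed.

Let coord_measurable i : measurable_fun setT (fun u : vecType (R := R) (d := d) => u i 0 : R).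
Proof. exact: (@measurable_rect_coord R _ _ (@vec_coord R d) i). Qed.

Let integral_prod m i j : i != j -> (\int[P]_w (v m w i 0 * v m w j 0) = 0)%R.
Proof.
(* The added squares make [F 1] nonnegative, as the flip invariance requires; flipping coordinate
   [i] turns [F 1] into [F (-1)], so the mixed moment equals its opposite. *)
move=> ij; pose F (s : R) (u : vecType (R := R) (d := d)) : R := s * (u i 0 * u j 0) + (u i 0 ^+ 2 + u j 0 ^+ 2).
have F0 u : 0 <= F 1 u by rewrite /F; have := sqr_ge0 (u i 0 + u j 0); have := sqr_ge0 (u i 0); have := sqr_ge0 (u j 0); nra.
have mF : measurable_fun setT (EFin \o F 1).
  apply/measurable_EFinP; apply: measurable_funD.
    by apply: measurable_funM => //; apply: measurable_funM.
  by apply: measurable_funD; exact: measurable_funX.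
have := @bm_inc_flip_signs _ _ _ _ _ _ _ D0 hB m (fun k => k == i) (EFin \o F 1) mF (fun u => F0 u).
have fl w : F 1 (flip_signs (fun k => k == i) (v m w)) = F (-1) (v m w).
  rewrite /F /flip_signs !mxE eqxx eq_sym (negbTE ij); ring.
under eq_integral do rewrite /= fl.
have I1 : P.-integrable setT (EFin \o (fun w => v m w i 0 ^+ 2 + v m w j 0 ^+ 2)).
  exact: integrable_EFinD.
have Is s : P.-integrable setT (EFin \o (fun w => s * (v m w i 0 * v m w j 0))).
  exact: integrable_EFinZ.
move=> /(congr1 fine); rewrite /F => h.
have : (\int[P]_w (-1 * (v m w i 0 * v m w j 0) + (v m w i 0 ^+ 2 + v m w j 0 ^+ 2)) =
  \int[P]_w (1 * (v m w i 0 * v m w j 0) + (v m w i 0 ^+ 2 + v m w j 0 ^+ 2)))%R by exact: h.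
rewrite !RintegralD// !RintegralZl//.
lra.
Qed.

(** The constant 1 is essential: this moment gets the factor [2 q - 1] and must match the term
    [|g|^2] of (A2). Hence the mixed terms must vanish, whereas the higher moments below may carry
    any constant. *)
Lemma integral_vnorm_mulmx_inc n (G : 'M[R]_(n, d)) m :
  (\int[P]_w (vnorm (G *m v m w) ^+ 2)%:E <= (D * mnorm G ^+ 2)%:E)%E.
Proof.
have e w : vnorm (G *m v m w) ^+ 2 =
    \sum_(k < n) \sum_(i < d) \sum_(j < d) (G k i * G k j) * (v m w i 0 * v m w j 0).
  rewrite vnorm_sqE; apply: eq_bigr => k _; rewrite mxE expr2 mulr_suml.
  by apply: eq_bigr => i _; rewrite mulr_sumr; apply: eq_bigr => j _; ring.
have I k i j : P.-integrable setT (fun w => (G k i * G k j * (v m w i 0 * v m w j 0))%:E).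
  exact: (integrable_EFinZ measurableT (G k i * G k j) (integrable_prod m i j)).
under eq_integral.
  move=> w _; rewrite e -sumEFin.
  under eq_bigr do (rewrite -sumEFin; under eq_bigr do rewrite -sumEFin).
  over.
rewrite integral_sum//; last first.
  by move=> k; apply: integrable_sum => // i _; exact: integrable_sum.
have step k : (\int[P]_w (\sum_(i < d) \sum_(j < d) ((G k i * G k j) * (v m w i 0 * v m w j 0))%:E)
   <= (D * \sum_(i < d) G k i ^+ 2)%:E)%E.
  rewrite integral_sum//; last by move=> i; exact: integrable_sum.
  rewrite mulr_sumr -sumEFin; apply: lee_sum => i _.
  rewrite integral_sum//.
  rewrite (bigD1 i)//= [X in (_ + X)%E]big1 ?adde0; last first.
    move=> j ji; under eq_integral do rewrite EFinM.
    rewrite integralZl//; last exact: integrable_prod.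
    have := integral_prod m (i := i) (j := j); rewrite eq_sym ji => /(_ isT).
    rewrite /Rintegral => z; rewrite -[X in (_ * X)%E]fineK ?z ?mule0//.
    exact: integrable_fin_num (integrable_prod m i j).
  under eq_integral do rewrite EFinM -!expr2.
  rewrite integralZl//; last exact: integrable_sq.
  rewrite -?expr2 (mulrC D) [(G k i ^+ 2 * D)%:E]EFinM lee_wpmul2l// ?lee_fin ?sqr_ge0//.
  have := @bm_inc_even_moment _ _ _ _ _ _ _ D0 hB m i 1.
  by rewrite big_ord1 mul1r expr1.
rewrite mnorm_sqE mulr_sumr -sumEFin; apply: lee_sum => k _; exact: step.
Qed.

Lemma measurable_vnorm_mulmx_inc n (G : 'M[R]_(n, d)) m :
  measurable_fun setT (fun w => vnorm (G *m v m w) ^+ 2).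
Proof.
under eq_fun do rewrite vnorm_sqE.
apply: measurable_sum => i; apply: measurable_funX.
under eq_fun do rewrite mxE.
by apply: measurable_sum => j; exact: measurable_funM.
Qed.

Lemma integral_vnorm_mulmx_inc_pow n (G : 'M[R]_(n, d)) m k :
  (\int[P]_w ((vnorm (G *m v m w) ^+ 2) ^+ k.+1)%:E <=
    ((d%:R ^+ k.+2 * even_coef k.+1) * (D * mnorm G ^+ 2) ^+ k.+1)%:E)%E.
Proof.
have mn := measurable_vnorm_mulmx_inc G m.
pose Cc := (mnorm G ^+ 2) ^+ k.+1 * d%:R ^+ k.+1.
have Cc0 : 0 <= Cc by rewrite mulr_ge0// exprn_ge0// sqr_ge0.
apply: (@le_trans _ _ (\int[P]_w (Cc%:E * \sum_(i < d) (v m w i 0 ^+ (2 * k.+1))%:E))%E).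
  apply: ge0_le_integral => //.
  - by move=> w _; rewrite lee_fin exprn_ge0// sqr_ge0.
  - by apply/measurable_EFinP; exact: measurable_funX.
  - under eq_fun do rewrite sumEFin -EFinM.
    apply/measurable_EFinP; apply: measurable_funM => //; apply: measurable_sum => i.
    exact: measurable_funX.
  - move=> w _; rewrite sumEFin -EFinM lee_fin.
    apply: (@le_trans _ _ ((mnorm G ^+ 2 * vnorm (v m w) ^+ 2) ^+ k.+1)).
      have h := vnorm_mulmx_sq G (v m w).
      by rewrite ler_pXn2r// nnegrE ?sqr_ge0// (mulr_ge0 (sqr_ge0 _) (sqr_ge0 _)).
    rewrite exprMn /Cc -[leRHS]mulrA; apply: ler_wpM2l; first by rewrite exprn_ge0// sqr_ge0.
    rewrite vnorm_sqE.
    apply: (le_trans (sum_exprn_le k _)) => [i|]; first exact: sqr_ge0.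
    by under eq_bigr do rewrite -exprM.
have mx i : measurable_fun setT (fun w => (v m w i 0 ^+ (2 * k.+1))%:E).
  by apply/measurable_EFinP; exact: measurable_funX.
rewrite ge0_integralZl//; last 2 first.
- exact: emeasurable_sum.
- by move=> w _; apply: sume_ge0 => i _; rewrite lee_fin exprM exprn_ge0// sqr_ge0.
rewrite ge0_integral_sum//; last by move=> i w _; rewrite lee_fin exprM exprn_ge0// sqr_ge0.
apply: (@le_trans _ _ (Cc%:E * \sum_(i < d) (even_coef k.+1 * D ^+ k.+1)%:E)%E).
  rewrite lee_wpmul2l// ?lee_fin//; apply: lee_sum => i _.
  exact: (@bm_inc_even_moment _ _ _ _ _ _ _ D0 hB m i k.+1).
rewrite sumEFin -EFinM lee_fin sumr_const card_ord -[_ *+ d]mulr_natl /Cc.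
set N := mnorm G ^+ 2; rewrite [(D * N) ^+ _]exprMn [d%:R ^+ k.+2]exprS.
by rewrite le_eqVlt; apply/orP; left; apply/eqP; ring.
Qed.

End IncrementMoments.

(** * Symmetrised expectation over one increment, from a frozen state *)

Section OneStep.
Context {R : realType} dO (Omega : measurableType dO) (P : probability Omega R).
Context {d : nat} (B : R -> Omega -> 'cV[R]_d).
Hypothesis hB : is_BM P B.
Local Notation inc D m w := (bm_inc B D m w).

(** The real power is compared with an integer one at the natural scale [s = D |G|^2]: below [s] it
    is at most [s^r], above [s] it is at most [s^(r - J - 1) t^(J + 1)] because [r <= J + 1]. The
    negative power of [s] is why [s = 0] is treated apart. *)
Lemma integral_powR_vnorm_inc (r : R) : 1 <= r -> exists K : R, 0 <= K /\
  forall (D : R) n (G : 'M[R]_(n, d)) m, 0 < D ->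
    (\int[P]_w ((vnorm (G *m inc D m w) ^+ 2) `^ r)%:E <= (K * (D * mnorm G ^+ 2) `^ r)%:E)%E.
Proof.
move=> r1; pose J := Num.truncn r.
have rJ : r <= J.+1%:R by exact/ltW/truncnS_gt.
pose K0 : R := d%:R ^+ J.+2 * \prod_(j < J.+1) (2 * j).+1%:R.
have K00 : 0 <= K0 by rewrite mulr_ge0 ?exprn_ge0// prodr_ge0.
exists (1 + K0); split => [|D n G m D0]; first by rewrite addr_ge0.
have rn0 : r != 0 by rewrite gt_eqF//; lra.
set s := D * mnorm G ^+ 2.
have s0 : 0 <= s by rewrite mulr_ge0 ?sqr_ge0// ltW.
have mt := measurable_vnorm_mulmx_inc D0 hB G m.
have t0 w : 0 <= vnorm (G *m inc D m w) ^+ 2 by exact: sqr_ge0.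
have [s1|s1] := eqVneq s 0.
  rewrite integral0_eq ?s1 ?powR0 ?mulr0// => w _.
  have : vnorm (G *m inc D m w) ^+ 2 <= mnorm G ^+ 2 * vnorm (inc D m w) ^+ 2 by exact: vnorm_mulmx_sq.
  have -> : mnorm G ^+ 2 = 0 by move/eqP: s1; rewrite mulf_eq0 gt_eqF//= => /eqP.
  rewrite mul0r => h; have -> : vnorm (G *m inc D m w) ^+ 2 = 0 by apply/eqP; rewrite eq_le h t0.
  by rewrite powR0.
have {}s1 : 0 < s by rewrite lt_neqAle eq_sym s1.
have c0 : 0 <= s `^ (r - J.+1%:R) by exact: powR_ge0.
have pt w : (vnorm (G *m inc D m w) ^+ 2) `^ r <=
    s `^ r + s `^ (r - J.+1%:R) * (vnorm (G *m inc D m w) ^+ 2) ^+ J.+1.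
  move: (t0 w); set t := _ ^+ 2 => t0'; have [ts|ts] := leP t s.
    apply: (@le_trans _ _ (s `^ r)); first by apply: ge0_ler_powR; rewrite ?nnegrE//; lra.
    by rewrite lerDl mulr_ge0// exprn_ge0.
  have tp : 0 < t by lra.
  apply: (@le_trans _ _ (s `^ (r - J.+1%:R) * t ^+ J.+1)); last by rewrite lerDr powR_ge0.
  have -> : t `^ r = t `^ (r - J.+1%:R) * t ^+ J.+1.
    rewrite -powR_mulrn// -powRD ?subrK//; apply/implyP => _; rewrite gt_eqF//.
  apply: ler_wpM2r; first exact: exprn_ge0.
  have := @powR_le_scale_neg R t s 1 (r - J.+1%:R).
  by rewrite powR1 !mul1r; apply => //; lra.
apply: (@le_trans _ _ (\int[P]_w ((s `^ r)%:E + (s `^ (r - J.+1%:R))%:E * ((vnorm (G *m inc D m w) ^+ 2) ^+ J.+1)%:E))%E).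
  apply: ge0_le_integral => //.
  - by move=> w _; rewrite lee_fin powR_ge0.
  - by apply/measurable_EFinP; exact: (measurableT_comp (measurable_powR r) mt).
  - apply/measurable_EFinP; apply: measurable_funD => //; apply: measurable_funM => //.
    exact: measurable_funX.
  - by move=> w _; rewrite -EFinM -EFinD lee_fin.
rewrite ge0_integralD//; last 3 first.
- by move=> w _; rewrite lee_fin powR_ge0.
- by move=> w _; rewrite -EFinM lee_fin mulr_ge0// exprn_ge0.
- by apply/measurable_EFinP; apply: measurable_funM => //; exact: measurable_funX.
rewrite integral_cst//= probability_setT mule1 ge0_integralZl//; last 2 first.
- by apply/measurable_EFinP; exact: measurable_funX.
- by move=> w _; rewrite lee_fin exprn_ge0.
have h := @integral_vnorm_mulmx_inc_pow _ _ _ _ _ _ _ D0 hB n G m J.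
apply: (le_trans (leeD2l _ (lee_wpmul2l _ h))); first by rewrite lee_fin.
rewrite -EFinM -EFinD lee_fin -/s -/K0 mulrDl mul1r lerD2l mulrCA ler_wpM2l//.
rewrite -powR_mulrn// -powRD ?subrK//; apply/implyP => _; rewrite gt_eqF//.
Qed.

(** For [q <= 2] two bounds are kept, since the drift estimate chooses between them according to the
    size of the product of state and drift. *)
Lemma integral_taylor_rem_le (q : R) : 1 <= q -> exists K : R, 0 <= K /\
  forall (D A : R) n (G : 'M[R]_(n, d)) m, 0 < D -> 0 < A ->
   let I := (\int[P]_w (taylor_rem q A (vnorm (G *m inc D m w) ^+ 2))%:E)%E in
   let s := D * mnorm G ^+ 2 in
   [/\ 2 <= q -> (I <= (K * (A `^ (q - 2) * s ^+ 2 + s `^ q))%:E)%E,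
       q <= 2 -> (I <= (K * (A `^ (q - 2) * s ^+ 2))%:E)%E &
       q <= 2 -> (I <= (K * s `^ q)%:E)%E].
Proof.
move=> q1; have [Kq [Kq0 hq]] := integral_powR_vnorm_inc q1.
have [K2 [K20 h2]] := @integral_powR_vnorm_inc 2 (ler1n R 2).
pose c := 2 `^ (q - 2) : R; have c0 : 0 <= c by exact: powR_ge0.
exists ((1 + c) * (Kq + K2)); split; first by rewrite mulr_ge0// addr_ge0.
move=> D A n G m D0 A0 I s.
have mt := measurable_vnorm_mulmx_inc D0 hB G m.
have t0 w : 0 <= vnorm (G *m inc D m w) ^+ 2 by exact: sqr_ge0.
have s0 : 0 <= s by rewrite mulr_ge0 ?sqr_ge0// ltW.
have mrem : measurable_fun setT (fun w => taylor_rem q A (vnorm (G *m inc D m w) ^+ 2)).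
  rewrite /taylor_rem; apply: measurable_funM; last exact: measurable_funX.
  under eq_fun do rewrite ger0_norm//.
  apply: (measurableT_comp (measurable_powR _)).
  exact: measurable_funD.
have mq r : measurable_fun setT (fun w => (vnorm (G *m inc D m w) ^+ 2) `^ r).
  exact: (measurableT_comp (measurable_powR r) mt).
have m2 : measurable_fun setT (fun w => (vnorm (G *m inc D m w) ^+ 2) ^+ 2) by exact: measurable_funX.
have {hq} hq := hq D n G m D0; rewrite -/s in hq.
have {h2} h2 : (\int[P]_w ((vnorm (G *m inc D m w) ^+ 2) ^+ 2)%:E <= (K2 * s ^+ 2)%:E)%E.
  have := h2 D n G m D0; rewrite -/s (powR_mulrn 2 s0).
  by under eq_integral do rewrite (powR_mulrn 2 (t0 _)).
have A20 : 0 <= A `^ (q - 2) by exact: powR_ge0.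
have sq0 : 0 <= s `^ q by exact: powR_ge0.
have s20 : 0 <= s ^+ 2 by exact: sqr_ge0.
have Iint (F : Omega -> R) (r : R) : measurable_fun setT F -> (forall w, 0 <= F w) ->
    (forall w, taylor_rem q A (vnorm (G *m inc D m w) ^+ 2) <= F w) ->
    (\int[P]_w (F w)%:E <= r%:E)%E -> (I <= r%:E)%E.
  move=> mF F0 h; apply: le_trans; apply: ge0_le_integral => //.
  - by move=> w _; rewrite lee_fin taylor_rem_ge0.
  - exact/measurable_EFinP.
  - exact/measurable_EFinP.
  - by move=> w _; rewrite lee_fin.
have I2 : (\int[P]_w (A `^ (q - 2) * (vnorm (G *m inc D m w) ^+ 2) ^+ 2)%:E <= (K2 * (A `^ (q - 2) * s ^+ 2))%:E)%E.
  under eq_integral do rewrite EFinM.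
  rewrite ge0_integralZl//; last 2 first.
  - exact/measurable_EFinP.
  - by move=> w _; rewrite lee_fin exprn_ge0.
  by rewrite mulrCA EFinM; apply: lee_wpmul2l => //; rewrite lee_fin.
split => q2.
- apply: (Iint (fun w => c * (A `^ (q - 2) * (vnorm (G *m inc D m w) ^+ 2) ^+ 2 + (vnorm (G *m inc D m w) ^+ 2) `^ q))).
  + by apply: measurable_funM => //; apply: measurable_funD => //; exact: measurable_funM.
  + by move=> w; rewrite mulr_ge0// addr_ge0 ?powR_ge0// mulr_ge0// exprn_ge0.
  + by move=> w; exact: taylor_rem_le_sum.
  under eq_integral do rewrite EFinM EFinD.
  rewrite ge0_integralZl//; last 2 first.
  - by apply/measurable_EFinP; apply: measurable_funD => //; exact: measurable_funM.
  - by move=> w _; rewrite -EFinD lee_fin addr_ge0 ?powR_ge0// mulr_ge0// exprn_ge0.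
  rewrite ge0_integralD//; last 4 first.
  - by move=> w _; rewrite lee_fin mulr_ge0// exprn_ge0.
  - by apply/measurable_EFinP; exact: measurable_funM.
  - by move=> w _; rewrite lee_fin powR_ge0.
  - exact/measurable_EFinP.
  apply: (@le_trans _ _ (c%:E * ((K2 * (A `^ (q - 2) * s ^+ 2))%:E + (Kq * s `^ q)%:E))%E).
    by apply: lee_wpmul2l; [rewrite lee_fin|exact: leeD].
  rewrite -EFinD -EFinM lee_fin.
  have p1 : 0 <= A `^ (q - 2) * s ^+ 2 by rewrite mulr_ge0.
  move: (A `^ (q - 2) * s ^+ 2) (s `^ q) p1 sq0 => u v u0 v0.
  have := mulr_ge0 (mulr_ge0 c0 Kq0) u0; have := mulr_ge0 (mulr_ge0 c0 K20) v0.
  have := mulr_ge0 Kq0 u0; have := mulr_ge0 K20 v0; have := mulr_ge0 Kq0 v0; have := mulr_ge0 K20 u0.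
  by rewrite !(mulrDl, mulrDr, mul1r) !mulrA; lra.
- apply: (Iint (fun w => A `^ (q - 2) * (vnorm (G *m inc D m w) ^+ 2) ^+ 2)).
  + exact: measurable_funM.
  + by move=> w; rewrite mulr_ge0// exprn_ge0.
  + by move=> w; exact: taylor_rem_le_sq.
  apply: (le_trans I2); rewrite lee_fin; apply: ler_wpM2r; first exact: mulr_ge0.
  by have := mulr_ge0 c0 (addr_ge0 Kq0 K20); rewrite mulrDl mul1r; lra.
- apply: (Iint (fun w => (vnorm (G *m inc D m w) ^+ 2) `^ q)) => //.
  + by move=> w; exact: powR_ge0.
  + by move=> w; exact: taylor_rem_le_pow.
  apply: (le_trans hq); rewrite lee_fin ler_wpM2r//.
  by have := mulr_ge0 c0 (addr_ge0 Kq0 K20); rewrite mulrDl mul1r; lra.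
Qed.

Lemma measurable_vec_affine n (y : 'cV[R]_n) (G : 'M[R]_(n, d)) (q s : R) :
  measurable_fun setT (fun u : vecType (R := R) (d := d) => (1 + vnorm (y + s *: (G *m u)) ^+ 2) `^ q).
Proof.
apply: (measurableT_comp (measurable_powR q)); apply: measurable_funD => //.
under eq_fun do rewrite vnorm_sqE.
apply: measurable_sum => i; apply: measurable_funX.
have -> : (fun u : vecType (R := R) (d := d) => (y + s *: (G *m u)) i 0) =
    (fun u => y i 0 + s * \sum_j G i j * vec_coord j u).
  by apply/funext => u; rewrite !mxE.
apply: measurable_funD => //; apply: measurable_funM => //.
apply: measurable_sum => j; apply: measurable_funM => //.
exact: (@measurable_rect_coord R _ _ (@vec_coord R d) j).
Qed.

(** By flip invariance the integrand may be replaced by its mean over [v] and [- v], to which the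
    pointwise symmetric step applies. The noise remainder stays an integral, to be bounded once (A2)
    is available. *)
Lemma integral_step (q : R) : 1 <= q -> exists C : R, [/\ 0 <= C, (q = 1 -> C = 0) &
  forall (D : R) n (x a : 'cV[R]_n) (G : 'M[R]_(n, d)) m A c, 0 < D ->
   A = 1 + vnorm x ^+ 2 -> c = vnorm (x + a) ^+ 2 - vnorm x ^+ 2 ->
   (\int[P]_w ((1 + vnorm (x + a + G *m inc D m w) ^+ 2) `^ q)%:E <=
    (A `^ q + q * A `^ (q - 1) * (c + (2 * q - 1) * (D * mnorm G ^+ 2)) + C * taylor_rem q A c)%:E
    + C%:E * \int[P]_w (taylor_rem q A (vnorm (G *m inc D m w) ^+ 2))%:E)%E].
Proof.
move=> q1; have [C [C0 Cq h]] := powR_sym_step q1; exists C; split => //.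
move=> D n x a G m A c D0 AE cE.
have A1 : 1 <= A by rewrite AE lerDl sqr_ge0.
have A0 : 0 < A by lra.
have Ac : 0 < A + c by rewrite AE cE; have := sqr_ge0 (vnorm (x + a)); lra.
have q0 : 0 <= q by lra.
have q20 : 0 <= 2 * q - 1 by lra.
have [F FE] : {F : R -> 'cV[R]_d -> R |
    forall s u, F s u = (1 + vnorm (x + a + s *: (G *m u)) ^+ 2) `^ q}.
  by exists (fun s u => (1 + vnorm (x + a + s *: (G *m u)) ^+ 2) `^ q).
have F0 s u : 0 <= F s u by rewrite FE powR_ge0.
have mF s : measurable_fun setT (fun w => F s (inc D m w)).
  under eq_fun do rewrite FE.
  exact: (measurableT_comp (measurable_vec_affine (x + a) G q s) (measurable_bm_inc_vec D0 hB m)).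
have flip : (\int[P]_w (F (-1) (inc D m w))%:E = \int[P]_w (F 1 (inc D m w))%:E)%E.
  have mF1 : measurable_fun setT (EFin \o (F 1 : vecType (R := R) (d := d) -> R)).
    apply/measurable_EFinP; rewrite (funext (FE 1)).
    exact: (measurable_vec_affine (x + a) G q 1).
  have := @bm_inc_flip_signs _ _ _ _ _ _ _ D0 hB m (fun=> true) _ mF1 (fun u => F0 1 u).
  have fe u : F 1 (flip_signs (fun=> true) u) = F (-1) u.
    rewrite !FE; suff -> : G *m flip_signs (fun=> true) u = - (G *m u) by rewrite scale1r scaleN1r.
    rewrite -mulmxN; congr (_ *m _); apply/matrixP => i j.
    by rewrite !mxE expr1 mulN1r (ord1 j).
  move=> e; apply: etrans e; apply: eq_integral => w _.
  exact: (congr1 EFin (esym (fe _))).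
pose t w := vnorm (G *m inc D m w) ^+ 2.
have t0 w : 0 <= t w by exact: sqr_ge0.
have mt : measurable_fun setT t := measurable_vnorm_mulmx_inc D0 hB G m.
pose c0 := A `^ q + q * A `^ (q - 1) * c + C * taylor_rem q A c.
pose c1 := q * A `^ (q - 1) * (2 * q - 1).
have c10 : 0 <= c1 by rewrite !mulr_ge0 ?powR_ge0.
(* The sign is read off the pointwise estimate at [t = l = 0], whose left side is a power. *)
have c00 : 0 <= c0.
  have := h A c 0 0 A0 Ac (lexx _); rewrite expr0n/= mulr0 => /(_ (lexx _)).
  rewrite !addr0 subr0 mulr0 addr0 => hh.
  have e0 : taylor_rem q A 0 = 0 by rewrite /taylor_rem expr0n/= mulr0.
  rewrite e0 addr0 in hh; apply: le_trans hh.
  by rewrite divr_ge0// addr_ge0// powR_ge0.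
have mrem : measurable_fun setT (fun w => taylor_rem q A (t w)).
  rewrite /taylor_rem; apply: measurable_funM; last exact: measurable_funX.
  under eq_fun do rewrite ger0_norm//.
  apply: (measurableT_comp (measurable_powR _)).
  exact: measurable_funD.
have pt w : (F 1 (inc D m w) + F (-1) (inc D m w)) / 2 <= c0 + c1 * t w + C * taylor_rem q A (t w).
  have := h A c (t w) (2 * vdot (x + a) (G *m inc D m w)) A0 Ac (t0 w).
  have cs := vdot_cauchy_schwarz (x + a) (G *m inc D m w).
  have e : A + c = 1 + vnorm (x + a) ^+ 2 by rewrite AE cE; ring.
  rewrite -/(t w) in cs; move=> /(_ _) hh.
  have {}hh : (2 * vdot (x + a) (G *m inc D m w)) ^+ 2 <= 4 * (A + c) * t w -> _ := hh.
  have bnd : (2 * vdot (x + a) (G *m inc D m w)) ^+ 2 <= 4 * (A + c) * t w.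
    rewrite e exprMn (_ : 2 ^+ 2 = 4); last by rewrite expr2 -natrM.
    rewrite -mulrA ler_wpM2l//; apply: (le_trans cs); rewrite ler_wpM2r//.
    by rewrite lerDr.
  have {}hh := hh bnd.
  rewrite !FE scale1r scaleN1r vnormD_sq vnormB_sq -/(t w).
  have -> : 1 + (vnorm (x + a) ^+ 2 + 2 * vdot (x + a) (G *m inc D m w) + t w) =
    A + c + t w + 2 * vdot (x + a) (G *m inc D m w) by rewrite e; ring.
  have -> : 1 + (vnorm (x + a) ^+ 2 - 2 * vdot (x + a) (G *m inc D m w) + t w) =
    A + c + t w - 2 * vdot (x + a) (G *m inc D m w) by rewrite e; ring.
  apply: (le_trans hh); rewrite /c0 /c1 le_eqVlt; apply/orP; left; apply/eqP; ring.
have -> : (\int[P]_w ((1 + vnorm (x + a + G *m inc D m w) ^+ 2) `^ q)%:E =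
    \int[P]_w ((F 1 (inc D m w) + F (-1) (inc D m w)) / 2)%:E)%E.
  have e1 : (\int[P]_w ((1 + vnorm (x + a + G *m inc D m w) ^+ 2) `^ q)%:E = \int[P]_w (F 1 (inc D m w))%:E)%E.
    by apply: eq_integral => w _; rewrite FE scale1r.
  rewrite e1; under [RHS]eq_integral do rewrite mulrC EFinM EFinD.
  rewrite ge0_integralZl//; last 2 first.
  - by apply/measurable_EFinP; exact: measurable_funD.
  - by move=> w _; rewrite -EFinD lee_fin addr_ge0.
  rewrite ge0_integralD//; [|by move=> w _; rewrite lee_fin|exact/measurable_EFinP|by move=> w _; rewrite lee_fin|exact/measurable_EFinP].
  (* [I] is not yet known to be finite, so halving [I + I] distinguishes the infinite case. *)
  rewrite flip; set I := (\int[P]_w _)%E.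
  have I0 : (0 <= I)%E by apply: integral_ge0 => w _; rewrite lee_fin.
  case: I I0 => [r| |]//=; rewrite ?lee_fin => r0.
    by rewrite -EFinD -EFinM -mulr2n -[r *+ 2]mulr_natl mulKf// pnatr_eq0.
  by rewrite addye// gt0_muley// lte_fin invr_gt0.
apply: (@le_trans _ _ (\int[P]_w (c0%:E + c1%:E * (t w)%:E + C%:E * (taylor_rem q A (t w))%:E))%E).
  apply: ge0_le_integral => //.
  - by move=> w _; rewrite lee_fin divr_ge0// addr_ge0.
  - by apply/measurable_EFinP; apply: measurable_funM => //; exact: measurable_funD.
  - by apply/measurable_EFinP; apply: measurable_funD; [apply: measurable_funD => //|]; exact: measurable_funM.
  - by move=> w _; rewrite -!EFinM -!EFinD lee_fin.
rewrite ge0_integralD//; last 4 first.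
- by move=> w _; rewrite -EFinM -EFinD lee_fin addr_ge0// mulr_ge0.
- by apply/measurable_EFinP; apply: measurable_funD => //; exact: measurable_funM.
- by move=> w _; rewrite -EFinM lee_fin mulr_ge0// taylor_rem_ge0.
- by apply/measurable_EFinP; exact: measurable_funM.
rewrite ge0_integralD//; last 2 first.
- by move=> w _; rewrite -EFinM lee_fin mulr_ge0.
- by apply/measurable_EFinP; exact: measurable_funM.
rewrite integral_cst//= probability_setT mule1.
rewrite ge0_integralZl//; [|exact/measurable_EFinP|by move=> w _; rewrite lee_fin].
rewrite ge0_integralZl//; [|exact/measurable_EFinP|by move=> w _; rewrite lee_fin taylor_rem_ge0].
rewrite leeD2r//.
have ht := @integral_vnorm_mulmx_inc _ _ _ _ _ _ _ D0 hB n G m.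
apply: (le_trans (leeD2l _ (lee_wpmul2l _ ht))); first by rewrite lee_fin.
rewrite -EFinM -EFinD lee_fin /c0 /c1 le_eqVlt; apply/orP; left; apply/eqP; ring.
Qed.

End OneStep.

(** * Piecewise linear interpolation *)

Section Jensen.
Context {R : realType}.

Lemma powR_tangent_at (r c y : R) : 1 <= r -> 0 < c -> 0 <= y ->
  c `^ r + r * c `^ (r - 1) * (y - c) <= y `^ r.
Proof.
move=> r1 c0; rewrite le_eqVlt => /predU1P[<-|y0].
  rewrite powR0 ?gt_eqF//; last lra.
  have : c `^ (r - 1) * c = c `^ r by rewrite powR_succ// subrK.
  have : 0 <= c `^ r by exact: powR_ge0.
  move: (c `^ r) (c `^ (r - 1)) => u v; nra.
have yc : 0 < y / c by rewrite divr_gt0.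
have -> : y `^ r = c `^ r * (y / c) `^ r.
  by rewrite -powRM ?ltW// mulrCA divff ?gt_eqF// mulr1.
have h := powR_tangent yc r1.
apply: le_trans (ler_wpM2l (powR_ge0 c r) h).
rewrite -powR_pred// le_eqVlt; apply/orP; left; apply/eqP; field.
by rewrite gt_eqF.
Qed.

(** The power lies above its tangent at the weighted mean, and the linear parts cancel in the
    weighted sum. A zero mean is separate because the tangent point must be positive. *)
Lemma jensen_powR n (w y : 'I_n -> R) (r : R) : 1 <= r ->
  (forall i, 0 <= w i) -> (forall i, 0 <= y i) -> \sum_i w i = 1 ->
  (\sum_i w i * y i) `^ r <= \sum_i w i * y i `^ r.
Proof.
move=> r1 w0 y0 w1; set c := \sum_i w i * y i.
have : 0 <= c by apply: sumr_ge0 => i _; exact: mulr_ge0.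
rewrite le_eqVlt => /predU1P[<-|c0].
  rewrite powR0; last by rewrite gt_eqF//; lra.
  by apply: sumr_ge0 => i _; rewrite mulr_ge0 ?powR_ge0.
have : \sum_i w i * (c `^ r + r * c `^ (r - 1) * (y i - c)) <= \sum_i w i * y i `^ r.
  by apply: ler_sum => i _; rewrite ler_wpM2l// powR_tangent_at.
apply: le_trans.
have -> : \sum_i w i * (c `^ r + r * c `^ (r - 1) * (y i - c)) =
   c `^ r * (\sum_i w i) + r * c `^ (r - 1) * (\sum_i w i * y i - c * \sum_i w i).
  rewrite mulr_sumr mulrBr !mulr_sumr -sumrB -big_split/=; apply: eq_bigr => i _; ring.
by rewrite w1 mulr1 mulr1 subrr mulr0 addr0.
Qed.

Lemma jensen_sqr n (w y : 'I_n -> R) :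
  (forall i, 0 <= w i) -> \sum_i w i = 1 ->
  (\sum_i w i * y i) ^+ 2 <= \sum_i w i * y i ^+ 2.
Proof.
move=> w0 w1; set c := \sum_i w i * y i.
have : \sum_i w i * (c ^+ 2 + 2 * c * (y i - c)) <= \sum_i w i * y i ^+ 2.
  apply: ler_sum => i _; rewrite ler_wpM2l//.
  by rewrite -subr_ge0 (_ : _ - _ = (y i - c) ^+ 2) ?sqr_ge0//; ring.
apply: le_trans.
have -> : \sum_i w i * (c ^+ 2 + 2 * c * (y i - c)) =
   c ^+ 2 * (\sum_i w i) + 2 * c * (\sum_i w i * y i - c * \sum_i w i).
  rewrite mulr_sumr mulrBr !mulr_sumr -sumrB -big_split/=; apply: eq_bigr => i _; ring.
by rewrite w1 mulr1 mulr1 subrr mulr0 addr0.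
Qed.

Lemma jensen_vnorm_sq n m (w : 'I_m -> R) (x : 'I_m -> 'cV[R]_n) :
  (forall i, 0 <= w i) -> \sum_i w i = 1 ->
  vnorm (\sum_i w i *: x i) ^+ 2 <= \sum_i w i * vnorm (x i) ^+ 2.
Proof.
move=> w0 w1; rewrite vnorm_sqE.
under [leRHS]eq_bigr do rewrite vnorm_sqE mulr_sumr.
rewrite exchange_big/=; apply: ler_sum => c _; rewrite summxE.
under [X in X ^+ 2]eq_bigr do rewrite mxE.
exact: jensen_sqr.
Qed.

End Jensen.

(** * Hat functions as a partition of unity *)

Section Hat.
Context {R : realType}.

(* [Num.max 0 (1 - `|s|)] *)
Definition hat (s : R) : R := (1 - `|s| + `|1 - `|s| |) / 2.

Lemma hat_ge0 s : 0 <= hat s.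
Proof. by rewrite /hat; have := lerNnormlW (lexx `|1 - `|s| |); have := ler_norm (- (1 - `|s|)); rewrite normrN; lra. Qed.

Lemma hat_out s : 1 <= `|s| -> hat s = 0.
Proof. by move=> h; rewrite /hat (@ler0_norm _ (1 - `|s|)); lra. Qed.

Lemma hat_in s : 0 <= s <= 1 -> hat s = 1 - s.
Proof. by move=> /andP[? ?]; rewrite /hat (ger0_norm (_ : 0 <= s))// ger0_norm; lra. Qed.

Lemma hat_in_neg s : -1 <= s <= 0 -> hat s = 1 + s.
Proof. by move=> /andP[? ?]; rewrite /hat (ler0_norm (_ : s <= 0))// ger0_norm; lra. Qed.

Lemma hat_sum (V : lmodType R) (N : nat) (s : R) (j : nat) (v : nat -> V) :
  (j < N)%N -> 0 <= s - j%:R <= 1 ->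
  \sum_(i < N.+1) hat (s - i%:R) *: v i = (1 - (s - j%:R)) *: v j + (s - j%:R) *: v j.+1.
Proof.
move=> jN /andP[s0 s1].
have j1 : (j < N.+1)%N by exact: ltnW.
have j2 : (j.+1 < N.+1)%N by [].
rewrite (bigD1 (Ordinal j1))//= (bigD1 (Ordinal j2))/=; last first.
  by rewrite -val_eqE/= gtn_eqF.
rewrite big1 ?addr0; last first.
  move=> i /andP[ij1 ij2]; rewrite hat_out ?scale0r//.
  move: ij1 ij2; rewrite -!val_eqE/= => ij1 ij2.
  have [ij|ij] := ltnP i j.
    have : i.+1%:R <= j%:R :> R by rewrite ler_nat.
    by rewrite -natr1 => h; rewrite ger0_norm; lra.
  have : (j.+1 < i)%N by rewrite ltn_neqAle eq_sym ij2 ltn_neqAle eq_sym ij1 ij.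
  rewrite -(ler_nat R) -2!natr1 => ij'.
  by rewrite ler0_norm; lra.
rewrite hat_in ?s0// hat_in_neg; last by rewrite -natr1; lra.
by congr (_ + _ *: _); rewrite -natr1; lra.
Qed.

Lemma hat_locate (N : nat) (s : R) : (0 < N)%N -> 0 <= s <= N%:R ->
  exists2 j, (j < N)%N & 0 <= s - j%:R <= 1.
Proof.
move=> N0 /andP[s0 sN]; have [h|h] := ltnP (Num.truncn s) N.
  exists (Num.truncn s) => //.
  by have := truncnS_gt s; have := truncn_le s; rewrite s0 -natr1; lra.
(* Only [s = N] reaches this case; it is assigned to the last interval. *)
exists N.-1; first by rewrite prednK.
have h2 : (Num.truncn s)%:R <= s by rewrite truncn_le.
have h3 : N%:R <= (Num.truncn s)%:R :> R by rewrite ler_nat.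
have : N%:R = N.-1%:R + 1 :> R by rewrite natr1 prednK.
by lra.
Qed.

Lemma hat_sum1 (N : nat) (s : R) : (0 < N)%N -> 0 <= s <= N%:R ->
  \sum_(i < N.+1) hat (s - i%:R) = 1.
Proof.
move=> N0 /(hat_locate N0)[j jN sj].
have := @hat_sum R^o N s j (fun=> 1) jN sj; rewrite /GRing.scale/=.
under eq_bigr do rewrite mulr1.
by move=> ->; lra.
Qed.

Lemma continuous_hat : continuous hat.
Proof.
move=> s; rewrite /hat; apply: cvgM; last exact: cvg_cst.
have c1 : 1 - `|x| @[x --> s] --> 1 - `|s|.
  by apply: cvgB; [exact: cvg_cst|exact: cvg_norm].
by apply: cvgD => //; exact: cvg_norm c1.
Qed.

End Hat.

(** * The interpolated segment as a convex combination of nodes *)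

Section Interpolation.
Context {R : realType} {n : nat} (tau : R) (N : nat).
Hypotheses (tau0 : 0 < tau) (N0 : (0 < N)%N).
Local Notation D := (stepsize tau N).
Implicit Types (h : nat -> 'cV[R]_n) (k : nat) (th : R).

Lemma stepsize_gt0 : 0 < D.
Proof. by rewrite divr_gt0// ltr0n. Qed.

Lemma stepsizeN : N%:R * D = tau.
Proof. by rewrite /stepsize mulrCA divff ?mulr1// pnatr_eq0 -lt0n. Qed.

Definition wt (i : nat) (th : R) : R := hat (th / D + N%:R - i%:R).

Lemma interp_range th : - tau <= th <= 0 -> 0 <= th / D + N%:R <= N%:R.
Proof.
move=> /andP[t1 t2]; have D0 := stepsize_gt0.
have h1 : - N%:R <= th / D by rewrite ler_pdivlMr// mulNr stepsizeN.
have h2 : th / D <= 0 by rewrite ler_pdivrMr// mul0r.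
by apply/andP; split; lra.
Qed.

Lemma wt_ge0 i th : 0 <= wt i th. Proof. exact: hat_ge0. Qed.

Lemma wt_sum1 th : - tau <= th <= 0 -> \sum_(i < N.+1) wt i th = 1.
Proof. by move=> /interp_range h; exact: hat_sum1. Qed.

Lemma continuous_wt i : continuous (wt i).
Proof.
move=> th; rewrite /wt.
have c : x / D + N%:R - i%:R @[x --> th] --> th / D + N%:R - i%:R.
  by apply: cvgB; [apply: cvgD; [apply: cvgM; [exact: cvg_id|exact: cvg_cst]|exact: cvg_cst]|exact: cvg_cst].
exact: (continuous_comp c (@continuous_hat R _)).
Qed.

Lemma YbarE h k th : - tau <= th <= 0 ->
  Ybar tau N h k th = \sum_(i < N.+1) wt i th *: h (k + i)%N.
Proof.
move=> ht; have D0 := stepsize_gt0.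
have DN0 : D != 0 by rewrite gt_eqF.
have := interp_range ht; set s := th / D + N%:R => /andP[s0 sN].
rewrite /Ybar; set fl := Num.floor (th / D).
have f1 : fl%:~R <= th / D by exact: floor_le_tmp.
have f2 : th / D < fl%:~R + 1 by have := floorD1_gt (th / D); rewrite intrD.
have NE : (N%:Z)%:~R = N%:R :> R by rewrite -pmulrn.
have Nfl : - N%:Z <= fl.
  rewrite -ltzD1 -(@ltr_int R) mulrNz NE intrD; apply: le_lt_trans f2.
  by rewrite /s in s0; lra.
set j : int := Num.max _ _.
have jE : j = Num.min fl (-1).
  rewrite /j; apply/max_idPr; rewrite le_min Nfl/= lerNl opprK lez_nat//.
have jN : - N%:Z <= j by rewrite /j le_max lexx.
have j1 : j <= -1 by rewrite jE ge_min lexx orbT.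
have jn0 : 0 <= j + N%:Z by rewrite -lerBlDr sub0r.
set jn := `|(j + N%:Z)%R|%N.
have jnE : j + N%:Z = jn%:Z by rewrite /jn gez0_abs.
have jnR : jn%:R = j%:~R + N%:R :> R.
  by have -> : jn%:R = (jn%:Z)%:~R :> R by []; rewrite -jnE intrD NE.
have jnN : (jn < N)%N.
  by rewrite -ltz_nat -jnE -ltrBrDr subrr; apply: le_lt_trans j1 _.
have sj : 0 <= s - jn%:R <= 1.
  (* When the floor is not below -1 the index is -1; the floor is then -1 or, at [th = 0], equal to
     0. *)
  rewrite jnR jE minElt; case: ifPn => hfl.
    by rewrite /s; lra.
  have : fl%:~R <= (0 : int)%:~R :> R.
    by apply: le_trans f1 _; rewrite /s in sN; lra.
  rewrite ler_int => fl0.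
  have : -1 <= fl by rewrite leNgt.
  rewrite -(@ler_int R) mulrNz => fl1.
  by rewrite /s in s0 sN *; lra.
rewrite /wt -/s (@hat_sum R 'cV[R]_n N s jn (fun i => h (k + i)%N))// addnS.
congr (_ *: _ + _ *: _); rewrite jnR /s ?intrD; field; exact: DN0.
Qed.

Lemma Ybar0 h k : Ybar tau N h k 0 = h (k + N)%N.
Proof.
rewrite YbarE; last by rewrite lexx oppr_le0 ltW.
rewrite (bigD1 ord_max)//= big1 ?addr0; last first.
  move=> i iN; rewrite /wt hat_out ?scale0r// mul0r add0r.
  have iN' : (i < N)%N by rewrite ltn_neqAle -ltnS ltn_ord andbT.
  have : i.+1%:R <= N%:R :> R by rewrite ler_nat.
  by rewrite -natr1 => h'; rewrite ger0_norm; lra.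
by rewrite /wt mul0r add0r subrr hat_in ?subr0 ?scale1r// lexx ler01.
Qed.

Lemma Ybar_vnorm_sq h k th : - tau <= th <= 0 ->
  vnorm (Ybar tau N h k th) ^+ 2 <= \sum_(i < N.+1) wt i th * vnorm (h (k + i)%N) ^+ 2.
Proof.
by move=> ht; rewrite YbarE//; apply: jensen_vnorm_sq; [move=> i; exact: wt_ge0|exact: wt_sum1].
Qed.

Lemma Ybar_vnorm_le h k (l : R) : 0 <= l ->
  (forall i, (i <= N)%N -> vnorm (h (k + i)%N) <= l) -> supnorm_le tau (Ybar tau N h k) l.
Proof.
move=> l0 hl th ht; rewrite -(@ler_pXn2r _ 2)// ?nnegrE ?vnorm_ge0//.
apply: (le_trans (Ybar_vnorm_sq h k ht)).
apply: (@le_trans _ _ (\sum_(i < N.+1) wt i th * l ^+ 2)).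
  apply: ler_sum => i _; rewrite ler_wpM2l ?wt_ge0// ler_pXn2r ?nnegrE ?vnorm_ge0//.
  by apply: hl; rewrite -ltnS.
by rewrite -mulr_suml wt_sum1// mul1r.
Qed.

Lemma Ybar_in_C h k : in_C tau (Ybar tau N h k).
Proof.
move=> c.
have ct : continuous (fun th => \sum_(i < N.+1) wt i th * h (k + i)%N c 0 : R).
  elim: N.+1 => [|m IH]; first by rewrite (_ : (fun _ => _) = fun=> 0); [exact: cst_continuous|apply/funext => ?; rewrite big_ord0].
  rewrite (_ : (fun _ => _) = fun th => \sum_(i < m) wt i th * h (k + i)%N c 0 + wt m th * h (k + m)%N c 0); last first.
    by apply/funext => ?; rewrite big_ord_recr.
  by move=> th; apply: cvgD; [exact: IH|apply: cvgM; [exact: continuous_wt|exact: cvg_cst]].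
apply: (@subspace_eq_continuous _ _ _ (fun th => \sum_(i < N.+1) wt i th * h (k + i)%N c 0 : R)).
  move=> th; rewrite inE/= in_itv/= => ht; rewrite /from_subspace YbarE// summxE.
  by apply: eq_bigr => i _; rewrite mxE.
exact: continuous_subspaceT.
Qed.

End Interpolation.

(** * Integration over the delay interval *)

Section Segment.
Context {R : realType} (tau : R).
Hypothesis tau0 : 0 < tau.
Implicit Types u v : R -> R.

(** [Iseg] is real-valued, and its linearity and monotonicity are used for integrable functions; on
    a bounded interval this class, closed under sums and products, supplies them. *)
Definition bmeas u := measurable_fun `[- tau, 0] u /\
  exists M, forall th, - tau <= th <= 0 -> `|u th| <= M.

Lemma lebesgue_segment : @lebesgue_measure R `[- tau, 0] = tau%:E.
Proof.
rewrite lebesgue_measure_itv/= lte_fin oppr_lt0 tau0 -EFinD.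
by congr (_%:E); ring.
Qed.

Lemma bmeas_integrable u : bmeas u -> (@lebesgue_measure R).-integrable `[- tau, 0] (EFin \o u).
Proof.
move=> [mu [M uM]]; apply: measurable_bounded_integrable => //.
  by rewrite [X in (X < _)%E]lebesgue_segment ltry.
exists M; split; first by rewrite num_real.
by move=> x Mx t /=; rewrite in_itv/= => /uM/le_trans; apply; exact: ltW.
Qed.

Lemma bmeas_cst c : bmeas (fun=> c).
Proof. by split; [exact: measurable_cst|exists `|c|]. Qed.

Lemma bmeasD u v : bmeas u -> bmeas v -> bmeas (fun th => u th + v th).
Proof.
move=> [mu [M uM]] [mv [M' vM]]; split; first exact: measurable_funD.
by exists (M + M') => th ht; rewrite (le_trans (ler_normD _ _))// lerD ?uM ?vM.
Qed.

Lemma bmeasM u v : bmeas u -> bmeas v -> bmeas (fun th => u th * v th).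
Proof.
move=> [mu [M uM]] [mv [M' vM]]; split; first exact: measurable_funM.
by exists (M * M') => th ht; rewrite normrM ler_pM ?uM ?vM.
Qed.

Lemma bmeas_eq u v : (forall th, - tau <= th <= 0 -> u th = v th) -> bmeas u -> bmeas v.
Proof.
move=> uv [mu [M uM]]; split; last by exists M => th ht; rewrite -uv ?uM.
by apply: eq_measurable_fun mu => th; rewrite inE/= in_itv/=; exact: uv.
Qed.

Lemma bmeas_sum m (F : nat -> R -> R) : (forall i, bmeas (F i)) ->
  bmeas (fun th => \sum_(i < m) F i th).
Proof.
move=> h; elim: m => [|m IH].
  by apply: bmeas_eq (bmeas_cst 0) => th _; rewrite big_ord0.
by apply: bmeas_eq (bmeasD IH (h m)) => th _; rewrite big_ord_recr.
Qed.

Lemma within_continuous_bounded u : {within `[- tau, 0], continuous u} ->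
  exists M, forall th, - tau <= th <= 0 -> `|u th| <= M.
Proof.
move=> cw; have t0 : - tau <= 0 by rewrite oppr_le0 ltW.
have [c1 _ h1] := EVT_max t0 cw; have [c2 _ h2] := EVT_min t0 cw.
exists (`|u c1| + `|u c2|) => th ht.
have := h1 th; have := h2 th; rewrite in_itv/= => /(_ ht) + /(_ ht).
have := ler_norm (u c1); have := ler_norm (- u c2); rewrite normrN.
have := normr_ge0 (u c1); have := normr_ge0 (u c2).
by rewrite ler_norml; move=> *; apply/andP; split; lra.
Qed.

Lemma bmeas_continuous u : continuous u -> bmeas u.
Proof.
move=> cu; split; first exact: measurable_funS (continuous_measurable_fun cu).
by apply: within_continuous_bounded; exact: continuous_subspaceT.
Qed.

Lemma bmeas_bounded u M : measurable_fun `[- tau, 0] u ->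
  (forall th, - tau <= th <= 0 -> 0 <= u th <= M) -> bmeas u.
Proof.
move=> mu uM; split => //; exists M => th /uM/andP[u0 ?].
by rewrite ger0_norm.
Qed.

Lemma Iseg_eq u v : (forall th, - tau <= th <= 0 -> u th = v th) -> Iseg tau u = Iseg tau v.
Proof.
by move=> uv; apply: eq_Rintegral => th; rewrite inE/= in_itv/=; exact: uv.
Qed.

Lemma Iseg_ge0 u : (forall th, - tau <= th <= 0 -> 0 <= u th) -> 0 <= Iseg tau u.
Proof. by move=> u0; apply: Rintegral_ge0 => th /=; rewrite in_itv/=; exact: u0. Qed.

Lemma Iseg_le u v : bmeas u -> bmeas v ->
  (forall th, - tau <= th <= 0 -> u th <= v th) -> Iseg tau u <= Iseg tau v.
Proof.
move=> mu mv uv; apply: le_Rintegral; [by []|exact: bmeas_integrable|exact: bmeas_integrable|].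
by move=> th /=; rewrite in_itv/=; exact: uv.
Qed.

Lemma IsegD u v : bmeas u -> bmeas v -> Iseg tau (fun th => u th + v th) = Iseg tau u + Iseg tau v.
Proof. by move=> mu mv; rewrite /Iseg RintegralD//; exact: bmeas_integrable. Qed.

Lemma IsegZ c u : bmeas u -> Iseg tau (fun th => c * u th) = c * Iseg tau u.
Proof. by move=> mu; rewrite /Iseg RintegralZl//; exact: bmeas_integrable. Qed.

Lemma Iseg_cst c : Iseg tau (fun=> c) = c * tau.
Proof. by rewrite /Iseg Rintegral_cst//= lebesgue_segment. Qed.

Lemma Iseg_sum m (c : nat -> R) (F : nat -> R -> R) : (forall i, bmeas (F i)) ->
  Iseg tau (fun th => \sum_(i < m) c i * F i th) = \sum_(i < m) c i * Iseg tau (F i).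
Proof.
move=> h; have h' i : bmeas (fun th => c i * F i th) by apply: bmeasM => //; exact: bmeas_cst.
elim: m => [|m IH].
  by rewrite big_ord0 -[RHS](mul0r tau) -Iseg_cst; apply: Iseg_eq => th _; rewrite big_ord0.
rewrite big_ord_recr/= -IH -IsegZ// -IsegD//; last exact: (bmeas_sum m h').
by apply: Iseg_eq => th _; rewrite big_ord_recr.
Qed.

Lemma bmeas_inW rho : inW tau rho -> bmeas rho.
Proof.
move=> [mr r0 [M rM] _]; apply: (@bmeas_bounded _ M) => // th ht.
by rewrite r0// rM.
Qed.

(** The plain average is the kernel [tau^-1], so both delay terms of (A2) are treated by the same
    node weights. *)
Lemma inW_cst : inW tau (fun=> tau^-1).
Proof.
split; [exact: measurable_cst| | |].
- by move=> *; rewrite invr_ge0 ltW.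
- by exists tau^-1.
- by rewrite Iseg_cst mulVf// gt_eqF.
Qed.

End Segment.

(** * Node weights of a delay kernel *)

Section InterpolationWeights.
Context {R : realType} {n : nat} (tau : R) (N : nat).
Hypotheses (tau0 : 0 < tau) (N0 : (0 < N)%N).
Local Notation Yb := (@Ybar R n tau N).
Implicit Types (h : nat -> 'cV[R]_n) (k : nat) (th : R).

(** Integrating the partition of unity against [rho] gives a probability vector on the nodes; these
    vectors become the delay weights of the recursion. *)
Definition node_weight rho i := Iseg tau (fun th => wt tau N i th * rho th).

Lemma bmeas_wt i : bmeas tau (wt tau N i).
Proof. by apply: bmeas_continuous => //; exact: continuous_wt. Qed.

Lemma node_weight_ge0 rho i : inW tau rho -> 0 <= node_weight rho i.
Proof. by move=> [_ r0 _ _]; apply: Iseg_ge0 => th ht; rewrite mulr_ge0 ?wt_ge0 ?r0. Qed.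

Lemma node_weight_sum1 rho : inW tau rho -> \sum_(i < N.+1) node_weight rho i = 1.
Proof.
move=> rW; have [_ _ _ <-] := rW; have mr := bmeas_inW rW.
transitivity (Iseg tau (fun th => \sum_(i < N.+1) 1 * (wt tau N i th * rho th))).
  rewrite (Iseg_sum tau0 N.+1 (fun=> 1) (F := fun i th => wt tau N i th * rho th)).
    by apply: eq_bigr => i _; rewrite mul1r.
  by move=> i; apply: bmeasM => //; exact: bmeas_wt.
apply: Iseg_eq => th ht; under eq_bigr do rewrite mul1r.
by rewrite -mulr_suml wt_sum1// mul1r.
Qed.

Lemma bmeas_Ybar h k c : bmeas tau (fun th => Yb h k th c 0).
Proof.
apply: (@bmeas_eq _ _ (fun th => \sum_(i < N.+1) wt tau N i th * h (k + i)%N c 0)).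
  by move=> th ht; rewrite YbarE// summxE; apply: eq_bigr => i _; rewrite mxE.
apply: (bmeas_sum N.+1 (F := fun i th => wt tau N i th * h (k + i)%N c 0)) => i.
by apply: bmeasM; [exact: bmeas_wt|exact: bmeas_cst].
Qed.

Lemma bmeas_vnorm_sq (phi : R -> 'cV[R]_n) : (forall c, bmeas tau (fun th => phi th c 0)) ->
  bmeas tau (fun th => vnorm (phi th) ^+ 2).
Proof.
case: n phi => [|m] phi h.
  by apply: bmeas_eq (bmeas_cst tau 0) => th _; rewrite vnorm_sqE big_ord0.
apply: (@bmeas_eq _ _ (fun th => \sum_(i < m.+1) (phi th (inord i) 0 * phi th (inord i) 0))).
  by move=> th _; rewrite vnorm_sqE; apply: eq_bigr => i _; rewrite inord_val.
apply: (bmeas_sum m.+1 (F := fun i th => phi th (inord i) 0 * phi th (inord i) 0)) => i.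
exact: bmeasM.
Qed.

Lemma bmeas_powR (u : R -> R) r : 0 <= r -> (forall th, - tau <= th <= 0 -> 0 <= u th) ->
  bmeas tau u -> bmeas tau (fun th => u th `^ r).
Proof.
move=> r0 u0 [mu [M uM]].
apply: (@bmeas_bounded _ _ _ (M `^ r)).
  exact: measurableT_comp (measurable_powR r) mu.
move=> th ht; rewrite powR_ge0/=; have := uM _ ht; have := u0 _ ht => h1.
rewrite ger0_norm// => h2; rewrite ge0_ler_powR// nnegrE//; lra.
Qed.

Lemma vnorm_powR_sq m (x : 'cV[R]_m) r : vnorm x `^ (2 * r) = (vnorm x ^+ 2) `^ r.
Proof. by rewrite powRrM -powR_mulrn ?vnorm_ge0. Qed.

(** At each point convexity is used twice with the hat weights, for the squared norm and for the
    [r]-th power. The total weight stays 1, so [a_3] is not enlarged by the interpolation. *)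
Lemma Iseg_Ybar_powR_le rho h k r : inW tau rho -> 1 <= r ->
  Iseg tau (fun th => vnorm (Yb h k th) `^ (2 * r) * rho th) <=
  \sum_(i < N.+1) node_weight rho i * (vnorm (h (k + i)%N) ^+ 2) `^ r.
Proof.
move=> rW r1; have mr := bmeas_inW rW; have [_ rho0 _ _] := rW.
have r0 : 0 <= r by lra.
have mw i : bmeas tau (fun th => wt tau N i th * rho th).
  by apply: bmeasM => //; exact: bmeas_wt.
under [leRHS]eq_bigr do rewrite mulrC.
rewrite -(Iseg_sum tau0 N.+1 (fun i => (vnorm (h (k + i)%N) ^+ 2) `^ r) mw).
apply: Iseg_le => //.
- apply: bmeasM => //; apply: (@bmeas_eq _ _ (fun th => (vnorm (Yb h k th) ^+ 2) `^ r)).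
    by move=> th _; rewrite vnorm_powR_sq.
  apply: bmeas_powR => // [th _|]; first exact: sqr_ge0.
  by apply: bmeas_vnorm_sq => c; exact: bmeas_Ybar.
- apply: (bmeas_sum N.+1 (F := fun i th => (vnorm (h (k + i)%N) ^+ 2) `^ r * (wt tau N i th * rho th))) => i.
  by apply: bmeasM => //; exact: bmeas_cst.
- move=> th ht; rewrite vnorm_powR_sq.
  apply: (@le_trans _ _ ((\sum_(i < N.+1) wt tau N i th * (vnorm (h (k + i)%N) ^+ 2) `^ r) * rho th)).
    rewrite ler_wpM2r ?rho0//.
    apply: (@le_trans _ _ ((\sum_(i < N.+1) wt tau N i th * vnorm (h (k + i)%N) ^+ 2) `^ r)).
      rewrite ge0_ler_powR// ?nnegrE ?sqr_ge0//; last exact: Ybar_vnorm_sq.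
      by apply: sumr_ge0 => i _; rewrite mulr_ge0 ?wt_ge0 ?sqr_ge0.
    apply: jensen_powR => //; [by move=> i; exact: wt_ge0|by move=> i; exact: sqr_ge0|exact: wt_sum1].
  rewrite mulr_suml le_eqVlt; apply/orP; left; apply/eqP; apply: eq_bigr => i _.
  by rewrite mulrAC mulrC.
Qed.

Lemma Iseg_Ybar_sq_le h k :
  tau^-1 * Iseg tau (fun th => vnorm (Yb h k th) ^+ 2) <=
  \sum_(i < N.+1) node_weight (fun=> tau^-1) i * vnorm (h (k + i)%N) ^+ 2.
Proof.
have := Iseg_Ybar_powR_le h k (inW_cst tau0) (lexx 1).
under [X in _ <= X -> _]eq_bigr do rewrite powRr1 ?sqr_ge0//.
apply: le_trans; rewrite -IsegZ//; last by apply: bmeas_vnorm_sq => c; exact: bmeas_Ybar.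
rewrite le_eqVlt; apply/orP; left; apply/eqP; apply: Iseg_eq => th _.
by rewrite vnorm_powR_sq powRr1 ?sqr_ge0// mulrC.
Qed.

End InterpolationWeights.

(** * Growth of the coefficients *)

Section Growth.
Context {R : realType}.

Lemma vnorm0 n : vnorm (0 : 'cV[R]_n) = 0.
Proof. by rewrite /vnorm big1 ?sqrtr0// => i _; rewrite mxE expr0n. Qed.

Lemma sqrD_le2 (a b : R) : (a + b) ^+ 2 <= 2 * a ^+ 2 + 2 * b ^+ 2.
Proof. by have := sqr_ge0 (a - b); rewrite -subr_ge0 => h; nra. Qed.

Lemma vnormD_sq_le2 n (x y : 'cV[R]_n) :
  vnorm (x + y) ^+ 2 <= 2 * vnorm x ^+ 2 + 2 * vnorm y ^+ 2.
Proof.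
rewrite !vnorm_sqE !mulr_sumr -big_split/=; apply: ler_sum => i _.
by rewrite mxE sqrD_le2.
Qed.

Lemma mnormD_sq_le2 n d (x y : 'M[R]_(n, d)) :
  mnorm (x + y) ^+ 2 <= 2 * mnorm x ^+ 2 + 2 * mnorm y ^+ 2.
Proof.
rewrite !mnorm_sqE !mulr_sumr -big_split/=; apply: ler_sum => i _.
rewrite !mulr_sumr -big_split/=; apply: ler_sum => j _.
by rewrite mxE sqrD_le2.
Qed.

Context {n d : nat} (tau : R) (f : (R -> 'cV[R]_n) -> 'cV[R]_n)
  (g : (R -> 'cV[R]_n) -> 'M[R]_(n, d)).
Hypothesis tau0 : 0 < tau.
Implicit Type phi : R -> 'cV[R]_n.

Lemma in_C0 : in_C tau (fun=> 0 : 'cV[R]_n).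
Proof. by move=> i; apply: continuous_subspaceT => x; exact: cvg_cst. Qed.

Lemma supnorm_le0 (l : R) : 0 <= l -> supnorm_le tau (fun=> 0 : 'cV[R]_n) l.
Proof. by move=> l0 th _; rewrite vnorm0. Qed.

Lemma bmeas_vnorm phi : (forall c, bmeas tau (fun th => phi th c 0)) ->
  bmeas tau (fun th => vnorm (phi th)).
Proof.
move=> h; have h2 : (0 : R) <= 1 / 2 by lra.
apply: bmeas_eq (bmeas_powR h2 (fun th _ => sqr_ge0 _) (bmeas_vnorm_sq h)) => th _.
by rewrite -vnorm_powR_sq (_ : 2 * (1 / 2) = 1) ?powRr1 ?vnorm_ge0//; lra.
Qed.

Definition sqmass phi := vnorm (phi 0) ^+ 2 + tau^-1 * Iseg tau (fun th => vnorm (phi th) ^+ 2).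

Lemma Iseg_vnorm_sq_ge0 phi : 0 <= tau^-1 * Iseg tau (fun th => vnorm (phi th) ^+ 2).
Proof. by rewrite mulr_ge0 ?invr_ge0 ?(ltW tau0)//; apply: Iseg_ge0 => th _; exact: sqr_ge0. Qed.

Lemma sqmass_ge0 phi : 0 <= sqmass phi.
Proof. by rewrite addr_ge0 ?sqr_ge0 ?Iseg_vnorm_sq_ge0. Qed.

Lemma PsiE phi : Psi tau phi (fun=> 0) = sqmass phi.
Proof.
by rewrite /Psi /sqmass subr0; congr (_ + _ * _); apply: Iseg_eq => th _; rewrite subr0.
Qed.

(* If [sqmass phi = 0] then [Gamma_ok] gives no information (division by [0]). *)
Lemma A1_sqmass_eq0 phi l : A1 tau f g -> in_C tau phi ->
  (forall c, bmeas tau (fun th => phi th c 0)) -> 1 <= l -> supnorm_le tau phi l ->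
  sqmass phi = 0 ->
  vnorm (f phi - f (fun=> 0)) <= 0 /\ mnorm (g phi - g (fun=> 0)) <= 0.
Proof.
move=> hA1 cphi mphi l1 hl S0; have l0 : 0 < l by apply: lt_le_trans l1.
have [C [C0 hC]] := hA1 _ l0.
have := hC _ _ cphi in_C0 hl (supnorm_le0 (ltW l0)).
have := vnorm_ge0 (phi 0); have := Iseg_vnorm_sq_ge0 phi; have := sqr_ge0 (vnorm (phi 0)).
move: S0; rewrite /sqmass => S0 n1 n2 n3.
have e1 : vnorm (phi 0) ^+ 2 = 0 by lra.
have e2 : tau^-1 * Iseg tau (fun th => vnorm (phi th) ^+ 2) = 0 by lra.
rewrite /= subr0; have /eqP -> : vnorm (phi 0) == 0 by rewrite -sqrf_eq0 e1.
rewrite add0r; set m := Num.max _ _ => hm.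
suff m0 : m <= 0 by split; apply: le_trans m0; rewrite /m le_max lexx ?orbT.
(* A vanishing mean square forces a vanishing mean: [|phi| <= e + e^-1 |phi|^2] bounds the mean by
   every [e > 0], and this [e] gives [m <= m / 2]. *)
rewrite leNgt; apply/negP => mpos; pose e := m / (2 * C).
have e0 : 0 < e by rewrite divr_gt0 ?mulr_gt0.
have : tau^-1 * Iseg tau (fun th => vnorm (phi th - 0)) <= e.
  have -> : e = tau^-1 * (e * tau) + e^-1 * (tau^-1 * Iseg tau (fun th => vnorm (phi th) ^+ 2)).
    by rewrite e2 mulr0 addr0 mulrC mulfK// gt_eqF.
  rewrite [e^-1 * (_ * _)]mulrCA -mulrDr ler_wpM2l ?invr_ge0 ?(ltW tau0)//.
  have mq : bmeas tau (fun th => e^-1 * vnorm (phi th) ^+ 2).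
    by apply: bmeasM; [exact: bmeas_cst|exact: bmeas_vnorm_sq].
  rewrite -IsegZ//; last exact: bmeas_vnorm_sq.
  rewrite -Iseg_cst// -IsegD//; last exact: bmeas_cst.
  apply: Iseg_le => //.
  - by apply: bmeas_eq (bmeas_vnorm mphi) => th _; rewrite subr0.
  - by apply: bmeasD => //; exact: bmeas_cst.
  - move=> th _; rewrite subr0; have := vnorm_ge0 (phi th); move: (vnorm _) => a a0.
    have [h|h] := leP a e; first by have := mulr_ge0 (ltW (etrans (invr_gt0 e) e0)) (sqr_ge0 a); lra.
    apply: (@le_trans _ _ (e^-1 * a ^+ 2)); last lra.
    by rewrite mulrC ler_pdivlMr// expr2 ler_wpM2l// ltW.
move=> h; have : m <= C * e by apply: (le_trans hm); rewrite ler_wpM2l// ltW.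
have -> : C * e = m / 2 by rewrite /e; field; exact: lt0r_neq0.
lra.
Qed.

(** Comparison with the zero segment. For [kd = K Delta^(-lam)] the values at 0 are dominated as
    well, because [K] bounds them. Positive [sqmass] is needed to clear the denominators, and it
    yields the point where [phi] is nonzero. *)
Lemma growth phi Gam l kd : A1 tau f g -> Gamma_ok tau f g Gam -> in_C tau phi ->
  (forall c, bmeas tau (fun th => phi th c 0)) -> 1 <= l -> supnorm_le tau phi l ->
  Gam l = kd -> vnorm (f (fun=> 0)) <= kd -> mnorm (g (fun=> 0)) ^+ 2 <= kd ->
  vnorm (f phi) ^+ 2 <= 2 * kd ^+ 2 * (1 + sqmass phi) /\
  mnorm (g phi) ^+ 2 <= 2 * kd * (1 + sqmass phi).
Proof.
move=> hA1 [Gam0 _ _ _ hG] cphi mphi l1 hl Gl f0 g0; have S0 := sqmass_ge0 phi.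
have kd0 : 0 <= kd by apply: le_trans f0; exact: vnorm_ge0.
have f02 : vnorm (f (fun=> 0)) ^+ 2 <= kd ^+ 2 by rewrite ler_pXn2r ?nnegrE ?vnorm_ge0.
have [df dg] : vnorm (f phi - f (fun=> 0)) ^+ 2 <= kd ^+ 2 * sqmass phi /\
    mnorm (g phi - g (fun=> 0)) ^+ 2 <= kd * sqmass phi.
  have [e|Spos] := eqVneq (sqmass phi) 0.
    have [v1 v2] := A1_sqmass_eq0 hA1 cphi mphi l1 hl e.
    have n1 := vnorm_ge0 (f phi - f (fun=> 0)).
    have n2 : 0 <= mnorm (g phi - g (fun=> 0)) by exact: sqrtr_ge0.
    rewrite e !mulr0 (_ : vnorm _ = 0) 1?(_ : mnorm _ = 0) ?expr0n//; by apply/eqP; rewrite eq_le ?v1 ?v2 ?n1 ?n2.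
  have {}Spos : 0 < sqmass phi by rewrite lt_neqAle eq_sym Spos.
  have [th [ht pth]] : exists th, - tau <= th <= 0 /\ phi th != 0.
    apply: contrapT => hn; have z th : - tau <= th <= 0 -> phi th = 0.
      by move=> ht; apply/eqP/negPn/negP => hp; apply: hn; exists th.
    move: Spos; rewrite /sqmass z ?lexx ?oppr_le0 ?(ltW tau0)// vnorm0.
    rewrite (@Iseg_eq _ _ _ (fun=> 0)); last by move=> t ht; rewrite z// vnorm0 expr0n.
    by rewrite Iseg_cst// mul0r mulr0 expr0n addr0 ltxx.
  have := hG _ l1 _ _ cphi in_C0 hl (supnorm_le0 (le_trans ler01 l1)) (ex_intro _ th (conj ht pth)).
  rewrite Gl PsiE ge_max => /andP[h1 h2]; split; last by rewrite -ler_pdivrMr.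
  rewrite -[sqmass phi]sqr_sqrtr// -exprMn ler_pXn2r ?nnegrE ?vnorm_ge0 ?mulr_ge0 ?sqrtr_ge0//.
  by rewrite -ler_pdivrMr// sqrtr_gt0.
split.
  rewrite -[f phi](addrNK (f (fun=> 0))).
  apply: (le_trans (vnormD_sq_le2 _ _)); lra.
rewrite -[g phi](addrNK (g (fun=> 0))).
apply: (le_trans (mnormD_sq_le2 _ _)); lra.
Qed.

End Growth.

(** * Drift estimate *)

Section StepSizes.
Context {R : realType}.

Lemma powR_small (r e : R) : 0 < r -> 0 < e ->
  exists2 D0, 0 < D0 & forall D, 0 <= D <= D0 -> D `^ r <= e.
Proof.
move=> r0 e0; exists (e `^ r^-1); first exact: powR_gt0.
move=> D /andP[D0 De]; have -> : e = (e `^ r^-1) `^ r.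
  by rewrite -powRrM mulVf ?powRr1 ?gt_eqF// ltW.
by rewrite ge0_ler_powR// ?nnegrE ?powR_ge0// ltW.
Qed.

(** This is where [lam < 1/2] enters: one power of the step beats the squared growth constant of the
    truncated coefficients. *)
Lemma step_powRN_sq (D lam : R) : 0 < D <= 1 -> 0 < lam < 1 / 2 -> D * (D `^ (- lam)) ^+ 2 <= 1.
Proof.
move=> /andP[D0 D1] /andP[l0 l1]; rewrite -powR_mulrn ?powR_ge0// -powRrM.
have h : D `^ (- lam * 2) <= D `^ (- 1) by apply: ger_powR; [rewrite D0|lra].
apply: (le_trans (ler_wpM2l (ltW D0) h)).
by rewrite powR_inv1 ?(ltW D0)// divff// gt_eqF.
Qed.

End StepSizes.

(** * One step under the growth and dissipativity bounds *)

Section OneStep.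
Context {R : realType} dO (Omega : measurableType dO) (P : probability Omega R).
Context {d : nat} (B : R -> Omega -> 'cV[R]_d).
Hypothesis hB : is_BM P B.
Variables (q K lam a1 a3 : R).
Hypotheses (q1 : 1 <= q) (K0 : 0 <= K) (lam01 : 0 < lam < 1 / 2) (a10 : 0 <= a1) (a30 : 0 <= a3).

(* [T] bounds [1 + Psi(phi, 0)], [M] is the [a_3]-integral and [b] the dissipative term of (A2). *)
Definition step_bounds n (D T M b : R) (x y : 'cV[R]_n) (G : 'M[R]_(n, d)) : Prop :=
  [/\ 1 + vnorm x ^+ 2 <= T, 0 <= M /\ 0 <= b,
      vnorm y ^+ 2 <= 2 * (K * D `^ (- lam)) ^+ 2 * T,
      mnorm G ^+ 2 <= 2 * (K * D `^ (- lam)) * T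
    & 2 * vdot x y + (2 * q - 1) * mnorm G ^+ 2 <= a1 * T - b + a3 * M].

Lemma step_noise_le n D T M b (x y : 'cV[R]_n) (G : 'M[R]_(n, d)) : 0 < D <= 1 ->
  step_bounds D T M b x y G ->
  let s := D * mnorm G ^+ 2 in
  [/\ s <= 2 * K * (D * D `^ (- lam)) * T, s ^+ 2 <= 4 * K ^+ 2 * D * T ^+ 2
    & (D * D `^ (- lam)) ^+ 2 <= D].
Proof.
move=> D01 [AT [M0 b0] hy hG _] s; have /andP[D0 D1] := D01.
have hu := step_powRN_sq D01 lam01; have u0 := powR_ge0 D (- lam).
move: (D `^ (- lam)) hu u0 hG => u hu u0 hG.
have T0 : 0 <= T by have := sqr_ge0 (vnorm x); lra.
have s1 : s <= 2 * K * (D * u) * T.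
  have -> : 2 * K * (D * u) * T = D * (2 * (K * u) * T) by ring.
  by rewrite ler_wpM2l// ltW.
have Du : (D * u) ^+ 2 <= D.
  rewrite (_ : _ ^+ 2 = D * (D * u ^+ 2)); last ring.
  by rewrite -[leRHS]mulr1 ler_wpM2l// ltW.
have s0 : 0 <= s by rewrite mulr_ge0 ?sqr_ge0// ltW.
split => //; apply: (@le_trans _ _ ((2 * K * (D * u) * T) ^+ 2)).
  by rewrite ler_pXn2r// nnegrE// (le_trans s0).
have -> : (2 * K * (D * u) * T) ^+ 2 = 4 * K ^+ 2 * (D * u) ^+ 2 * T ^+ 2 by ring.
by rewrite ler_wpM2r ?sqr_ge0// ler_wpM2l// mulr_ge0 ?sqr_ge0.
Qed.

(** For [q >= 2], [v = D D^(-lam) <= 1] and [v^2 <= D] make [v^q] at most [D]. For [q < 2] a factor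
    [D] is gained by inserting (A2) in the noise bound; [q > 1] strictly makes the resulting
    coefficient of [M] small with [D]. *)
Lemma integral_noise_rem_le e : 1 < q -> 0 < e ->
  exists C D0, [/\ 0 <= C, 0 < D0 & forall n D T M b (x y : 'cV[R]_n) (G : 'M[R]_(n, d)) m,
    0 < D <= 1 -> D <= D0 -> step_bounds D T M b x y G ->
    (\int[P]_w (taylor_rem q (1 + vnorm x ^+ 2) (vnorm (G *m bm_inc B D m w) ^+ 2))%:E <=
     (D * (C * T `^ q + e * (T `^ (q - 1) * M)))%:E)%E].
Proof.
have [q1' a10' a30'] : [/\ 1 <= q, 0 <= a1 & 0 <= a3] by [].
have q0 : 0 <= q by exact: le_trans ler01 q1.
move=> q_gt1 e0; have [K' [K'0 hI]] := integral_taylor_rem_le hB q1.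
pose k1 := (2 * K) `^ (q - 1); pose k2 := (2 * K) `^ q.
have k10 : 0 <= k1 by exact: powR_ge0.
have k20 : 0 <= k2 by exact: powR_ge0.
(* From (A2), [|G|^2 <= C1 (T + M)] when [|z| <= T + M], and [|G|^2 <= C1 |z|] otherwise, with [z]
   the product of state and drift. *)
pose C1 := a1 + a3 + 2; have C10 : 0 <= C1 by rewrite /C1; lra.
pose e1 := e / (K' * k1 * C1 + 1).
have den0 : 0 < K' * k1 * C1 + 1 by rewrite ltr_wpDl// !mulr_ge0.
have e10 : 0 < e1 by rewrite divr_gt0.
(* The exponent is halved because smallness passes from [D] to [v] through [v^2 <= D]. *)
have [D0 D00 hD0] := @powR_small R ((q - 1) / 2) e1 (ltac:(lra)) e10.
pose C := K' * (4 * K ^+ 2 + k2) + e + K' * (2 * K ^+ 2 * C1 ^+ 2).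
have p1 : 0 <= K' * (4 * K ^+ 2 + k2) by rewrite mulr_ge0// addr_ge0// mulr_ge0 ?sqr_ge0.
have p2 : 0 <= K' * (2 * K ^+ 2 * C1 ^+ 2) by rewrite mulr_ge0// mulr_ge0 ?sqr_ge0// mulr_ge0 ?sqr_ge0.
exists C, D0; split => //; first by rewrite /C; lra.
move=> n D T M b x y G m D01 DD0 hs; have [s1 s2 Du2] := step_noise_le D01 hs.
have [AT [M0 b0] hy hG hd] := hs; have /andP[Dpos D1] := D01.
set A := 1 + vnorm x ^+ 2 in AT *; have A1 : 1 <= A by rewrite lerDl sqr_ge0.
have A0 : 0 < A by lra.
have T0 : 0 < T by lra.
have Ap : 0 <= T `^ (q - 1) * M by rewrite mulr_ge0 ?powR_ge0.
have Tq0 : 0 <= T `^ q by exact: powR_ge0.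
have := hI D A n G m Dpos A0; move: s1 s2; set s := D * mnorm G ^+ 2 => s1 s2 [i1 i2 i3].
have s0 : 0 <= s by rewrite mulr_ge0 ?sqr_ge0// ltW.
have u0 := powR_ge0 D (- lam); set v := D * D `^ (- lam) in Du2 s1.
have v0 : 0 <= v by rewrite mulr_ge0// ltW.
have v1 : v <= 1 by rewrite -(@ler_pXn2r _ 2)// ?nnegrE// expr1n (le_trans Du2).
have TqE : T `^ q = T `^ (q - 2) * T ^+ 2 by rewrite powR_succ2.
have [q2|q2] := leP 2 q.
  apply: (le_trans (i1 q2)); rewrite lee_fin.
  have h1 : A `^ (q - 2) * s ^+ 2 <= 4 * K ^+ 2 * D * T `^ q.
    rewrite TqE (_ : 4 * _ * _ * _ = T `^ (q - 2) * (4 * K ^+ 2 * D * T ^+ 2)); last ring.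
    rewrite ler_pM ?powR_ge0 ?sqr_ge0//.
    by rewrite ge0_ler_powR ?nnegrE ?subr_ge0 ?(ltW A0) ?(ltW T0).
  have h2 : s `^ q <= k2 * D * T `^ q.
    have kv0 : 0 <= 2 * K * v by rewrite mulr_ge0// mulr_ge0.
    have := powR_le_scale q0 s0 (ltW T0) kv0 s1.
    rewrite (powRM _ (mulr_ge0 _ K0) v0)// => /le_trans; apply; rewrite ler_wpM2r// ler_wpM2l//.
    have [->|vn0] := eqVneq v 0; first by rewrite powR0 ?ltW// gt_eqF// (lt_le_trans ltr01 q1).
    apply: (le_trans _ Du2); rewrite -(powR_mulrn 2)//; apply: ger_powR => //.
    by rewrite lt0r vn0 v0 v1.
  apply: (@le_trans _ _ (K' * (4 * K ^+ 2 * D * T `^ q + k2 * D * T `^ q))).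
    by rewrite ler_wpM2l// lerD.
  have -> : K' * (4 * K ^+ 2 * D * T `^ q + k2 * D * T `^ q) =
     D * (K' * (4 * K ^+ 2 + k2) * T `^ q) by ring.
  rewrite ler_wpM2l ?(ltW Dpos)//; apply: (@le_trans _ _ (C * T `^ q)).
    by rewrite ler_wpM2r// /C -addrA lerDl addr_ge0// ltW.
  by rewrite lerDl mulr_ge0// ltW.
have {i1}q2' := ltW q2.
have hG2 : mnorm G ^+ 2 <= (2 * q - 1) * mnorm G ^+ 2.
  by rewrite -[leLHS]mul1r ler_wpM2r ?sqr_ge0//; lra.
have cs := vdot_cauchy_schwarz x y.
set z := vdot x y in hd cs.
(* In the first case [s^q] is split: one factor [s] is bounded through (A2) and is linear in [D],
   while [s^(q-1)] is bounded by growth and is small. *)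
have [zTM|zTM] := leP `|z| (T + M).
  apply: (le_trans (i3 q2')); rewrite lee_fin.
  have hGC : mnorm G ^+ 2 <= C1 * (T + M).
    have : - z <= T + M by apply: le_trans zTM; rewrite -normrN ler_norm.
    have := mulr_ge0 a10 M0; have := mulr_ge0 a30 (ltW T0).
    by rewrite /C1 !mulrDl !mulrDr; lra.
  have sle : s <= D * (C1 * (T + M)) by rewrite ler_wpM2l// ltW.
  have sq1 : s `^ (q - 1) <= k1 * e1 * T `^ (q - 1).
    have q0' : 0 <= q - 1 by rewrite subr_ge0.
    have kv0 : 0 <= 2 * K * v by rewrite mulr_ge0// mulr_ge0.
    have := powR_le_scale q0' s0 (ltW T0) kv0 s1.
    rewrite (powRM _ (mulr_ge0 _ K0) v0)// => /le_trans; apply; rewrite ler_wpM2r ?powR_ge0// ler_wpM2l//.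
    apply: le_trans (hD0 D _); last by rewrite ltW.
    have -> : v `^ (q - 1) = (v ^+ 2) `^ ((q - 1) / 2).
      by rewrite -powR_mulrn// -powRrM; congr (_ `^ _); field.
    by rewrite ge0_ler_powR// ?nnegrE ?sqr_ge0 ?(ltW Dpos)// divr_ge0 ?subr_ge0.
  have hsq : s `^ q <= k1 * e1 * T `^ (q - 1) * (D * (C1 * (T + M))).
    have [->|sn0] := eqVneq s 0.
      rewrite powR0; last by rewrite gt_eqF// (lt_le_trans ltr01 q1).
      apply: mulr_ge0; last by apply: mulr_ge0; [exact: ltW|apply: mulr_ge0; [exact: C10|rewrite addr_ge0// ltW]].
      by apply: mulr_ge0; [apply: mulr_ge0; [exact: k10|exact: ltW]|exact: powR_ge0].
    have sp : 0 < s by rewrite lt0r sn0.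
    have -> : s `^ q = s `^ (q - 1) * s by rewrite powR_succ// subrK.
    by apply: ler_pM => //; exact: powR_ge0.
  apply: (le_trans (ler_wpM2l K'0 hsq)).
  have TT : T `^ (q - 1) * T = T `^ q by rewrite powR_succ// subrK.
  have -> : K' * (k1 * e1 * T `^ (q - 1) * (D * (C1 * (T + M)))) =
    D * ((K' * k1 * C1 * e1) * (T `^ (q - 1) * T + T `^ (q - 1) * M)) by ring.
  rewrite TT ler_wpM2l ?(ltW Dpos)//.
  have ee : K' * k1 * C1 * e1 <= e.
    by rewrite /e1 mulrCA ger_pMr// ler_pdivrMr// mul1r lerDl.
  apply: (@le_trans _ _ (e * (T `^ q + T `^ (q - 1) * M))).
    by rewrite ler_wpM2r// addr_ge0.
  by rewrite mulrDr lerD2r ler_wpM2r// /C addrAC lerDr addr_ge0.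
(* Now [|G|^4] is bounded by [z^2], and Cauchy-Schwarz yields a factor [A]; it turns the dangerous
   [A^(q-2)] into [A^(q-1) <= T^(q-1)]. *)
apply: (le_trans (i2 q2')); rewrite lee_fin.
have hGC : mnorm G ^+ 2 <= C1 * `|z|.
  have nz : - z <= `|z| by rewrite -normrN ler_norm.
  have t1 : a1 * T <= a1 * `|z| by rewrite ler_wpM2l//; lra.
  have t3 : a3 * M <= a3 * `|z| by rewrite ler_wpM2l//; lra.
  by rewrite /C1 !mulrDl; lra.
have hG4 : (mnorm G ^+ 2) ^+ 2 <= C1 ^+ 2 * (A * (2 * (K * D `^ (- lam)) ^+ 2 * T)).
  apply: (@le_trans _ _ ((C1 * `|z|) ^+ 2)).
    by rewrite ler_pXn2r// nnegrE ?sqr_ge0// mulr_ge0.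
  rewrite exprMn ler_wpM2l ?sqr_ge0// sqr_normr (le_trans cs)//.
  by rewrite ler_pM ?sqr_ge0// /A lerDr.
have s4 : s ^+ 2 <= C1 ^+ 2 * 2 * K ^+ 2 * D * (A * T).
  rewrite exprMn; apply: (le_trans (ler_wpM2l (sqr_ge0 D) hG4)).
  have -> : D ^+ 2 * (C1 ^+ 2 * (A * (2 * (K * D `^ (- lam)) ^+ 2 * T))) =
     C1 ^+ 2 * 2 * K ^+ 2 * v ^+ 2 * (A * T) by rewrite /v; ring.
  rewrite ler_wpM2r ?mulr_ge0 ?(ltW A0) ?(ltW T0)// ler_wpM2l//.
  by rewrite !mulr_ge0 ?sqr_ge0.
have hA : A `^ (q - 2) * s ^+ 2 <= C1 ^+ 2 * 2 * K ^+ 2 * D * T `^ q.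
  apply: (le_trans (ler_wpM2l (powR_ge0 _ _) s4)).
  have -> : A `^ (q - 2) * (C1 ^+ 2 * 2 * K ^+ 2 * D * (A * T)) =
    C1 ^+ 2 * 2 * K ^+ 2 * D * (A `^ (q - 2) * A * T) by ring.
  rewrite ler_wpM2l; first by [].
    by rewrite !mulr_ge0 ?sqr_ge0 ?(ltW Dpos).
  rewrite powR_succ// (_ : q - 2 + 1 = q - 1); last ring.
  rewrite -[leRHS](_ : T `^ (q - 1) * T = _); last by rewrite powR_succ// subrK.
  by rewrite ler_wpM2r ?(ltW T0)// ge0_ler_powR ?nnegrE ?subr_ge0 ?(ltW A0) ?(ltW T0).
apply: (le_trans (ler_wpM2l K'0 hA)).
have -> : K' * (C1 ^+ 2 * 2 * K ^+ 2 * D * T `^ q) =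
  D * (K' * (2 * K ^+ 2 * C1 ^+ 2) * T `^ q) by ring.
rewrite ler_wpM2l ?(ltW Dpos)//.
apply: (@le_trans _ _ (C * T `^ q)); first by rewrite ler_wpM2r// /C lerDr addr_ge0// ltW.
by rewrite lerDl mulr_ge0// ltW.
Qed.

Lemma integral_step_drift e : 0 < e ->
  exists C D0, [/\ 0 <= C, 0 < D0 & forall n D T M b (x y : 'cV[R]_n) (G : 'M[R]_(n, d)) m A,
    0 < D <= 1 -> D <= D0 -> A = 1 + vnorm x ^+ 2 -> step_bounds D T M b x y G ->
    (\int[P]_w ((1 + vnorm (x + D *: y + G *m bm_inc B D m w) ^+ 2) `^ q)%:E <=
     (A `^ q + D * (q * A `^ (q - 1) * (a1 * T - b + a3 * M) +
        C * T `^ q + e * (T `^ (q - 1) * M)))%:E)%E].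
Proof.
have q1' : 1 <= q by [].
have q0 : 0 <= q by exact: le_trans ler01 q1.
move=> e0; have [C [C0 Cq1 hC]] := integral_step hB q1.
have [C2 [C20 hC2]] := @taylor_rem_drift R q q1.
have [C3 [D0 [C30 D00 hI]]] : exists C3 D0, [/\ 0 <= C3, 0 < D0 &
    forall n D T M b (x y : 'cV[R]_n) (G : 'M[R]_(n, d)) m,
    0 < D <= 1 -> D <= D0 -> step_bounds D T M b x y G ->
    (C%:E * \int[P]_w (taylor_rem q (1 + vnorm x ^+ 2) (vnorm (G *m bm_inc B D m w) ^+ 2))%:E <=
     (D * (C3 * T `^ q + e * (T `^ (q - 1) * M)))%:E)%E].
  (* The noise estimate requires [q > 1]; at [q = 1] its coefficient [C] is 0. *)
  have [q_eq1|q_neq1] := eqVneq q 1.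
    exists 0, 1; split => // n D T M b x y G m /andP[D0 _] _ [_ [M0 _] _ _ _].
    rewrite (Cq1 q_eq1) mul0e lee_fin mul0r add0r.
    by rewrite !mulr_ge0 ?powR_ge0 ?(ltW D0) ?(ltW e0).
  have q_gt1 : 1 < q by rewrite lt_neqAle eq_sym q_neq1.
  have e10 : 0 < e / (C + 1) by rewrite divr_gt0//; lra.
  have [C4 [D0 [C40 D00 hI]]] := integral_noise_rem_le q_gt1 e10.
  exists (C * C4), D0; split => //; first exact: mulr_ge0.
  move=> n D T M b x y G m D01 DD0 hs; have := hI n D T M b x y G m D01 DD0 hs.
  have [_ [M0 _] _ _ _] := hs; have /andP[Dp _] := D01.
  rewrite -(@lee_fin R) in C0.
  move=> /(lee_wpmul2l C0)/le_trans; apply; rewrite -EFinM lee_fin.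
  rewrite mulrCA ler_wpM2l ?(ltW Dp)// mulrDr mulrA lerD2l mulrA ler_wpM2r ?mulr_ge0 ?powR_ge0//.
  rewrite lee_fin in C0; rewrite mulrCA ger_pMr// ler_pdivrMr; lra.
pose k1 := 2 * K ^+ 2; have k10 : 0 <= k1 by rewrite mulr_ge0 ?sqr_ge0.
(* The first summand pays for the squared drift inside [c], the second for the drift remainder. *)
pose k2 := q * k1 + C * (C2 * (k1 + k1 `^ q)).
exists (k2 + C3), D0; split => //.
  by rewrite addr_ge0// addr_ge0 ?mulr_ge0 ?addr_ge0 ?powR_ge0//; lra.
move=> n D T M b x y G m A D01 DD0 AE hs.
pose c := vnorm (x + D *: y) ^+ 2 - vnorm x ^+ 2.
have /andP[Dp D1] := D01.
have := hC D n x (D *: y) G m A c Dp AE erefl; move/le_trans; apply.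
have := hI n D T M b x y G m D01 DD0 hs; rewrite -AE.
move=> /(leeD2l _)/le_trans; apply; rewrite -EFinD lee_fin.
have [AT [M0 b0] hy hG hd] := hs.
have A1 : 1 <= A by rewrite AE lerDl sqr_ge0.
have A0 : 0 < A by lra.
rewrite -AE in AT; have T0 : 0 < T by lra.
have hu := step_powRN_sq D01 lam01.
have hy2 : D * vnorm y ^+ 2 <= k1 * T.
  apply: (le_trans (ler_wpM2l (ltW Dp) hy)).
  have -> : D * (2 * (K * D `^ (- lam)) ^+ 2 * T) = k1 * (D * (D `^ (- lam)) ^+ 2) * T.
    by rewrite /k1; ring.
  by rewrite ler_wpM2r ?(ltW T0)// -[leRHS]mulr1 ler_wpM2l.
pose a := D ^+ 2 * vnorm y ^+ 2; have a0 : 0 <= a by rewrite mulr_ge0 ?sqr_ge0.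
have aT : a <= (k1 * D) * T.
  by rewrite /a expr2 -mulrA (_ : k1 * D * T = D * (k1 * T)) ?ler_wpM2l ?(ltW Dp)//; ring.
have cE : c = 2 * (D * vdot x y) + a.
  by rewrite /c vnormD_sq vdotZr vnormZ_sq -/a; ring.
have cs := vdot_cauchy_schwarz x y.
have ca : (c - a) ^+ 2 <= 4 * A * a.
  rewrite cE addrK (_ : _ ^+ 2 = 4 * D ^+ 2 * vdot x y ^+ 2); last ring.
  apply: (@le_trans _ _ (4 * D ^+ 2 * (vnorm x ^+ 2 * vnorm y ^+ 2))).
    by rewrite ler_wpM2l// mulr_ge0 ?sqr_ge0.
  have -> : 4 * D ^+ 2 * (vnorm x ^+ 2 * vnorm y ^+ 2) = 4 * vnorm x ^+ 2 * a by rewrite /a; ring.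
  by rewrite ler_wpM2r// ler_wpM2l// AE lerDr.
have hrem := hC2 A c a A0 a0 ca.
have Aq : A `^ (q - 1) <= T `^ (q - 1) by rewrite ge0_ler_powR ?nnegrE ?subr_ge0 ?(ltW A0) ?(ltW T0).
have TT : T `^ (q - 1) * T = T `^ q by rewrite powR_succ// subrK.
have Aa : A `^ (q - 1) * a <= k1 * D * T `^ q.
  apply: (@le_trans _ _ (T `^ (q - 1) * (k1 * D * T))); first by rewrite ler_pM ?powR_ge0.
  by rewrite -TT le_eqVlt; apply/orP; left; apply/eqP; ring.
have aq : a `^ q <= k1 `^ q * D * T `^ q.
  have kD0 : 0 <= k1 * D by rewrite mulr_ge0// ltW.
  have := powR_le_scale q0 a0 (ltW T0) kD0 aT.
  rewrite powRM ?(ltW Dp)// => /le_trans; apply; rewrite ler_wpM2r ?powR_ge0// ler_wpM2l ?powR_ge0//.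
  rewrite -[leRHS]powRr1 ?(ltW Dp)//; apply: ger_powR => //; by rewrite Dp.
have hr2 : taylor_rem q A c <= C2 * (k1 + k1 `^ q) * D * T `^ q.
  apply: (le_trans hrem); rewrite -2!mulrA ler_wpM2l//.
  rewrite [leRHS](_ : _ = k1 * D * T `^ q + k1 `^ q * D * T `^ q); first exact: lerD.
  by move: (T `^ q) (k1 `^ q) => *; ring.
have hdr : A `^ (q - 1) * (c + (2 * q - 1) * (D * mnorm G ^+ 2)) <=
   A `^ (q - 1) * (D * (a1 * T - b + a3 * M)) + k1 * D * T `^ q.
  have -> : c + (2 * q - 1) * (D * mnorm G ^+ 2) =
    D * (2 * vdot x y + (2 * q - 1) * mnorm G ^+ 2) + a by rewrite cE; ring.
  by rewrite mulrDr lerD// ler_wpM2l ?powR_ge0// ler_wpM2l// ltW.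
have := ler_wpM2l C0 hr2; have := ler_wpM2l q0 hdr.
rewrite /k2 !mulrDl !mulrDr.
move: (A `^ (q - 1)) (T `^ q) (T `^ (q - 1)) (taylor_rem q A c) (k1 `^ q) (A `^ q) => u1 u2 u3 u4 u5 u6.
move=> h1 h2; nra.
Qed.

End OneStep.

Section Young.
Context {R : realType}.

(** Bernoulli at [(v / u)^t] with exponent [(s + t) / t]. The sharp weights sum to 1, so the [a_3]
    term is shared between present and delayed moments without loss. *)
Lemma young_powR (s t u v : R) : 0 <= s -> 0 < t -> 0 < u -> 0 < v ->
  u `^ s * v `^ t <= s / (s + t) * u `^ (s + t) + t / (s + t) * v `^ (s + t).
Proof.
move=> s0 t0 u0 v0; have st0 : 0 < s + t by rewrite ltr_wpDl.
have x0 : 0 < (v / u) `^ t by rewrite powR_gt0// divr_gt0.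
have r1 : 1 <= (s + t) / t by rewrite ler_pdivlMr// mul1r lerDr.
have := powR_tangent x0 r1; rewrite -powRrM mulrCA divff ?gt_eqF// mulr1.
rewrite !powRM ?invr_ge0 ?(ltW u0) ?(ltW v0)// => h.
have e w : u^-1 `^ w = (u `^ w)^-1 by rewrite -powR_inv1 ?(ltW u0)// -powRrM mulN1r powRN.
move: h; rewrite !e [u `^ (s + t)]powRD; last by rewrite gt_eqF// implybT.
have us0 : 0 < u `^ s by exact: powR_gt0.
have ut0 : 0 < u `^ t by exact: powR_gt0.
move: (u `^ s) (u `^ t) us0 ut0 (v `^ t) (v `^ (s + t)) => a b a0 b0 c w h.
have : (1 + (s + t) / t * (c / b - 1)) * (a * b) <= w.
  by rewrite -ler_pdivlMr// mulr_gt0.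
have -> : (1 + (s + t) / t * (c / b - 1)) * (a * b) = (s + t) / t * (a * c) - s / t * (a * b).
  by field; rewrite !gt_eqF.
move=> h2; have : t / (s + t) * ((s + t) / t * (a * c)) <= t / (s + t) * (w + s / t * (a * b)).
  by rewrite ler_wpM2l ?divr_ge0 ?(ltW t0) ?(ltW st0)//; rewrite -lerBlDr.
have -> : t / (s + t) * ((s + t) / t * (a * c)) = a * c by field; rewrite !gt_eqF.
have -> // : t / (s + t) * (w + s / t * (a * b)) = s / (s + t) * (a * b) + t / (s + t) * w.
by field; rewrite !gt_eqF.
Qed.

Lemma young_powR_le (s t u v : R) : 0 <= s -> 0 < t -> 0 < u -> 0 < v ->
  u `^ s * v `^ t <= u `^ (s + t) + v `^ (s + t).
Proof.
move=> s0 t0 u0 v0; apply: (le_trans (young_powR s0 t0 u0 v0)).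
have st0 : 0 < s + t by rewrite ltr_wpDl.
by rewrite lerD// ger_pMl ?powR_gt0// ler_pdivrMr// mul1r ?lerDl ?lerDr// ltW.
Qed.

(** Above the threshold [b] one has [u^(t - s) >= e^-1]; below it [u^s] is bounded, the maximum with
    0 covering a negative [s]. *)
Lemma powR_absorb (s t e : R) : s < t -> 0 < e ->
  exists2 C, 0 <= C & forall u, 1 <= u -> u `^ s <= e * u `^ t + C.
Proof.
move=> st e0; have ts : 0 < t - s by rewrite subr_gt0.
pose b := e^-1 `^ (t - s)^-1; exists (Num.max 1 b `^ Num.max s 0); first exact: powR_ge0.
move=> u u1; have u0 : 0 < u by exact: lt_le_trans u1.
have [ub|ub] := leP u b.
  apply: (@le_trans _ _ (u `^ Num.max s 0)).
    by apply: ler_powR => //; rewrite le_max lexx.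
  apply: (@le_trans _ _ (Num.max 1 b `^ Num.max s 0)); last by rewrite lerDr mulr_ge0 ?powR_ge0// ltW.
  by rewrite ge0_ler_powR ?nnegrE ?le_max ?lexx ?ub ?ler01 ?(ltW u0) ?orbT.
have h : e^-1 <= u `^ (t - s).
  have -> : e^-1 = b `^ (t - s) by rewrite /b -powRrM mulVf ?powRr1 ?invr_ge0 ?(ltW e0)// gt_eqF.
  by rewrite ge0_ler_powR ?nnegrE ?powR_ge0 ?(ltW u0) ?(ltW ub) ?(ltW ts).
have -> : u `^ t = u `^ (t - s) * u `^ s by rewrite -powRD ?subrK// (gt_eqF u0) implybT.
rewrite mulrA; apply: (@le_trans _ _ (e * u `^ (t - s) * u `^ s)); last by rewrite lerDl powR_ge0.
rewrite -[leLHS]mul1r ler_wpM2r ?powR_ge0//.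
by rewrite -(mulfV (lt0r_neq0 e0)) ler_wpM2l// ltW.
Qed.

Lemma powR_mass_le m (w y : 'I_m -> R) (u s : R) : 1 <= s -> 0 <= u ->
  (forall i, 0 <= w i) -> (forall i, 0 <= y i) -> \sum_i w i = 1 ->
  (u + \sum_i w i * y i) `^ s <= 2 `^ s * (u `^ s + \sum_i w i * y i `^ s).
Proof.
move=> s1 u0 w0 y0 w1; set v := \sum_i _.
have v0 : 0 <= v by apply: sumr_ge0 => i _; exact: mulr_ge0.
have s0 : 0 <= s by apply: le_trans s1.
have hm : (u + v) `^ s <= 2 `^ s * (u `^ s + v `^ s).
  have hmax a b : 0 <= b -> b <= a -> (a + b) `^ s <= 2 `^ s * (a `^ s + b `^ s).
    move=> b0 ba; have a0 := le_trans b0 ba.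
    apply: (@le_trans _ _ ((2 * a) `^ s)).
      by rewrite ge0_ler_powR ?nnegrE ?addr_ge0 ?mulr_ge0//; lra.
    by rewrite powRM// ler_wpM2l ?powR_ge0// lerDl powR_ge0.
  have [h|h] := leP u v; last by apply: hmax => //; exact: ltW.
  by rewrite addrC [u `^ s + _]addrC hmax.
apply: (le_trans hm); rewrite ler_wpM2l ?powR_ge0// lerD2l.
exact: jensen_powR.
Qed.

End Young.

(** * From dissipativity to a delayed recursion *)

Section DriftAlgebra.
Context {R : realType}.
Variables (q r a1 a2 a3 : R).
Hypotheses (q1 : 1 <= q) (r1 : 1 < r) (a10 : 0 <= a1) (a30 : 0 <= a3) (a23 : a3 < a2).
Local Notation s := (q - 1 + r).

(** The order of quantifiers is forced: [C] is produced by the one-step estimate for the given [e],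
    so it may only influence the additive constant [C'], not the gap between [b2] and [b3 + b4]. *)
Lemma drift_algebra : exists e b2 b3 b4, [/\ 0 < e, 0 <= b3, 0 <= b4, b3 + b4 < b2 &
  forall C, 0 <= C -> exists2 C', 0 <= C' &
  forall m (w0 w1 y : 'I_m -> R) (A T M b : R), 1 <= A -> (forall i, 1 <= y i) ->
    (forall i, 0 <= w0 i) -> (forall i, 0 <= w1 i) -> \sum_i w0 i = 1 -> \sum_i w1 i = 1 ->
    T = A + \sum_i w0 i * y i -> M <= \sum_i w1 i * y i `^ r -> b = a2 * (A - 1) `^ r ->
    q * A `^ (q - 1) * (a1 * T - b + a3 * M) + C * T `^ q + e * (T `^ (q - 1) * M) <=
    - b2 * A `^ s + \sum_i (b3 * w1 i + b4 * w0 i) * y i `^ s + C'].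
Proof.
have [q1' r1' a10' a30' a23'] : [/\ 1 <= q, 1 < r, 0 <= a1, 0 <= a3 & a3 < a2] by [].
have q0 : 0 < q by exact: lt_le_trans q1.
have q10 : 0 <= q - 1 by rewrite subr_ge0.
have r0 : 0 < r by exact: lt_trans r1.
have s1 : 1 <= s by lra.
have s0 : 0 < s by lra.
pose dl := q * (a2 - a3); have dl0 : 0 < dl by rewrite mulr_gt0 ?subr_gt0.
pose two := 2 `^ s : R; have two0 : 0 < two by exact: powR_gt0.
(* The corrections to [b2 - b3 - b4] add up to [e (4 two + 2)], at most half of the available gap
   [dl]. *)
pose e := dl / (8 * (two + 1)).
have e0 : 0 < e by rewrite divr_gt0// mulr_gt0// addr_gt0.
pose th := (q - 1) / s; pose th' := r / s.
have thE : th + th' = 1 by rewrite /th /th' -mulrDl divff// gt_eqF.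
have th0 : 0 <= th by rewrite divr_ge0// ltW.
have th'0 : 0 <= th' by rewrite divr_ge0// ltW.
pose b3 := q * a3 * th' + e; pose b4 := 2 * e * two.
pose b2 := q * a2 - q * a3 * th - 2 * e * two - e.
have e8 : 8 * (e * two + e) = dl.
  by rewrite /e; field; rewrite gt_eqF// addr_gt0.
exists e, b2, b3, b4; split => //.
- by apply: addr_ge0; [apply: mulr_ge0; [apply: mulr_ge0; [exact: ltW|]|]|exact: ltW].
- by apply: mulr_ge0; [apply: mulr_ge0|]; rewrite ?ler0n//; exact: ltW.
- have : q * a3 * th' + q * a3 * th = q * a3 by rewrite -mulrDr addrC thE mulr1.
  have := mulr_gt0 e0 two0; rewrite /b2 /b3 /b4; move: e8; rewrite /dl => *; nra.
move=> C C0.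
(* the two lower order terms [T^q] and [A^(s-1)] are absorbed into [T^s] *)
pose k1 := q * a1 + C; have k10 : 0 <= k1 by rewrite addr_ge0// mulr_ge0// ltW.
pose k2 := q * a2 * r; have k20 : 0 <= k2 by rewrite !mulr_ge0 ?(ltW q0) ?(ltW r0)//; lra.
have e1 : 0 < e / (k1 + 1) by rewrite divr_gt0//; lra.
have e2 : 0 < e / (k2 + 1) by rewrite divr_gt0//; lra.
have [C1 C10 hC1] := @powR_absorb R q s _ (ltac:(lra)) e1.
have [C2 C20 hC2] := @powR_absorb R (s - 1) s _ (ltac:(lra)) e2.
exists (k1 * C1 + k2 * C2); first by rewrite addr_ge0// mulr_ge0.
move=> m w0 w1 y A T M b A1 y1 w00 w10 sw0 sw1 TE Mle bE.
have A0 : 0 < A by exact: lt_le_trans A1.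
have y0 i : 0 < y i by exact: lt_le_trans (y1 i).
have sy0 : 0 <= \sum_i w0 i * y i by apply: sumr_ge0 => i _; rewrite mulr_ge0// ltW.
have AT : A <= T by rewrite TE lerDl.
have T1 : 1 <= T by exact: le_trans AT.
have T0 : 0 < T by exact: lt_le_trans T1.
set Y1 := \sum_i w1 i * y i `^ s; set Y0 := \sum_i w0 i * y i `^ s.
have hT : T `^ s <= two * (A `^ s + Y0).
  by rewrite TE; apply: powR_mass_le => // [|i]; exact: ltW.
have hM1 : A `^ (q - 1) * M <= th * A `^ s + th' * Y1.
  apply: (@le_trans _ _ (A `^ (q - 1) * \sum_i w1 i * y i `^ r)); first by rewrite ler_wpM2l ?powR_ge0.
  have -> : th * A `^ s + th' * Y1 = \sum_i w1 i * (th * A `^ s + th' * y i `^ s).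
    rewrite /Y1 mulr_sumr -[th * _]mul1r -{1}sw1 mulr_suml -big_split/=.
    by apply: eq_bigr => i _; ring.
  rewrite mulr_sumr; apply: ler_sum => i _; rewrite mulrCA ler_wpM2l//.
  exact: young_powR.
have hM2 : T `^ (q - 1) * M <= T `^ s + Y1.
  apply: (@le_trans _ _ (T `^ (q - 1) * \sum_i w1 i * y i `^ r)); first by rewrite ler_wpM2l ?powR_ge0.
  have -> : T `^ s + Y1 = \sum_i w1 i * (T `^ s + y i `^ s).
    rewrite /Y1 -[T `^ s]mul1r -{1}sw1 mulr_suml -big_split/=.
    by apply: eq_bigr => i _; ring.
  rewrite mulr_sumr; apply: ler_sum => i _; rewrite mulrCA ler_wpM2l//.
  exact: young_powR_le.
(* (A2) damps powers of [|x|^2 = A - 1]; the tangent at [A] passes to powers of [A] at the cost of a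
   lower order term. *)
have hb : A `^ s - r * A `^ (s - 1) <= A `^ (q - 1) * (A - 1) `^ r.
  have := powR_tangent_at (ltW r1) A0 (_ : 0 <= A - 1); rewrite subr_ge0 => /(_ A1).
  rewrite (_ : A - 1 - A = - 1); last ring.
  move=> /(ler_wpM2l (powR_ge0 A (q - 1))); apply: le_trans.
  rewrite (_ : A `^ s = A `^ (q - 1) * A `^ r); last by rewrite -powRD// gt_eqF// implybT.
  rewrite (_ : s - 1 = q - 1 + (r - 1)); last ring.
  rewrite [A `^ (q - 1 + (r - 1))]powRD; last by rewrite (gt_eqF A0) implybT.
  by rewrite le_eqVlt; apply/orP; left; apply/eqP; ring.
have hTq : A `^ (q - 1) * T <= T `^ q.
  rewrite -[leRHS](_ : T `^ (q - 1) * T = _); last by rewrite powR_succ// subrK.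
  by rewrite ler_wpM2r ?(ltW T0)// ge0_ler_powR ?nnegrE ?(ltW A0) ?(ltW T0).
have hk1 : k1 * T `^ q <= e * T `^ s + k1 * C1.
  apply: (le_trans (ler_wpM2l k10 (hC1 T T1))).
  rewrite mulrDr lerD2r mulrA ler_wpM2r ?powR_ge0//.
  by rewrite mulrCA ger_pMr// ler_pdivrMr ?mul1r ?lerDl// ltr_wpDl.
have hk2 : k2 * A `^ (s - 1) <= e * A `^ s + k2 * C2.
  apply: (le_trans (ler_wpM2l k20 (hC2 A A1))).
  rewrite mulrDr lerD2r mulrA ler_wpM2r ?powR_ge0//.
  by rewrite mulrCA ger_pMr// ler_pdivrMr ?mul1r ?lerDl// ltr_wpDl.
have -> : \sum_i (b3 * w1 i + b4 * w0 i) * y i `^ s = b3 * Y1 + b4 * Y0.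
  by rewrite /Y1 /Y0 !mulr_sumr -big_split/=; apply: eq_bigr => i _; ring.
have i1 : q * a1 * (A `^ (q - 1) * T) <= q * a1 * T `^ q.
  by rewrite ler_wpM2l// mulr_ge0// ltW.
have i2 : q * a2 * (A `^ s - r * A `^ (s - 1)) <= q * a2 * (A `^ (q - 1) * (A - 1) `^ r).
  by rewrite ler_wpM2l// mulr_ge0 ?(ltW q0)//; lra.
have i3 : q * a3 * (A `^ (q - 1) * M) <= q * a3 * (th * A `^ s + th' * Y1).
  by rewrite ler_wpM2l// mulr_ge0// ltW.
have i4 : e * (T `^ (q - 1) * M) <= e * (T `^ s + Y1) by rewrite ler_wpM2l// ltW.
have i5 : 2 * e * T `^ s <= 2 * e * (two * (A `^ s + Y0)).
  by rewrite ler_wpM2l// mulr_ge0// ltW.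
rewrite bE /b2 /b3 /b4.
have -> : q * A `^ (q - 1) * (a1 * T - a2 * (A - 1) `^ r + a3 * M) =
  q * a1 * (A `^ (q - 1) * T) - q * a2 * (A `^ (q - 1) * (A - 1) `^ r) + q * a3 * (A `^ (q - 1) * M) by ring.
move: hk1 hk2 i1 i2 i3 i4 i5; rewrite /k1 /k2.
clear; clearbody th th' Y1 Y0 two e.
move: (A `^ (q - 1) * T) (A `^ (q - 1) * (A - 1) `^ r) (A `^ (q - 1) * M) (T `^ (q - 1) * M) (T `^ q) (T `^ s) (A `^ s) (A `^ (s - 1)).
move=> z1 z2 z3 z4 z5 z6 z7 z8 h1 h2 h3 h4 h5 h6 h7.
lra.
Qed.

End DriftAlgebra.

(** * Discrete delay Gronwall inequality *)

Section Gronwall.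
Context {R : realType}.

Lemma expR_le1D2x (x : R) : 0 <= x <= 1 / 2 -> expR x <= 1 + 2 * x.
Proof.
move=> /andP[x0 x1]; have := expR_ge1Dx (- x); rewrite expRN => h.
have e0 := expR_gt0 x; rewrite -[leLHS]mul1r -ler_pdivlMr//.
have : 1 <= (1 + 2 * x) * (1 - x) by nra.
by move/le_trans; apply; rewrite ler_wpM2l//; lra.
Qed.

(* weights making [e m + D * \sum_(l < N) c_l * mu (m + l)] a Lyapunov function *)
Fixpoint delay_weight (r : R) (W : nat -> R) (l : nat) : R :=
  r * (if l is l'.+1 then W l + delay_weight r W l' else W 0%N).

Lemma delay_weight_ge0 r W l : 0 <= r -> (forall i, 0 <= W i) -> 0 <= delay_weight r W l.
Proof.
move=> r0 W0; elim: l => [|l IH] /=; first by rewrite mulr_ge0.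
by rewrite mulr_ge0// addr_ge0.
Qed.

Lemma delay_weight_le r W l : 1 <= r -> (forall i, 0 <= W i) ->
  delay_weight r W l <= r ^+ l.+1 * \sum_(i < l.+1) W i.
Proof.
move=> r1 W0; have r0 : 0 <= r by exact: le_trans r1.
elim: l => [|l IH] /=; first by rewrite big_ord1 expr1.
rewrite exprS -mulrA ler_wpM2l// big_ord_recr/= mulrDr addrC lerD//.
by rewrite -[leLHS]mul1r ler_wpM2r// exprn_ege1.
Qed.

(** The recursion for the weights is designed for this shift: the current delay sum and the shifted
    functional recombine into the old functional, and only the newest node is left over. *)
Lemma sum_delay_weight r (W mu : nat -> R) (m N : nat) :
  r * (\sum_(i < N.+1) W i * mu (m + i)%N + \sum_(l < N) delay_weight r W l * mu (m.+1 + l)%N) =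
  \sum_(l < N) delay_weight r W l * mu (m + l)%N + delay_weight r W N * mu (m + N)%N.
Proof.
transitivity (\sum_(l < N.+1) delay_weight r W l * mu (m + l)%N); last by rewrite big_ord_recr.
rewrite !big_ord_recl/= -addrA -big_split/= mulrDr mulrA; congr (_ + _).
rewrite mulr_sumr; apply: eq_bigr => i _.
by rewrite /bump/= add1n addSn addnS; ring.
Qed.

(** The excess [b2 - b] pays for two things: the growth of the weights over one delay, and a
    contraction of [e m] itself, possible because [e m <= mu (N + m)]. *)
Lemma delay_gronwall (tau b b2 c0 C : R) : 0 < tau -> 0 <= b -> b < b2 -> 0 <= c0 -> 0 <= C ->
  exists L, forall (N : nat) (D : R) (W mu e : nat -> R),
    0 < D <= 1 -> N%:R * D = tau -> (forall i, 0 <= W i) -> \sum_(i < N.+1) W i <= b ->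
    (forall i, 0 <= mu i) -> (forall i, (i <= N)%N -> mu i <= c0) ->
    (forall m, e m <= mu (N + m)%N) ->
    (forall m, e m.+1 <= e m + D * (- b2 * mu (N + m)%N + \sum_(i < N.+1) W i * mu (m + i)%N + C)) ->
    forall m, e m <= L.
Proof.
move=> tau0 b0 bb2 c00 C0.
(* [1 + 2 eta tau] bounds [exp (eta tau)], hence [(1 + eta D)^N] for all [N] with [N D = tau]; this
   makes the estimate uniform in the step size. *)
have [eta [eta0 etat etab]] : exists eta : R,
    [/\ 0 < eta, eta * tau <= 1 / 2 & b * (1 + 2 * (eta * tau)) + eta <= b2].
  have d0 : 0 < 2 * tau * b + 1 by rewrite ltr_wpDl// !mulr_ge0// ltW.
  pose x := (2 * tau)^-1; pose y := (b2 - b) / (2 * tau * b + 1).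
  have x0 : 0 < x by rewrite invr_gt0 mulr_gt0.
  have y0 : 0 < y by rewrite divr_gt0// subr_gt0.
  have hx : x * tau = 1 / 2 by rewrite /x; field; rewrite gt_eqF.
  have hy : y * (2 * tau * b + 1) = b2 - b by rewrite divfK// gt_eqF.
  exists (Num.min x y); split; first by rewrite lt_min x0 y0.
    by rewrite -hx ler_wpM2r ?(ltW tau0)// ge_min lexx.
  have h : Num.min x y * (2 * tau * b + 1) <= b2 - b.
    by rewrite -hy ler_wpM2r ?(ltW d0)// ge_min lexx orbT.
  by move: h; move: (Num.min x y) => z; rewrite mulrDr mulr1 => h; nra.
(* The first two terms bound the functional at time 0; the last dominates the fixed point
   [r C / eta] of [r Z = Z + r D C], as [r <= 1 + eta]. *)
exists (c0 + tau * b2 * c0 + (1 + eta) * C / eta) => N D W mu e /andP[D0 D1] ND W0 sW mu0 muc emu estep.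
pose r := 1 + eta * D.
have eD0 : 0 <= eta * D by rewrite mulr_ge0// ltW.
have r1 : 1 <= r by rewrite lerDl.
have r0 : 0 <= r by exact: le_trans r1.
have rN : r ^+ N * b + eta <= b2.
  apply: le_trans etab; rewrite lerD2r [leRHS]mulrC ler_wpM2r//.
  apply: (@le_trans _ _ (expR (eta * tau))).
    rewrite -ND mulrCA expRM_natl lerXn2r ?nnegrE ?expR_ge0//; exact: expR_ge1Dx.
  by apply: expR_le1D2x; rewrite etat mulr_ge0// ltW.
have c0' l : 0 <= delay_weight r W l by exact: delay_weight_ge0.
have sWl l : (l <= N)%N -> \sum_(i < l.+1) W i <= b.
  move=> lN; apply: le_trans sW; rewrite -(subnK lN) -addnS addnC big_split_ord/= lerDl.
  by apply: sumr_ge0.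
have cN : delay_weight r W N <= r * (r ^+ N * b).
  apply: (le_trans (delay_weight_le N r1 W0)); rewrite exprS -mulrA ler_wpM2l//.
  by rewrite ler_wpM2l ?exprn_ge0// sWl.
have cl l : (l < N)%N -> delay_weight r W l <= b2.
  move=> lN; apply: (le_trans (delay_weight_le l r1 W0)).
  apply: (@le_trans _ _ (r ^+ N * b)); last by apply: le_trans rN; rewrite lerDl ltW.
  rewrite ler_pM ?exprn_ge0 ?sumr_ge0//; first exact: ler_weXn2l.
  by apply: sWl; exact: ltnW.
pose Z m := e m + D * \sum_(l < N) delay_weight r W l * mu (m + l)%N.
have b20 : 0 <= b2 by apply: le_trans b0 (ltW bb2).
have CC : 0 <= (1 + eta) * C / eta by rewrite !mulr_ge0 ?addr_ge0 ?invr_ge0 ?(ltW eta0).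
have tb : 0 <= tau * b2 * c0 by rewrite !mulr_ge0// ltW.
suff ZL m : Z m <= c0 + tau * b2 * c0 + (1 + eta) * C / eta.
  move=> m; apply: le_trans (ZL m); rewrite /Z lerDl mulr_ge0 ?(ltW D0)//.
  by apply: sumr_ge0 => l _; rewrite mulr_ge0.
elim: m => [|m IH].
  rewrite /Z -addrA; apply: lerD; first by apply: (le_trans (emu 0%N)); rewrite addn0 muc.
  apply: (@le_trans _ _ (tau * b2 * c0)); last by rewrite lerDl.
  rewrite -ND [N%:R * D]mulrC -2!mulrA ler_wpM2l ?(ltW D0)//.
  apply: (@le_trans _ _ (\sum_(l < N) b2 * c0)); last first.
    by rewrite sumr_const card_ord mulr_natl.
  by apply: ler_sum => l _; rewrite ler_pM// ?cl// add0n muc// ltnW.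
have step : r * Z m.+1 <= Z m + r * D * C.
  have := ler_wpM2l r0 (estep m); rewrite /Z => h.
  have hs := sum_delay_weight r W mu m N; move: h hs.
  move: (\sum_(i < N.+1) W i * mu (m + i)%N) (\sum_(l < N) delay_weight r W l * mu (m.+1 + l)%N)
    (\sum_(l < N) delay_weight r W l * mu (m + l)%N) => s1 s2 s3 h hs.
  have -> : r * (e m.+1 + D * s2) = r * e m.+1 + D * (r * (s1 + s2)) - D * (r * s1) by ring.
  rewrite hs [(m + N)%N]addnC; have hm := emu m; have hmu := mu0 (N + m)%N.
  have h1 := ler_wpM2r hmu cN; have h2 := ler_wpM2l (ltW D0) h1.
  have h3 := ler_wpM2l eD0 hm.
  have h4 : (r ^+ N * b + eta) * (r * D * mu (N + m)%N) <= b2 * (r * D * mu (N + m)%N).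
    by rewrite ler_wpM2r// !mulr_ge0// ltW.
  have h5 : eta * D * mu (N + m)%N <= r * (eta * D * mu (N + m)%N).
    by rewrite -[leLHS]mul1r ler_wpM2r// mulr_ge0.
  have rE : r * e m = e m + eta * D * e m by rewrite /r; ring.
  move: h h2 h3 h4 h5 rE; clear.
  move: (mu _) (e m) (e m.+1) (r ^+ N) (delay_weight _ _ _) => u x y z c; clearbody r.
  rewrite !mulrDr !mulrDl; lra.
have rpos : 0 < r by exact: lt_le_trans r1.
rewrite -(ler_pM2l rpos); apply: (le_trans step).
set L := c0 + _ + _ in IH *.
have -> : r * L = L + eta * D * L by rewrite /r; ring.
apply: lerD => //.
apply: (@le_trans _ _ (eta * D * ((1 + eta) * C / eta))); last first.
  by rewrite ler_wpM2l// lerDr addr_ge0.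
have -> : eta * D * ((1 + eta) * C / eta) = (1 + eta) * (D * C) by field; rewrite gt_eqF.
rewrite -mulrA ler_wpM2r ?mulr_ge0 ?(ltW D0)// lerD2l.
by rewrite -[leRHS]mulr1 ler_wpM2l// ltW.
Qed.

End Gronwall.

(** * Measurability *)

Section MeasurabilityTools.
Context {R : realType}.

Lemma measurable_comp_countable d (T : measurableType d) (I : countType) (Z : T -> I) (Y : I -> R) :
  (forall z, measurable (Z @^-1` [set z])) -> measurable_fun setT (Y \o Z).
Proof.
move=> mZ _ A _; rewrite setTI.
have -> : (Y \o Z) @^-1` A = \bigcup_i (if `[< A (Y i) >] then Z @^-1` [set i] else set0).
  apply/seteqP; split => [x Ax|x [i _]]; first by exists (Z x) => //; rewrite asboolT.
  by case: ifPn => // /asboolP Ai /= ->.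
apply: countable_bigcupT_measurable; first exact: countableP.
by move=> i; case: ifP.
Qed.

Lemma measurable_floor_preimage d (T : measurableType d) (x : T -> R) (z : int) :
  measurable_fun setT x -> measurable [set w | Num.floor (x w) = z].
Proof.
move=> mx; have -> : [set w | Num.floor (x w) = z] = x @^-1` [set` `[z%:~R, (z + 1)%:~R[ ].
  apply/seteqP; split => w /=; rewrite in_itv/=.
    by move=> <-; rewrite floor_le_tmp floorD1_gt.
  exact: floor_def.
by rewrite -[X in measurable X]setTI; exact: mx.
Qed.

Lemma coord_le_vnorm n (x : 'cV[R]_n) c : `|x c 0| <= vnorm x.
Proof.
rewrite -(@ler_pXn2r _ 2)// ?nnegrE ?vnorm_ge0// sqr_normr vnorm_sqE (bigD1 c)//= lerDl.
by apply: sumr_ge0 => *; exact: sqr_ge0.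
Qed.

Lemma coord_le_mnorm n d (G : 'M[R]_(n, d)) i j : `|G i j| <= mnorm G.
Proof.
rewrite -(@ler_pXn2r _ 2)// ?nnegrE ?sqrtr_ge0// sqr_normr mnorm_sqE.
rewrite (bigD1 i)//= (bigD1 j)//= -addrA lerDl addr_ge0//.
  by apply: sumr_ge0 => *; exact: sqr_ge0.
by apply: sumr_ge0 => *; apply: sumr_ge0 => *; exact: sqr_ge0.
Qed.

Lemma vnorm_le_coord n (x : 'cV[R]_n) e : 0 <= e -> (forall c, `|x c 0| <= e) ->
  vnorm x <= n%:R * e.
Proof.
move=> e0 xe; rewrite -(@ler_pXn2r _ 2)// ?nnegrE ?vnorm_ge0 ?mulr_ge0// vnorm_sqE.
apply: (@le_trans _ _ (\sum_(i < n) e ^+ 2)).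
  by apply: ler_sum => i _; rewrite -sqr_normr ler_pXn2r ?nnegrE.
rewrite sumr_const card_ord -[X in X <= _]mulr_natl exprMn ler_wpM2r ?sqr_ge0//.
by rewrite -natrX ler_nat; case: n {x xe} => // n; rewrite leq_pmulr.
Qed.

Lemma measurable_vnorm d (T : measurableType d) n (x : T -> 'cV[R]_n) :
  (forall c, measurable_fun setT (fun w => x w c 0)) ->
  measurable_fun setT (fun w => vnorm (x w)).
Proof.
move=> mx; have -> : (fun w => vnorm (x w)) = (fun w => (\sum_i x w i 0 ^+ 2) `^ 2^-1).
  by apply/funext => w; rewrite powR12_sqrt// sumr_ge0// => i _; exact: sqr_ge0.
apply: measurableT_comp (measurable_powR _) _.
by apply: measurable_sum => i; apply: measurable_funX.
Qed.

End MeasurabilityTools.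

Section YbarMeasurable.
Context {R : realType} {n : nat} (tau : R) (N : nat).
Hypotheses (tau0 : 0 < tau) (N0 : (0 < N)%N).
Local Notation Yb := (@Ybar R n tau N).

Lemma Ybar_dist h h' k e : 0 <= e ->
  (forall i, (i <= N)%N -> vnorm (h (k + i)%N - h' (k + i)%N) <= e) ->
  vnorm (Yb h k 0 - Yb h' k 0) +
    tau^-1 * Iseg tau (fun th => vnorm (Yb h k th - Yb h' k th)) <= 2 * e.
Proof.
move=> e0 he; have hB th : - tau <= th <= 0 ->
    Yb h k th - Yb h' k th = Yb (fun i => h i - h' i) k th.
  move=> ht; rewrite !YbarE// -sumrB; apply: eq_bigr => i _.
  by rewrite scalerBr.
have hle th : - tau <= th <= 0 -> vnorm (Yb h k th - Yb h' k th) <= e.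
  by move=> ht; rewrite hB//; apply: (Ybar_vnorm_le tau0 N0 e0 he).
have t00 : - tau <= (0 : R) <= 0 by rewrite oppr_le0 ltW/=.
rewrite mulr_natl mulr2n; apply: lerD; first exact: hle.
have -> : e = tau^-1 * (e * tau) by rewrite mulrCA mulVf ?mulr1// gt_eqF.
rewrite ler_wpM2l ?invr_ge0 ?(ltW tau0)// -Iseg_cst//.
apply: Iseg_le => //; last exact: bmeas_cst.
apply: (bmeas_eq (u := fun th => vnorm (Yb (fun i => h i - h' i) k th))).
  by move=> th ht; rewrite hB.
by apply: bmeas_vnorm => // c; exact: bmeas_Ybar.
Qed.

(** Node values are rounded down to multiples of [1 / (j + 1)]. The rounded segment takes countably
    many values, so [Phi] of it is measurable, and the Lipschitz bound gives convergence as [j]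
    grows. The radius exceeds [l] by [n] because rounding moves a node by at most [n / (j + 1)]. *)
Lemma measurable_Ybar_comp d (T : measurableType d) (H : T -> nat -> 'cV[R]_n) k l C
    (Phi : (R -> 'cV[R]_n) -> R) : 0 <= l -> 0 <= C ->
  (forall i c, (i <= N)%N -> measurable_fun setT (fun w => H w (k + i)%N c 0)) ->
  (forall w i, (i <= N)%N -> vnorm (H w (k + i)%N) <= l) ->
  (forall phi phi', in_C tau phi -> in_C tau phi' ->
     supnorm_le tau phi (l + n%:R) -> supnorm_le tau phi' (l + n%:R) ->
     `|Phi phi - Phi phi'| <= C * (vnorm (phi 0 - phi' 0) +
        tau^-1 * Iseg tau (fun th => vnorm (phi th - phi' th)))) ->
  measurable_fun setT (fun w => Phi (Yb (H w) k)).
Proof.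
move=> l0 C0 mH bH hPhi.
pose Z j w : {ffun 'I_N.+1 * 'I_n -> int} :=
  [ffun p : 'I_N.+1 * 'I_n => Num.floor (j.+1%:R * H w (k + p.1)%N p.2 0)].
pose G j (z : {ffun 'I_N.+1 * 'I_n -> int}) (i : nat) : 'cV[R]_n :=
  \col_c ((z (inord (i - k), c))%:~R / j.+1%:R).
have close j w i : (i <= N)%N -> vnorm (H w (k + i)%N - G j (Z j w) (k + i)%N) <= n%:R * j.+1%:R^-1.
  move=> iN; apply: vnorm_le_coord; first by rewrite invr_ge0.
  move=> c; rewrite !mxE ffunE/= addKn inordK ?ltnS//.
  set x := H w (k + i)%N c 0; have j0 : 0 < j.+1%:R :> R by rewrite ltr0n.
  have := floor_le_tmp (j.+1%:R * x); have := floorD1_gt (j.+1%:R * x); rewrite intrD.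
  move: (Num.floor _)%:~R => y h1 h2.
  have -> : x - y / j.+1%:R = (j.+1%:R * x - y) / j.+1%:R by field; rewrite gt_eqF.
  rewrite normrM [`|_^-1|]ger0_norm ?invr_ge0 ?(ltW j0)// -[leRHS]mul1r ler_wpM2r ?invr_ge0 ?(ltW j0)//.
  by rewrite ger0_norm; lra.
have small j : n%:R * j.+1%:R^-1 <= n%:R :> R.
  by rewrite ler_piMr// invf_le1 ?ltr0n// ler1n.
have bG j w i : (i <= N)%N -> vnorm (G j (Z j w) (k + i)%N) <= l + n%:R.
  move=> iN; have := close j w i iN; have := bH w i iN; have := small j.
  set u := H w _; set v := G _ _ _ => s1 s2 s3.
  have h1 := vnorm_ge0 u; have h2 := vnorm_ge0 (u - v).
  rewrite -(@ler_pXn2r _ 2)// ?nnegrE ?vnorm_ge0 ?addr_ge0//.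
  have cs := vdot_cauchy_schwarz u (u - v).
  have -> : v = u - (u - v) by rewrite opprB addrC subrK.
  rewrite vnormB_sq; move: cs; rewrite -exprMn => cs.
  have : - vdot u (u - v) <= vnorm u * vnorm (u - v).
    rewrite (le_trans (ler_norm _))// normrN -(@ler_pXn2r _ 2)// ?nnegrE ?mulr_ge0//.
    by rewrite sqr_normr.
  have t : vnorm u + vnorm (u - v) <= l + n%:R by exact: lerD s2 (le_trans s3 s1).
  have t2 : (vnorm u + vnorm (u - v)) ^+ 2 <= (l + n%:R) ^+ 2.
    by rewrite ler_pXn2r// nnegrE addr_ge0.
  move=> h; apply: le_trans t2; rewrite sqrrD mulr_natl; lra.
apply: (measurable_fun_cvg (h := fun j w => Phi (Yb (G j (Z j w)) k))) => [j|w _].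
  apply: (measurable_comp_countable (Z := Z j) (fun z => Phi (Yb (G j z) k))) => z.
  have -> : Z j @^-1` [set z] = \bigcap_(p in [set: 'I_N.+1 * 'I_n])
      [set w | Num.floor (j.+1%:R * H w (k + p.1)%N p.2 0) = z p].
    apply/seteqP; split => [w /= <- p _ /=|w h /=]; first by rewrite ffunE.
    by apply/ffunP => p; rewrite ffunE; exact: h.
  apply: fin_bigcap_measurable => // p _.
  apply: measurable_floor_preimage; apply: measurable_funM; first exact: measurable_cst.
  by apply: mH; rewrite -ltnS.
have cvg0 : C * (2 * (n%:R * j.+1%:R^-1)) @[j --> \oo] --> (0 : R).
  rewrite -[X in _ --> X](mulr0 C); apply: cvgM; first exact: cvg_cst.
  rewrite -[X in _ --> X](mulr0 2); apply: cvgM; first exact: cvg_cst.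
  rewrite -[X in _ --> X](mulr0 n%:R); apply: cvgM; first exact: cvg_cst.
  exact: cvg_harmonic.
have bnd j : `|Phi (Yb (H w) k) - Phi (Yb (G j (Z j w)) k)| <= C * (2 * (n%:R * j.+1%:R^-1)).
  apply: (le_trans (hPhi _ _ _ _ _ _)); try exact: Ybar_in_C.
  - apply: Ybar_vnorm_le => // [|i iN]; first by rewrite addr_ge0.
    by rewrite (le_trans (bH _ _ iN))// lerDl.
  - by apply: Ybar_vnorm_le => //; [rewrite addr_ge0|exact: bG].
  - by rewrite ler_wpM2l//; apply: Ybar_dist; [rewrite mulr_ge0 ?invr_ge0|exact: close].
set a := Phi _ in bnd *.
apply: (@squeeze_cvgr _ _ _ _ (fun j => a - C * (2 * (n%:R * j.+1%:R^-1)))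
  (fun j => a + C * (2 * (n%:R * j.+1%:R^-1)))).
- by apply: nearW => j; have := bnd j; move: (C * _) (Phi (Yb (G _ _) k)) => c y; rewrite ler_norml => /andP[? ?]; apply/andP; split; lra.
- by rewrite -[X in _ --> X]subr0; apply: cvgB => //; exact: cvg_cst.
- by rewrite -[X in _ --> X]addr0; apply: cvgD => //; exact: cvg_cst.
Qed.

(** Equality holds on the whole line, because [f] and [g] receive the function itself; the clamped
    index never leaves the [N + 1] nodes. *)
Lemma Ybar_ext h h' k : (forall i, (i <= N)%N -> h (k + i)%N = h' (k + i)%N) ->
  Yb h k = Yb h' k.
Proof.
move=> hh; apply/funext => th; rewrite /Ybar; set j : int := Num.max _ _.
have jN : - N%:Z <= j by rewrite /j le_max lexx.
have j1 : j <= -1.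
  by rewrite /j ge_max ge_min lexx orbT andbT lerNl opprK lez_nat.
have jn0 : 0 <= j + N%:Z by rewrite -lerBlDr sub0r.
set jn := `|(j + N%:Z)%R|%N.
have jnE : j + N%:Z = jn%:Z by rewrite /jn gez0_abs.
have jnN : (jn < N)%N.
  by rewrite -ltz_nat -jnE -ltrBrDr subrr; apply: le_lt_trans j1 _.
by rewrite -addnS !hh// ltnW.
Qed.

End YbarMeasurable.

(** * Moments of the truncated scheme *)

Section BoundedExpectation.
Context {R : realType} dO (Omega : measurableType dO) (P : probability Omega R).
Implicit Types u v : Omega -> R.

(** For a fixed step size truncation bounds every node, so expectations are real numbers and
    linearity needs no further integrability check. *)
Definition bounded_rv u := measurable_fun setT u /\ exists M, forall w, `|u w| <= M.

Definition Ex u : R := (\int[P]_w u w)%R.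

Lemma bounded_rv_integrable u : bounded_rv u -> P.-integrable setT (EFin \o u).
Proof.
move=> [mu [M uM]]; apply: measurable_bounded_integrable => //.
  by rewrite [X in (X < _)%E]probability_setT ltry.
exists M; split; first by rewrite num_real.
by move=> x Mx w _ /=; apply: le_trans (uM w) _; exact: ltW.
Qed.

Lemma ExE u : bounded_rv u -> (\int[P]_w (u w)%:E)%E = (Ex u)%:E.
Proof.
by move=> /bounded_rv_integrable h; rewrite /Ex /Rintegral fineK// integrable_fin_num.
Qed.

Lemma bounded_rv_cst c : bounded_rv (fun=> c).
Proof. by split; [exact: measurable_cst|exists `|c|]. Qed.

Lemma bounded_rvD u v : bounded_rv u -> bounded_rv v -> bounded_rv (fun w => u w + v w).
Proof.
move=> [mu [M uM]] [mv [M' vM]]; split; first exact: measurable_funD.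
by exists (M + M') => w; rewrite (le_trans (ler_normD _ _))// lerD.
Qed.

Lemma bounded_rvZ c u : bounded_rv u -> bounded_rv (fun w => c * u w).
Proof.
move=> [mu [M uM]]; split; first by apply: measurable_funM => //; exact: measurable_cst.
by exists (`|c| * M) => w; rewrite normrM ler_wpM2l.
Qed.

Lemma bounded_rv_ext u v : u =1 v -> bounded_rv u -> bounded_rv v.
Proof. by move=> /funext ->. Qed.

Lemma bounded_rv_sum m (W : nat -> R) (u : nat -> Omega -> R) : (forall i, bounded_rv (u i)) ->
  bounded_rv (fun w => \sum_(i < m) W i * u i w).
Proof.
move=> h; elim: m => [|m IH].
  by apply: bounded_rv_ext (bounded_rv_cst 0) => w; rewrite big_ord0.
apply: bounded_rv_ext (bounded_rvD IH (bounded_rvZ (W m) (h m))) => w.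
by rewrite big_ord_recr.
Qed.

Lemma ExD u v : bounded_rv u -> bounded_rv v -> Ex (fun w => u w + v w) = Ex u + Ex v.
Proof. by move=> mu mv; rewrite /Ex RintegralD//; exact: bounded_rv_integrable. Qed.

Lemma ExZ c u : bounded_rv u -> Ex (fun w => c * u w) = c * Ex u.
Proof. by move=> mu; rewrite /Ex RintegralZl//; exact: bounded_rv_integrable. Qed.

Lemma Ex_cst c : Ex (fun=> c) = c.
Proof. by rewrite /Ex Rintegral_cst//= probability_setT mulr1. Qed.

Lemma Ex_sum m (W : nat -> R) (u : nat -> Omega -> R) : (forall i, bounded_rv (u i)) ->
  Ex (fun w => \sum_(i < m) W i * u i w) = \sum_(i < m) W i * Ex (u i).
Proof.
move=> h; elim: m => [|m IH].
  by rewrite big_ord0 -[RHS]Ex_cst; congr Ex; apply/funext => w; rewrite big_ord0.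
rewrite big_ord_recr/= -IH -ExZ// -ExD; [|exact: bounded_rv_sum|exact: bounded_rvZ].
by congr Ex; apply/funext => w; rewrite big_ord_recr.
Qed.

Lemma Ex_le u v : bounded_rv u -> bounded_rv v -> (forall w, u w <= v w) -> Ex u <= Ex v.
Proof.
move=> mu mv uv; apply: le_Rintegral; [by []|exact: bounded_rv_integrable|exact: bounded_rv_integrable|].
by move=> w _; exact: uv.
Qed.

Lemma Ex_ge0 u : (forall w, 0 <= u w) -> 0 <= Ex u.
Proof. by move=> u0; apply: Rintegral_ge0. Qed.

End BoundedExpectation.

(** * The scheme indexed by nodes *)

Section TruncatedScheme.
Context {R : realType} {n d : nat} {dO : measure_display} {Omega : measurableType dO}.
Variables (tau : R) (N : nat) (f : (R -> 'cV[R]_n) -> 'cV[R]_n)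
  (g : (R -> 'cV[R]_n) -> 'M[R]_(n, d)) (xi : R -> 'cV[R]_n) (Gam Gaminv : R -> R) (lam : R)
  (B : R -> Omega -> 'cV[R]_d).
Local Notation D := (stepsize tau N).
Local Notation Tr := (Trunc tau N f g Gam Gaminv lam).
Local Notation hi := (hist tau N f g xi Gam Gaminv lam B).

Definition trunc_level := Gaminv (Kconst f g Gam * D `^ (- lam)).
(** Node [i] is the time [t_(i-N)]. The diagonal is legitimate because stage [m] of the history is
    final for all nodes up to [N + m]. *)
Definition grid_value (i : nat) (w : Omega) := hi w i i.

Lemma vnormZ n' (a : R) (x : 'cV[R]_n') : 0 <= a -> vnorm (a *: x) = a * vnorm x.
Proof.
move=> a0; apply/eqP; rewrite -(@eqrXn2 _ 2)// ?vnorm_ge0 ?mulr_ge0 ?vnorm_ge0//.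
by rewrite vnormZ_sq exprMn.
Qed.

Lemma TruncE x : Tr x = (Num.min (vnorm x) trunc_level * (vnorm x)^-1) *: x.
Proof. by rewrite /Trunc; case: eqVneq => [->|//]; rewrite scaler0. Qed.

Lemma vnorm_gt0 n' (x : 'cV[R]_n') : x != 0 -> 0 < vnorm x.
Proof.
move=> x0; rewrite lt_neqAle vnorm_ge0 andbT; apply: contra x0 => /eqP e.
apply/eqP/matrixP => i j; rewrite mxE ord1; apply/eqP; rewrite -normr_le0.
by rewrite e coord_le_vnorm.
Qed.

Lemma vnorm_Trunc x : 0 <= trunc_level -> vnorm (Tr x) = Num.min (vnorm x) trunc_level.
Proof.
move=> l0; have [->|x0] := eqVneq x 0.
  by rewrite /Trunc eqxx vnorm0; apply/esym/min_idPl.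
have v0 := vnorm_gt0 x0.
rewrite TruncE vnormZ; last by rewrite divr_ge0 ?vnorm_ge0// le_min vnorm_ge0.
by rewrite divfK// gt_eqF.
Qed.

Lemma hist_addn w m k i : (i <= N + m)%N -> hi w (m + k)%N i = hi w m i.
Proof.
move=> im; elim: k => [|k IH]; first by rewrite addn0.
by rewrite addnS/= ifT// addnA (leq_trans im)// leq_addr.
Qed.

Lemma hist_grid_value w m i : (i <= N + m)%N -> hi w m i = grid_value i w.
Proof.
move=> im; rewrite -(hist_addn w i im) addnC hist_addn//.
exact: leq_addl.
Qed.

Lemma grid_value_init w i : (i <= N)%N -> grid_value i w = Tr (xi ((i%:R - N%:R) * D)).
Proof. by move=> iN; rewrite -(@hist_grid_value w 0 i)// addn0. Qed.

Lemma grid_value_step w m : (0 < N)%N -> grid_value (N + m).+1 w =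
  Tr (grid_value (N + m) w + D *: f (Ybar tau N (grid_value ^~ w) m) +
      g (Ybar tau N (grid_value ^~ w) m) *m bm_inc B D m w).
Proof.
move=> N0; rewrite -(@hist_grid_value w m.+1) ?addnS//= ltnn hist_grid_value//.
have -> // : Ybar tau N (hi w m) m = Ybar tau N (grid_value ^~ w) m.
by apply: (Ybar_ext _ N0) => i iN; rewrite hist_grid_value// addnC leq_add2r.
Qed.

Lemma vnorm_grid_value_le w i : (0 < N)%N -> 0 <= trunc_level -> vnorm (grid_value i w) <= trunc_level.
Proof.
move=> N0 l0; have [iN|iN] := leqP i N.
  by rewrite grid_value_init// vnorm_Trunc// ge_min lexx orbT.
have -> : i = (N + (i - N.+1)).+1 by rewrite -addSn subnKC.
by rewrite grid_value_step// vnorm_Trunc// ge_min lexx orbT.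
Qed.

Lemma measurable_Trunc dT (T : measurableType dT) (x : T -> 'cV[R]_n) :
  (forall c, measurable_fun setT (fun w => x w c 0)) ->
  forall c, measurable_fun setT (fun w => Tr (x w) c 0).
Proof.
move=> mx c; have mv := measurable_vnorm mx.
have -> : (fun w => Tr (x w) c 0) =
    (fun w => Num.min (vnorm (x w)) trunc_level * vnorm (x w) `^ (- 1) * x w c 0).
  by apply/funext => w; rewrite TruncE mxE powR_inv1 ?vnorm_ge0.
apply: measurable_funM => //; apply: measurable_funM.
  by apply: measurable_minr => //; exact: measurable_cst.
exact: measurableT_comp (measurable_powR _) mv.
Qed.

End TruncatedScheme.

(** * The moment recursion and its uniform bound *)

Section MomentStep.
Context {R : realType} {n d : nat} {dO : measure_display} {Omega : measurableType dO}.
Variables (P : probability Omega R) (tau : R) (f : (R -> 'cV[R]_n) -> 'cV[R]_n)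
  (g : (R -> 'cV[R]_n) -> 'M[R]_(n, d)) (xi : R -> 'cV[R]_n) (Gam Gaminv : R -> R) (lam : R)
  (B : R -> Omega -> 'cV[R]_d).
Variables (p varrho a1 a2 a3 : R) (rho1 : R -> R).
Hypotheses (tau0 : 0 < tau) (cxi : in_C tau xi) (hB : is_BM P B) (hA1 : A1 tau f g)
  (hA2 : A2 tau f g p varrho a1 a2 a3 rho1) (hGam : Gamma_ok tau f g Gam)
  (hGinv : Ginv_ok Gam Gaminv) (lam01 : 0 < lam < 1 / 2).
Local Notation q := (p / 2).
Local Notation r := (1 + varrho / 2).
Local Notation s := (q - 1 + r).
Local Notation K := (Kconst f g Gam).
Local Notation Y N := (grid_value tau N f g xi Gam Gaminv lam B).
Local Notation level N := (trunc_level tau N f g Gam Gaminv lam).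

Definition lyap N i w := 1 + vnorm (Y N i w) ^+ 2.

Lemma lyap_ge1 N i w : 1 <= lyap N i w.
Proof. by rewrite lerDl sqr_ge0. Qed.

Lemma Kconst_ge : [/\ 0 <= K, Gam 1 <= K, vnorm (f (fun=> 0)) <= K & mnorm (g (fun=> 0)) ^+ 2 <= K].
Proof.
have [G0 _ _ _ _] := hGam; rewrite /Kconst; split; rewrite !le_max ?lexx ?orbT//.
by rewrite G0.
Qed.

Section FixedStep.
Variable N : nat.
Hypothesis tauN : tau <= N%:R.
Local Notation D := (stepsize tau N).

Lemma node_count_gt0 : (0 < N)%N.
Proof. by rewrite -(ltr_nat R); exact: lt_le_trans tauN. Qed.
Let N0 := node_count_gt0.

Lemma stepsize_in01 : 0 < D <= 1.
Proof. by rewrite stepsize_gt0//= ler_pdivrMr ?mul1r// ltr0n. Qed.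

(** Since [D <= 1]. This puts the argument of [Gaminv] into its domain and lets the growth constant
    dominate the coefficients at 0. *)
Lemma Kconst_le_step : K <= K * D `^ (- lam).
Proof.
have [K0 _ _ _] := Kconst_ge; rewrite ler_peMr//.
have /andP[D0 D1] := stepsize_in01; have /andP[l0 _] := lam01.
rewrite -(powRr0 D); apply: ger_powR; first exact: stepsize_in01.
by rewrite oppr_le0 ltW.
Qed.

Lemma trunc_levelP : 1 <= level N /\ Gam (level N) = K * D `^ (- lam).
Proof.
by apply: hGinv; have [_ h _ _] := Kconst_ge; apply: le_trans h Kconst_le_step.
Qed.

Lemma trunc_level_ge0 : 0 <= level N.
Proof. by have [h _] := trunc_levelP; exact: le_trans h. Qed.

Lemma grid_value_bound i w : vnorm (Y N i w) <= level N.
Proof. exact: vnorm_grid_value_le N0 trunc_level_ge0. Qed.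

(** The measurable space is a parameter because the lemma is applied with the past of [m] and with
    the past of [m + 1] increments. *)
Lemma measurable_coef dT (T : measurableType dT) (H : T -> nat -> 'cV[R]_n) k :
  (forall i c, (i <= N)%N -> measurable_fun setT (fun w => H w (k + i)%N c 0)) ->
  (forall w i, (i <= N)%N -> vnorm (H w (k + i)%N) <= level N) ->
  (forall c, measurable_fun setT (fun w => f (Ybar tau N (H w) k) c 0)) /\
  (forall c j, measurable_fun setT (fun w => g (Ybar tau N (H w) k) c j)).
Proof.
move=> mH bH; have l0 := trunc_level_ge0; have [l1 _] := trunc_levelP.
have ln0 : 0 < level N + n%:R by rewrite ltr_pwDl// (lt_le_trans ltr01 l1).
have [C [C0 hC]] := hA1 ln0.
split=> c; [|move=> j].
  apply: (measurable_Ybar_comp tau0 N0 (Phi := fun phi => f phi c 0) l0 (ltW C0) mH bH).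
  move=> phi phi' c1 c2 b1 b2; apply: le_trans (hC _ _ c1 c2 b1 b2).
  apply: (@le_trans _ _ (vnorm (f phi - f phi'))); last by rewrite le_max lexx.
  by have := coord_le_vnorm (f phi - f phi') c; rewrite !mxE.
apply: (measurable_Ybar_comp tau0 N0 (Phi := fun phi => g phi c j) l0 (ltW C0) mH bH).
move=> phi phi' c1 c2 b1 b2; apply: le_trans (hC _ _ c1 c2 b1 b2).
apply: (@le_trans _ _ (mnorm (g phi - g phi'))); last by rewrite le_max lexx orbT.
by have := coord_le_mnorm (g phi - g phi') c j; rewrite !mxE.
Qed.

(** Adaptedness: older nodes pass to the larger sigma-algebra, and the newest node is a function of
    them and of the last increment. *)
Lemma measurable_grid_value m i c : (i <= N + m)%N ->
  measurable_fun setT (fun w : pastType B D m => Y N i w c 0).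
Proof.
elim: m i c => [|m IH] i c.
  rewrite addn0 => iN; under eq_fun do rewrite grid_value_init//.
  exact: measurable_cst.
rewrite addnS leq_eqVlt ltnS => /predU1P[->|im]; last first.
  exact: (measurableT_comp (IH _ c im) (@measurable_past_succ _ _ _ _ B D m)).
have mY i' c' : (i' <= N + m)%N -> measurable_fun setT (fun w : pastType B D m.+1 => Y N i' w c' 0).
  by move=> im; exact: (measurableT_comp (IH _ c' im) (@measurable_past_succ _ _ _ _ B D m)).
have [mf mg] := @measurable_coef _ (pastType B D m.+1) (fun w i => Y N i w) m
  (fun i' c' h => mY (m + i')%N c' (ltac:(by rewrite addnC leq_add2r)))
  (fun w i' _ => grid_value_bound (m + i')%N w).
under eq_fun do rewrite grid_value_step//.
apply: measurable_Trunc => c'.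
have -> : (fun w : pastType B D m.+1 => (Y N (N + m) w + D *: f (Ybar tau N ((Y N) ^~ w) m) +
      g (Ybar tau N ((Y N) ^~ w) m) *m bm_inc B D m w) c' 0) =
   (fun w : pastType B D m.+1 => Y N (N + m) w c' 0 + D * f (Ybar tau N ((Y N) ^~ w) m) c' 0 +
      \sum_j g (Ybar tau N ((Y N) ^~ w) m) c' j * bm_inc B D m w j 0).
  by apply/funext => w; rewrite !mxE.
apply: measurable_funD; first apply: measurable_funD.
- exact: mY.
- by apply: measurable_funM; [exact: measurable_cst|exact: mf].
- by apply: measurable_sum => j; apply: measurable_funM; [exact: mg|exact: measurable_past_last].
Qed.

Lemma measurable_grid_valueT i c : measurable_fun setT (fun w => Y N i w c 0).
Proof.
have h := @measurable_grid_value i i c (leq_addl N i).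
have /andP[D0 _] := stepsize_in01.
exact: (measurableT_comp h (@measurable_past _ _ _ P _ B D D0 hB i)).
Qed.

Lemma bounded_lyap_powR e i : 0 <= e -> bounded_rv (fun w => lyap N i w `^ e).
Proof.
move=> e0; split.
  apply: measurableT_comp (measurable_powR e) _.
  apply: measurable_funD; first exact: measurable_cst.
  by apply: measurable_funX; apply: measurable_vnorm => c; exact: measurable_grid_valueT.
exists ((1 + level N ^+ 2) `^ e) => w; rewrite ger0_norm ?powR_ge0//.
rewrite ge0_ler_powR ?nnegrE ?addr_ge0 ?sqr_ge0//.
by rewrite lerD2l ler_pXn2r ?nnegrE ?vnorm_ge0 ?trunc_level_ge0 ?grid_value_bound.
Qed.

(* Conditioning on the past: independence replaces the driving increment by an
   independent copy, with the present state frozen. *)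
Lemma integral_lyap_succ m e : 0 <= e ->
  let V w w' := (1 + vnorm (Y N (N + m) w + D *: f (Ybar tau N ((Y N) ^~ w) m) +
      g (Ybar tau N ((Y N) ^~ w) m) *m bm_inc B D m w') ^+ 2) `^ e in
  measurable_fun setT (fun w => \int[P]_w' (V w w')%:E)%E /\
  (\int[P]_w (lyap N (N + m).+1 w `^ e)%:E <= \int[P]_w \int[P]_w' (V w w')%:E)%E.
Proof.
move=> e0 V; have /andP[D0 _] := stepsize_in01.
have l0 := trunc_level_ge0.
have mY i c : (i <= N)%N -> measurable_fun setT (fun w : pastType B D m => Y N (m + i) w c 0).
  by move=> im; apply: measurable_grid_value; rewrite addnC leq_add2r.
have [mf mg] := @measurable_coef _ (pastType B D m) (fun w i => Y N i w) m mY
  (fun w i _ => grid_value_bound (m + i)%N w).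
pose F (z : pastType B D m * vecType (R:=R) (d:=d)) : \bar R :=
  ((1 + vnorm (Y N (N + m) z.1 + D *: f (Ybar tau N ((Y N) ^~ z.1) m) +
      g (Ybar tau N ((Y N) ^~ z.1) m) *m z.2) ^+ 2) `^ e)%:E.
have mF : measurable_fun setT F.
  apply/measurable_EFinP; apply: measurableT_comp (measurable_powR e) _.
  apply: measurable_funD; first exact: measurable_cst.
  apply: measurable_funX; apply: measurable_vnorm => c.
  have -> : (fun z : pastType B D m * vecType (R:=R) (d:=d) =>
      (Y N (N + m) z.1 + D *: f (Ybar tau N ((Y N) ^~ z.1) m) +
      g (Ybar tau N ((Y N) ^~ z.1) m) *m z.2) c 0) =
    (fun z => Y N (N + m) z.1 c 0 + D * f (Ybar tau N ((Y N) ^~ z.1) m) c 0 +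
      \sum_j g (Ybar tau N ((Y N) ^~ z.1) m) c j * vec_coord j z.2).
    by apply/funext => z; rewrite !mxE.
  apply: measurable_funD; first apply: measurable_funD.
  - exact: (measurableT_comp (@measurable_grid_value m (N + m) c (leqnn _)) measurable_fst).
  - apply: measurable_funM; first exact: measurable_cst.
    exact: (measurableT_comp (mf c) measurable_fst).
  - apply: measurable_sum => j; apply: measurable_funM.
      exact: (measurableT_comp (mg c j) measurable_fst).
    exact: (measurableT_comp (@measurable_rect_coord R _ _ (@vec_coord R d) j) measurable_snd).
have F0 z : (0 <= F z)%E by rewrite lee_fin powR_ge0.
have [h1 h2] := ge0_independent_fubini (@measurable_past _ _ _ P _ B D D0 hB m) (@measurable_bm_inc_vec _ _ _ P _ B D D0 hB m)
  (@bm_inc_independent _ _ _ P _ B D D0 hB m) mF F0.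
split; first exact: h1.
rewrite -h2; apply: ge0_le_integral; [by []| | | |].
- by move=> w _; rewrite lee_fin powR_ge0.
- by apply/measurable_EFinP; have [] := bounded_lyap_powR (N + m).+1 e0.
- apply: (measurableT_comp mF); apply/measurable_fun_pairP; split.
    exact: (@measurable_past _ _ _ P _ B D D0 hB m).
  exact: (@measurable_bm_inc_vec _ _ _ P _ B D D0 hB m).
(* The inequality is pointwise: truncation does not increase the norm. *)
- move=> w _; rewrite lee_fin ge0_ler_powR ?nnegrE ?addr_ge0 ?sqr_ge0//.
  rewrite lerD2l ler_pXn2r ?nnegrE ?vnorm_ge0// grid_value_step// vnorm_Trunc//.
  by rewrite ge_min lexx.
Qed.

End FixedStep.

Local Notation weight0 N := (node_weight tau N (fun=> tau^-1)).
Local Notation weight1 N := (node_weight tau N rho1).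

(** The delayed mean square is replaced by a node sum of [lyap] instead of [|Y|^2]: this only
    enlarges [T], and it keeps every base at least 1, as comparing different powers requires. *)
Lemma scheme_step_bounds N m w : tau <= N%:R ->
  let phi := Ybar tau N ((Y N) ^~ w) m in
  let M := Iseg tau (fun th => vnorm (phi th) `^ (2 + varrho) * rho1 th) in
  step_bounds q K lam a1 a3 (stepsize tau N)
    (lyap N (N + m) w + \sum_(i < N.+1) weight0 N i * lyap N (m + i) w) M
    (a2 * (lyap N (N + m) w - 1) `^ r) (Y N (N + m) w) (f phi) (g phi) /\
  M <= \sum_(i < N.+1) weight1 N i * lyap N (m + i) w `^ r.
Proof.
move=> tauN phi M; have N0 := node_count_gt0 tauN.
have [_ [vr0 [a10 [a20 [a30 [_ [rW hA]]]]]]] := hA2.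
have r1 : 1 <= r by rewrite lerDl divr_ge0// ltW.
have [_ rho0 _ _] := rW.
set T := _ + \sum_(i < _) _.
have cphi : in_C tau phi by exact: Ybar_in_C.
have mphi c : bmeas tau (fun th => phi th c 0) by exact: bmeas_Ybar.
have [l1 Gl] := trunc_levelP tauN.
have bphi : supnorm_le tau phi (trunc_level tau N f g Gam Gaminv lam).
  apply: (Ybar_vnorm_le tau0 N0); first exact: trunc_level_ge0 tauN.
  by move=> i _; exact: grid_value_bound.
have phi0 : phi 0 = Y N (N + m) w by rewrite /phi (Ybar0 tau0 N0) addnC.
have w0_ge0 i : 0 <= weight0 N i by apply: node_weight_ge0 => //; exact: inW_cst.
have w1_ge0 i : 0 <= weight1 N i by exact: node_weight_ge0.
have Tge : 1 + sqmass tau phi <= T.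
  rewrite /sqmass phi0 addrA lerD2l; apply: (le_trans (Iseg_Ybar_sq_le tau0 N0 _ _)).
  by apply: ler_sum => i _; rewrite ler_wpM2l// /lyap lerDr.
have [_ _ f0 g0] := Kconst_ge; have KK := Kconst_le_step tauN.
have [hf hg] := growth tau0 hA1 hGam cphi mphi l1 bphi Gl (le_trans f0 KK) (le_trans g0 KK).
have [K0 _ _ _] := Kconst_ge; have KD0 := le_trans K0 KK.
split; last first.
  rewrite /M (_ : 2 + varrho = 2 * r); last by field.
  apply: (le_trans (Iseg_Ybar_powR_le tau0 N0 _ _ rW r1)).
  apply: ler_sum => i _; rewrite ler_wpM2l// ge0_ler_powR ?nnegrE ?sqr_ge0//.
  - exact: le_trans r1.
  - exact: le_trans (lyap_ge1 _ _ _).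
  - by rewrite lerDr.
have w0T : 0 <= \sum_(i < N.+1) weight0 N i * lyap N (m + i) w.
  by apply: sumr_ge0 => i _; rewrite mulr_ge0// (le_trans ler01)// lyap_ge1.
split.
- by rewrite lerDl.
- split; last by rewrite mulr_ge0 ?powR_ge0// ltW.
  by apply: Iseg_ge0 => th ht; rewrite mulr_ge0 ?powR_ge0 ?rho0.
- by apply: (le_trans hf); rewrite ler_wpM2l// mulr_ge0 ?sqr_ge0.
- by apply: (le_trans hg); rewrite ler_wpM2l// mulr_ge0.
- have := hA _ cphi; rewrite phi0 -/(vdot _ _) -/M => h.
  have -> : 2 * q - 1 = p - 1 by field.
  apply: (le_trans h); rewrite lerD2r (_ : lyap _ _ _ - 1 = vnorm (Y N (N + m) w) ^+ 2); last first.
    by rewrite /lyap addrC addrA addNr add0r.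
  rewrite -vnorm_powR_sq (_ : 2 * r = 2 + varrho); last by field.
  rewrite lerD2r ler_wpM2l ?(ltW a10)//.
  by apply: le_trans Tge; rewrite /sqmass phi0 addrA.
Qed.

Lemma moment_step : exists b2 b3 b4 C D0, [/\ 0 <= b3, 0 <= b4, b3 + b4 < b2, 0 <= C /\ 0 < D0 &
  forall N m, tau <= N%:R -> stepsize tau N <= D0 ->
  Ex P (fun w => lyap N (N + m).+1 w `^ q) <= Ex P (fun w => lyap N (N + m) w `^ q) +
    stepsize tau N * (- b2 * Ex P (fun w => lyap N (N + m) w `^ s) +
      \sum_(i < N.+1) (b3 * weight1 N i + b4 * weight0 N i) * Ex P (fun w => lyap N (m + i) w `^ s) + C)].
Proof.
have [p2 [vr0 [a10 [a20 [a30 [a32 [rW _]]]]]]] := hA2.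
have q1 : 1 <= q by rewrite ler_pdivlMr// mul1r.
have q0 : 0 <= q by exact: le_trans q1.
have r1 : 1 < r by rewrite ltrDl divr_gt0.
have s0 : 0 <= s by rewrite addr_ge0 ?subr_ge0// ltW// (lt_trans ltr01).
have [K0 _ _ _] := Kconst_ge.
have [e [b2 [b3 [b4 [e0 b30 b40 b234 hdrift]]]]] := drift_algebra q1 r1 (ltW a10) (ltW a30) a32.
have [C [D0 [C0 D00 hstep]]] := integral_step_drift hB q1 K0 lam01 (ltW a10) (ltW a30) e0.
have [C' C'0 hC'] := hdrift C C0.
exists b2, b3, b4, C', D0; split => // N m tauN DD0.
have N0 := node_count_gt0 tauN; have D01 := stepsize_in01 tauN; have /andP[Dp _] := D01.
have bA i : bounded_rv (fun w => lyap N i w `^ q) by exact: bounded_lyap_powR.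
have bS i : bounded_rv (fun w => lyap N i w `^ s) by exact: bounded_lyap_powR.
pose W i := b3 * weight1 N i + b4 * weight0 N i.
have bsum : bounded_rv (fun w => \sum_(i < N.+1) W i * lyap N (m + i) w `^ s).
  exact: (bounded_rv_sum N.+1 W (u := fun i w => lyap N (m + i) w `^ s) (fun i => bS (m + i)%N)).
have bdr : bounded_rv (fun w => - b2 * lyap N (N + m) w `^ s +
    \sum_(i < N.+1) W i * lyap N (m + i) w `^ s + C').
  by apply: bounded_rvD; [apply: bounded_rvD => //; exact: bounded_rvZ|exact: bounded_rv_cst].
have bR : bounded_rv (fun w => lyap N (N + m) w `^ q + stepsize tau N *
   (- b2 * lyap N (N + m) w `^ s + \sum_(i < N.+1) W i * lyap N (m + i) w `^ s + C')).
  by apply: bounded_rvD => //; exact: bounded_rvZ.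
have -> : Ex P (fun w => lyap N (N + m) w `^ q) + stepsize tau N *
    (- b2 * Ex P (fun w => lyap N (N + m) w `^ s) +
      \sum_(i < N.+1) (b3 * weight1 N i + b4 * weight0 N i) * Ex P (fun w => lyap N (m + i) w `^ s) + C') =
  Ex P (fun w => lyap N (N + m) w `^ q + stepsize tau N *
   (- b2 * lyap N (N + m) w `^ s + \sum_(i < N.+1) W i * lyap N (m + i) w `^ s + C')).
  rewrite ExD//; last exact: bounded_rvZ.
  rewrite ExZ// ExD//; [|by apply: bounded_rvD => //; exact: bounded_rvZ|exact: bounded_rv_cst].
  rewrite ExD//; last exact: bounded_rvZ.
  by rewrite ExZ// Ex_cst (Ex_sum P N.+1 W (u := fun i w => lyap N (m + i) w `^ s) (fun i => bS (m + i)%N)).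
rewrite -lee_fin -!ExE//.
have [mV hV] := integral_lyap_succ tauN m q0.
apply: (le_trans hV).
(* With the past frozen, the one-step estimate and Young's inequality are applied path by path; the
   outer expectation comes last. *)
have key w : (\int[P]_w' ((1 + vnorm (Y N (N + m) w + stepsize tau N *: f (Ybar tau N ((Y N) ^~ w) m) +
      g (Ybar tau N ((Y N) ^~ w) m) *m bm_inc B (stepsize tau N) m w') ^+ 2) `^ q)%:E <=
   (lyap N (N + m) w `^ q + stepsize tau N * (- b2 * lyap N (N + m) w `^ s +
     \sum_(i < N.+1) W i * lyap N (m + i) w `^ s + C'))%:E)%E.
  have [hb hM] := scheme_step_bounds m w tauN.
  apply: (le_trans (hstep _ _ _ _ _ _ _ _ m _ D01 DD0 erefl hb)).
  rewrite lee_fin lerD2l ler_wpM2l ?(ltW Dp)//.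
  apply: (hC' N.+1 (fun i => weight0 N i) (fun i => weight1 N i) (fun i => lyap N (m + i) w)) => //.
  - exact: lyap_ge1.
  - by move=> i; exact: lyap_ge1.
  - by move=> i; apply: node_weight_ge0 => //; exact: inW_cst.
  - by move=> i; exact: node_weight_ge0.
  - by apply: node_weight_sum1 => //; exact: inW_cst.
  - exact: node_weight_sum1.
apply: ge0_le_integral; [by []| |exact: mV| |].
- by move=> w _; apply: integral_ge0 => w' _; rewrite lee_fin powR_ge0.
- by apply/measurable_EFinP; have [] := bR.
- by move=> w _; exact: key.
Qed.

(** Uniform in the step size, since truncation only shrinks the initial values and [xi] is bounded
    on the delay interval. *)
Lemma initial_bound : exists2 Xi, 0 <= Xi &
  forall N i w, tau <= N%:R -> (i <= N)%N -> vnorm (Y N i w) <= Xi.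
Proof.
have hM (c : 'I_n) : exists M, forall th, - tau <= th <= 0 -> `|xi th c 0| <= M.
  by apply: within_continuous_bounded => //; exact: cxi.
have [M hMc] := choice hM.
have M0 : 0 <= \sum_c `|M c| by apply: sumr_ge0.
exists (n%:R * \sum_c `|M c|); first by rewrite mulr_ge0.
move=> N i w tauN iN; rewrite grid_value_init// vnorm_Trunc; last exact: trunc_level_ge0.
rewrite ge_min; apply/orP; left; apply: vnorm_le_coord => // c.
have N0 := node_count_gt0 tauN; have D0 := stepsize_gt0 tau0 N0.
apply: (@le_trans _ _ (M c)).
  apply: hMc; apply/andP; split; last first.
    by rewrite mulr_le0_ge0 ?(ltW D0)// subr_le0 ler_nat.
  by rewrite -[X in - X <= _](stepsizeN tau N0) -mulNr ler_wpM2r ?(ltW D0)// lerBrDl subrr.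
rewrite (bigD1 c)//= (le_trans (ler_norm _))// lerDl.
by apply: sumr_ge0.
Qed.

Lemma moment_bound : exists2 L, 0 <= L & forall N j, tau <= N%:R ->
  Ex P (fun w => lyap N j w `^ q) <= L.
Proof.
have [p2 [vr0 [a10 [a20 [a30 [a32 [rW _]]]]]]] := hA2.
have q1 : 1 <= q by rewrite ler_pdivlMr// mul1r.
have q0 : 0 <= q by exact: le_trans q1.
have r1 : 1 < r by rewrite ltrDl divr_gt0.
have s0 : 0 <= s by rewrite addr_ge0 ?subr_ge0// ltW// (lt_trans ltr01).
have qs : q <= s by rewrite -addrA lerDl addrC subr_ge0 ltW.
have [b2 [b3 [b4 [C [D0 [b30 b40 b234 [C0 D00] hstep]]]]]] := moment_step.
have [Xi Xi0 hXi] := initial_bound.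
pose c0 := (1 + Xi ^+ 2) `^ s; have c00 : 0 <= c0 by exact: powR_ge0.
have [L hL] := delay_gronwall tau0 (addr_ge0 b30 b40) b234 c00 C0.
pose Lsmall N := (1 + trunc_level tau N f g Gam Gaminv lam ^+ 2) `^ q.
(* [N > N1] forces [tau / N <= D0]; for the other [N] the sum of all [Lsmall] stands in for their
   maximum. *)
pose N1 := Num.truncn (tau / D0).
have bA N i : tau <= N%:R -> bounded_rv (fun w => lyap N i w `^ q).
  by move=> tauN; exact: bounded_lyap_powR.
have bS N i : tau <= N%:R -> bounded_rv (fun w => lyap N i w `^ s).
  by move=> tauN; exact: bounded_lyap_powR.
have qS N i : tau <= N%:R -> Ex P (fun w => lyap N i w `^ q) <= Ex P (fun w => lyap N i w `^ s).
  move=> tauN; apply: Ex_le => [||w]; [exact: bA|exact: bS|].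
  by apply: ler_powR => //; exact: lyap_ge1.
have init N i : tau <= N%:R -> (i <= N)%N -> Ex P (fun w => lyap N i w `^ s) <= c0.
  move=> tauN iN; rewrite -(Ex_cst P c0); apply: Ex_le => [||w]; [exact: bS|exact: bounded_rv_cst|].
  rewrite (ge0_ler_powR s0) ?nnegrE ?addr_ge0 ?sqr_ge0//.
  by rewrite lerD2l ler_pXn2r ?nnegrE ?vnorm_ge0// hXi.
have Ls0 : 0 <= \sum_(N < N1.+1) Lsmall N by apply: sumr_ge0 => N _; exact: powR_ge0.
exists (`|L| + c0 + \sum_(N < N1.+1) Lsmall N); first by rewrite !addr_ge0.
move=> N j tauN; have N0 := node_count_gt0 tauN.
have [NN1|NN1] := leqP N N1.
  apply: (@le_trans _ _ (Lsmall N)).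
    rewrite -(Ex_cst P (Lsmall N)); apply: Ex_le => [||w]; [exact: bA|exact: bounded_rv_cst|].
    rewrite ge0_ler_powR ?nnegrE ?addr_ge0 ?sqr_ge0//.
    by rewrite lerD2l ler_pXn2r ?nnegrE ?vnorm_ge0 ?trunc_level_ge0 ?grid_value_bound.
  rewrite (bigD1 (Ordinal (NN1 : (N < N1.+1)%N)))//= addrCA lerDl !addr_ge0//.
  by apply: sumr_ge0 => i _; exact: powR_ge0.
have DD0 : stepsize tau N <= D0.
  rewrite ler_pdivrMr ?ltr0n// mulrC -ler_pdivrMr//; apply: ltW.
  apply: (lt_le_trans (truncnS_gt _)); by rewrite ler_nat.
have [jN|jN] := leqP j N.
  apply: (le_trans (qS _ _ tauN)); apply: (le_trans (init _ _ tauN jN)).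
  by rewrite addrAC lerDr addr_ge0.
have -> : j = (N + (j - N))%N by rewrite subnKC// ltnW.
apply: (@le_trans _ _ L); last first.
  by apply: (le_trans (ler_norm L)); rewrite -addrA lerDl addr_ge0.
apply: (hL N (stepsize tau N) (fun i => b3 * weight1 N i + b4 * weight0 N i)
  (fun i => Ex P (fun w => lyap N i w `^ s)) (fun m => Ex P (fun w => lyap N (N + m) w `^ q))).
- exact: stepsize_in01.
- exact: stepsizeN.
- move=> i; rewrite addr_ge0// mulr_ge0//; apply: node_weight_ge0 => //; exact: inW_cst.
- rewrite big_split/= -!mulr_sumr node_weight_sum1// node_weight_sum1// ?mulr1//; exact: inW_cst.
- by move=> i; apply: Ex_ge0 => w; exact: powR_ge0.
- by move=> i; exact: init.
- by move=> m; exact: qS.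
- by move=> m; rewrite addnS; exact: hstep.
Qed.

End MomentStep.

Theorem theorem3p1 (R : realType) (n d : nat) (tau : R)
  (f : (R -> 'cV[R]_n) -> 'cV[R]_n) (g : (R -> 'cV[R]_n) -> 'M[R]_(n, d))
  (xi : R -> 'cV[R]_n)
  (dO : measure_display) (Omega : measurableType dO) (P : probability Omega R)
  (B : R -> Omega -> 'cV[R]_d)
  (p varrho a1 a2 a3 : R) (rho1 : R -> R) (Gam Gaminv : R -> R) (lam : R) :
  0 < tau -> in_C tau xi -> is_BM P B ->
  A1 tau f g -> A2 tau f g p varrho a1 a2 a3 rho1 ->
  Gamma_ok tau f g Gam -> Ginv_ok Gam Gaminv -> 0 < lam < 1 / 2 ->
  exists L : R, 0 < L /\
    forall N : nat, tau <= N%:R ->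
      forall k : int, - (N%:Z) <= k ->
        (\int[P]_w ((powR (vnorm (Yscheme tau N f g xi Gam Gaminv lam B w k)) p)%:E)
           <= L%:E)%E.
Proof.
move=> tau0 cxi hB hA1 hA2 hGam hGinv lam01.
have [L L0 hL] := moment_bound tau0 cxi hB hA1 hA2 hGam hGinv lam01.
exists (L + 1); split; first by rewrite ltr_wpDl.
(* By definition the scheme at [k] is [grid_value] at this shifted index, so the bound over nodes
   applies directly. *)
move=> N tauN k _; set j := `|(k + N%:Z)%R|%N.
have p2 : 2 <= p by have [] := hA2.
have p0 : 0 <= p / 2 by rewrite divr_ge0// (le_trans _ p2).
have bA := bounded_lyap_powR xi tau0 hB hA1 hGam hGinv lam01 tauN j p0.
have mY := measurable_grid_valueT xi tau0 hB hA1 hGam hGinv lam01 tauN j.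
apply: (@le_trans _ _ (\int[P]_w (lyap tau f g xi Gam Gaminv lam B N j w `^ (p / 2))%:E)%E).
  apply: ge0_le_integral; [by []| | | |].
  - by move=> w _; rewrite lee_fin powR_ge0.
  - apply/measurable_EFinP; apply: measurableT_comp (measurable_powR p) _.
    exact: measurable_vnorm.
  - by apply/measurable_EFinP; have [] := bA.
  - move=> w _; rewrite lee_fin -[X in _ `^ X <= _](_ : 2 * (p / 2) = p); last by field.
    by rewrite vnorm_powR_sq ge0_ler_powR ?nnegrE ?addr_ge0 ?sqr_ge0 ?lerDr.
rewrite (ExE P bA) lee_fin; apply: (le_trans (hL N j tauN)).
by rewrite lerDl.
Qed.
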